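(* Let $n\ge 1$ and $N_1,N_2\ge 0$ be integers. Then $AQ_{-N_1}^{N_2}(2n+1)$ is a Koszul algebra.
   Context: The algebra: consider the polynomial ring over $\mathbb{C}$ in variables $f^i[s],g_j[t],h[k]$, $1\le i,j\le n$, $-N_1\le s,t,k\le N_2$. Then $$AQ_{-N_1}^{N_2}(2n+1)=\mathbb{C}[f^i[s],g_j[t],h[k]]/(r[-2N_1],\dots,r[2N_2]),\qquad r[l]=\sum_{s+t=l}\Big(\sum_{i=1}^n f^i[s]g_i[t]+h[s]h[t]\Big),$$ graded by the degree in the variables. It is a quadratic algebra. Koszul property: a graded algebra $A=\bigoplus_{k\ge 0}A_k$ over $\mathbb{C}$ is quadratic if $A_0=\mathbb{C}$, $W=A_1$ generates $A$, and all relations follow from quadratic ones, i.e. $A=T(W)/(R)$ with $R\subset W\otimes W$. The dual quadratic algebra is $A^!=T(W^* )/(R^\perp)$, with $R^\perp\subset W^*\otimes W^*$ the annihilator of $R$. If $A$ is commutative, $R^\perp$ is spanned by anticommutators (symmetric tensors), so $A^!=U(L)$ is the universal enveloping algebra of a graded Lie superalgebra $L=\bigoplus_{k\ge1}L_k$ (with $L_k$ of parity $k$ mod 2) generated by $L_1=W^*$; $L$ is called Koszul dual to $A$. A quadratic commutative algebra $A$ is called Koszul if the cohomology $H(L)$ of the Cartan–Chevalley (Chevalley–Eilenberg) cochain complex $C(L)$ of $L$ with trivial coefficients $\mathbb{C}$ is equal to $A$ (where $A_1=L_1^*$ is the space of cochains dual to $L_1$). This is equivalent to the other standard definitions of a Koszul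 algebra. *)

(* Defs.v *)
From HB Require Import structures.
From mathcomp Require Import all_boot all_order all_fingroup all_algebra.
From mathcomp Require Import boolp reals complex.
From mathcomp Require Import mpoly.
From mathcomp Require monalg.

Set Implicit Arguments.
Unset Strict Implicit.
Unset Printing Implicit Defensive.

Import GRing.Theory Num.Theory.
Local Open Scope ring_scope.

Section Linear.
Variables (K : fieldType) (V : lmodType K).

Definition basis_of_pred (P : V -> Prop) m (e : 'I_m -> V) : Prop :=
  (forall v, P v <-> exists c : 'I_m -> K, v = \sum_i c i *: e i) /\
  (forall c : 'I_m -> K, \sum_i c i *: e i = 0 -> forall i, c i = 0).

(* V is the internal direct sum of the subspaces gr k. *)
Record grading (gr : nat -> V -> Prop) : Prop := {
  grading0 : forall k, gr k 0;
  gradingP : forall k (c : K) u v, gr k u -> gr k v -> gr k (c *: u + v);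
  grading_sum : forall v, exists (N : nat) (c : nat -> V),
    (forall k, gr k (c k)) /\ v = \sum_(k < N) c k;
  grading_direct : forall (N : nat) (c : nat -> V), (forall k, gr k (c k)) ->
    \sum_(k < N) c k = 0 -> forall k, (k < N)%N -> c k = 0 }.

End Linear.

(* [monalg] is only imported in this module: its notations clash with those of
   [mpoly]. *)
Module TensorAlgebra.
Import monalg.

Section TensorAlgebra.
Variable K : fieldType.

(* T(W), for W with a basis indexed by 'I_m: noncommutative polynomials. *)
Definition tensor_alg m := {malg K[{fmonom 'I_m}]}.

(* The tensor of degree 2 with coefficient matrix a. *)
Definition tensor2 m (a : 'M[K]_m) : tensor_alg m :=
  \sum_i \sum_j a i j *: (<< fmu i >> * << fmu j >>).

Definition word_eval m (B : algType K) (v : 'I_m -> B) (u : {fmonom 'I_m}) : B :=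
  \prod_(i <- fmonom_val u) v i.

(* The algebra morphism T(W) -> B sending the i-th basis vector of W to v i. *)
Definition tensor_eval m (B : algType K) (v : 'I_m -> B) (p : tensor_alg m) : B :=
  mmap (in_alg B) (word_eval v) p.

Definition two_sided_ideal (B : nzRingType) (S : B -> Prop) (p : B) : Prop :=
  exists (d : nat) (a s b : 'I_d -> B),
    (forall i, S (s i)) /\ p = \sum_i a i * s i * b i.

(* B = T(W)/(R), where v i is the image in B of the i-th basis vector of W and
   R, a set of tensors in W (x) W, is given by coefficient matrices. *)
Definition presented_by m (B : algType K) (v : 'I_m -> B)
    (R : 'M[K]_m -> Prop) : Prop :=
  (forall b, exists p, tensor_eval v p = b) /\
  (forall p, tensor_eval v p = 0 <->
     two_sided_ideal (fun q => exists2 a, R a & q = tensor2 a) p).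

End TensorAlgebra.
End TensorAlgebra.
Export TensorAlgebra.

Section QuadraticAlgebras.
Variable K : fieldType.

Definition quadratic_rels m (B : algType K) (v : 'I_m -> B) : 'M[K]_m -> Prop :=
  fun a => \sum_i \sum_j a i j *: (v i * v j) = 0.

(* R^\perp, in coordinates with respect to the dual basis of W^*. *)
Definition annihilator m (R : 'M[K]_m -> Prop) : 'M[K]_m -> Prop :=
  fun b => forall a, R a -> \sum_i \sum_j a i j * b i j = 0.

Record quadratic_algebra (A : algType K) (gr : nat -> A -> Prop) m
    (w : 'I_m -> A) : Prop := {
  qa_grading : grading gr;
  qa_mul : forall i j a b, gr i a -> gr j b -> gr (i + j)%N (a * b);
  qa_degree0 : forall a, gr 0%N a <-> exists c : K, a = c%:A;
  qa_degree1 : basis_of_pred (gr 1%N) w;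
  qa_presented : presented_by w (quadratic_rels w) }.

End QuadraticAlgebras.

(* Graded Lie superalgebras L = \bigoplus_(k >= 1) L_k, with L_k of parity k
   mod 2; in characteristic 0 no axiom on [x,x] or [x,[x,x]] has to be added. *)
Record gradedLieSuper (K : numFieldType) := GradedLieSuper {
  lie_car :> lmodType K;
  lie_gr : nat -> lie_car -> Prop;
  lie_br : lie_car -> lie_car -> lie_car;
  lie_grading : grading lie_gr;
  lie_gr0 : forall x, lie_gr 0%N x -> x = 0;
  lie_br_linl : forall (c : K) x y z,
    lie_br (c *: x + y) z = c *: lie_br x z + lie_br y z;
  lie_br_linr : forall (c : K) x y z,
    lie_br z (c *: x + y) = c *: lie_br z x + lie_br z y;
  lie_br_gr : forall i j x y, lie_gr i x -> lie_gr j y ->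
    lie_gr (i + j)%N (lie_br x y);
  lie_br_skew : forall i j x y, lie_gr i x -> lie_gr j y ->
    lie_br x y = - (-1) ^+ (i * j)%N *: lie_br y x;
  lie_jacobi : forall i j k x y z, lie_gr i x -> lie_gr j y -> lie_gr k z ->
    lie_br x (lie_br y z) =
      lie_br (lie_br x y) z + (-1) ^+ (i * j)%N *: lie_br y (lie_br x z) }.

Section LieSuper.
Variables (K : numFieldType) (L : gradedLieSuper K).

Definition generated_in_degree1 : Prop :=
  forall S : L -> Prop, S 0 ->
    (forall (c : K) x y, S x -> S y -> S (c *: x + y)) ->
    (forall x y, S x -> S y -> S (lie_br x y)) ->
    (forall x, lie_gr 1%N x -> S x) -> forall x, S x.

Definition lie_to_assoc (B : algType K) (f : L -> B) : Prop :=
  linear f /\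
  forall i j (x y : L), lie_gr i x -> lie_gr j y ->
    f (lie_br x y) = f x * f y - (-1) ^+ (i * j)%N *: (f y * f x).

(* U, with the map iota : L -> U, is the universal enveloping algebra of L. *)
Definition enveloping (U : algType K) (iota : L -> U) : Prop :=
  lie_to_assoc iota /\
  forall (B : algType K) (f : L -> B), lie_to_assoc f ->
    exists2 F : {lrmorphism U -> B}, (forall x, F (iota x) = f x) &
      forall G : {lrmorphism U -> B}, (forall x, G (iota x) = f x) -> G =1 F.

Definition cochain p := {ffun 'I_p -> L} -> K.

Definition homogeneous p (k : 'I_p -> nat) (x : {ffun 'I_p -> L}) : Prop :=
  forall i, lie_gr (k i) (x i).

Definition multilinear p (f : cochain p) : Prop :=
  forall (i : 'I_p) (x : {ffun 'I_p -> L}) (c : K) (u v : L),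
    let upd (y : L) := [ffun j => if j == i then y else x j] in
    f (upd (c *: u + v)) = c * f (upd u) + f (upd v).

(* The sign produced by reordering x_0, ..., x_(p-1), with x_i of degree k i,
   into x_(s 0), ..., x_(s (p-1)) in the exterior superalgebra. *)
Definition super_sign p (k : 'I_p -> nat) (s : 'S_p) : K :=
  \prod_(i < p) \prod_(j < p | (i < j)%N && (s j < s i)%N)
     (- (-1) ^+ (k (s i) * k (s j))%N).

Definition super_alternating p (f : cochain p) : Prop :=
  forall (k : 'I_p -> nat) x (s : 'S_p), homogeneous k x ->
    f [ffun i => x (s i)] = super_sign k s * f x.

(* C^p(L) = Hom(\Lambda^p L, K), \Lambda in the super sense. *)
Definition is_cochain p (f : cochain p) : Prop :=
  multilinear f /\ super_alternating f.

(* g = df for the Cartan-Chevalley-Eilenberg differential with trivial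
   coefficients. A multilinear map is determined by its values on homogeneous
   arguments, where (indices starting at 0)
     df(x_0, ..., x_p) = \sum_(i < j) (-1)^(j + k_j (k_(i+1) + ... + k_(j-1)))
        f(x_0, ..., x_(i-1), [x_i, x_j], x_(i+1), ..., x_(j-1), x_(j+1), ...).
   Moving the bracket to the first slot, by super-alternation, turns the sign
   into the usual (-1)^(i+j) times the Koszul sign of moving x_i, x_j to the
   front. *)
Definition is_differential p (f : cochain p) (g : cochain p.+1) : Prop :=
  forall (k : 'I_p.+1 -> nat) x, homogeneous k x ->
    g x = \sum_(j < p.+1) \sum_(i < p.+1 | (i < j)%N)
      (-1) ^+ (j + k j * \sum_(l < p.+1 | (i < l < j)%N) k l)%N *
      f [ffun m : 'I_p => if lift j m == i then lie_br (x i) (x j)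
                          else x (lift j m)].

Definition cocycle p (f : cochain p) : Prop :=
  is_cochain f /\ is_differential f (fun=> 0).

Definition coboundary p : cochain p -> Prop :=
  match p with
  | 0 => fun g => forall x, g x = 0
  | q.+1 => fun g =>
      is_cochain g /\ exists f : cochain q, is_cochain f /\ is_differential f g
  end.

Definition cohomologous p (f g : cochain p) : Prop :=
  coboundary (fun x => f x - g x).

(* h is the exterior product of f and g. The sum over (p,q)-shuffles is written
   as a sum over all permutations, each shuffle being counted p! q! times. *)
Definition is_product p q (f : cochain p) (g : cochain q) (h : cochain (p + q))
    : Prop :=
  is_cochain h /\
  forall (k : 'I_(p + q) -> nat) x, homogeneous k x ->
    (p`! * q`!)%:R * h x =
      \sum_(s : 'S_(p + q)) super_sign k s *
        (f [ffun i => x (s (lshift q i))] * g [ffun i => x (s (rshift p i))]).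

End LieSuper.

Section Koszul.
Variables (K : numFieldType) (A : comAlgType K) (gr : nat -> A -> Prop).

(* A^! = T(W^* )/(R^\perp) = U(L), where W = A_1 has basis w, and
   e is the dual basis of L_1 = W^*. *)
Definition koszul_dual m (w : 'I_m -> A) (L : gradedLieSuper K)
    (e : 'I_m -> L) : Prop :=
  [/\ basis_of_pred (@lie_gr K L 1%N) e,
      generated_in_degree1 L &
      exists (U : algType K) (iota : L -> U),
        presented_by (fun i => iota (e i)) (annihilator (quadratic_rels w)) /\
        enveloping iota].

(* The maps phi p induce an isomorphism of graded algebras A = H(L) which on
   A_1 is the identification of A_1 with the dual of L_1. *)
Record cohomology_iso m (w : 'I_m -> A) (L : gradedLieSuper K) (e : 'I_m -> L)
    (phi : forall p, A -> cochain L p) : Prop := {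
  ci_cocycle : forall p a, gr p a -> cocycle (phi p a);
  ci_linear : forall p (c : K) a b, gr p a -> gr p b ->
    cohomologous (phi p (c *: a + b)) (fun x => c * phi p a x + phi p b x);
  ci_one : cohomologous (phi 0%N 1) (fun=> 1);
  ci_mul : forall p q a b, gr p a -> gr q b ->
    exists2 h, is_product (phi p a) (phi q b) h &
               cohomologous h (phi (p + q)%N (a * b));
  ci_inj : forall p a, gr p a -> coboundary (phi p a) -> a = 0;
  ci_surj : forall p f, cocycle f ->
    exists2 a, gr p a & cohomologous f (phi p a);
  ci_degree1 : forall i j, phi 1%N (w i) [ffun=> e j] = (i == j)%:R }.

Definition koszul : Prop :=
  exists (m : nat) (w : 'I_m -> A),
    quadratic_algebra gr w /\
    exists (L : gradedLieSuper K) (e : 'I_m -> L),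
      koszul_dual w e /\ exists phi, cohomology_iso w e phi.

End Koszul.

Section PolynomialQuotient.
Variables (K : fieldType) (m : nat) (I : idealr {mpoly K[m]}).

Definition poly_quot := {ideal_quot I}.

HB.instance Definition _ := GRing.ComNzRing.on poly_quot.
HB.instance Definition _ := ZmodQuotient.on poly_quot.
HB.instance Definition _ := NzRingQuotient.on poly_quot.

Definition poly_quot_scale (c : K) (x : poly_quot) : poly_quot :=
  \pi_poly_quot%qT c%:MP * x.

Fact poly_quot_scaleA a b x :
  poly_quot_scale a (poly_quot_scale b x) = poly_quot_scale (a * b) x.
Proof. by rewrite /poly_quot_scale mulrA -rmorphM -mpolyCM. Qed.

Fact poly_quot_scale1 : left_id 1 poly_quot_scale.
Proof. by move=> x; rewrite /poly_quot_scale mpolyC1 rmorph1 mul1r. Qed.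

Fact poly_quot_scaleDr : right_distributive poly_quot_scale +%R.
Proof. by move=> a x y; rewrite /poly_quot_scale mulrDr. Qed.

Fact poly_quot_scaleDl x : {morph poly_quot_scale^~ x : a b / a + b}.
Proof. by move=> a b; rewrite /poly_quot_scale mpolyCD rmorphD mulrDl. Qed.

HB.instance Definition _ := GRing.Zmodule_isLmodule.Build K poly_quot
  poly_quot_scaleA poly_quot_scale1 poly_quot_scaleDr poly_quot_scaleDl.

Fact poly_quot_scaleAl (a : K) (x y : poly_quot) : a *: (x * y) = (a *: x) * y.
Proof. exact: mulrA. Qed.

HB.instance Definition _ :=
  GRing.Lmodule_isLalgebra.Build K poly_quot poly_quot_scaleAl.
HB.instance Definition _ := GRing.Lalgebra_isComAlgebra.Build K poly_quot.

Definition poly_quot_gr (k : nat) (a : poly_quot) : Prop :=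
  exists2 p : {mpoly K[m]}, p \is k.-homog & a = \pi_poly_quot%qT p.

End PolynomialQuotient.

Section AQ.
Variables (K : fieldType) (n N1 N2 : nat).

(* s : AQ_index stands for the integer mode s, in the range -N1 .. N2. *)
Definition AQ_index := 'I_(N1 + N2).+1.
Definition mode (s : AQ_index) : int := (s : nat)%:Z - N1%:Z.

Definition AQ_var : finType :=
  ('I_n * AQ_index + 'I_n * AQ_index + AQ_index)%type.
Definition AQ_poly := {mpoly K[#|AQ_var|]}.

Definition fvar (i : 'I_n) (s : AQ_index) : AQ_poly :=
  'X_(enum_rank (inl (inl (i, s)) : AQ_var)).
Definition gvar (j : 'I_n) (t : AQ_index) : AQ_poly :=
  'X_(enum_rank (inl (inr (j, t)) : AQ_var)).
Definition hvar (k : AQ_index) : AQ_poly :=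
  'X_(enum_rank (inr k : AQ_var)).

Definition AQ_rel (l : int) : AQ_poly :=
  \sum_(s : AQ_index) \sum_(t : AQ_index | mode s + mode t == l)
     (\sum_(i < n) fvar i s * gvar i t + hvar s * hvar t).

(* The ideal (r[-2 N1], ..., r[2 N2]). *)
Definition AQ_ideal : {pred AQ_poly} := fun p =>
  `[< exists c : 'I_(2 * (N1 + N2)).+1 -> AQ_poly,
        p = \sum_l c l * AQ_rel ((l : nat)%:Z - (2 * N1)%:Z) >].

Fact AQ_ideal_closed : idealr_closed AQ_ideal.
Proof.
split.
- apply/asboolP; exists (fun=> 0).
  by rewrite big1 // => l _; rewrite mul0r.
- apply/negP => /asboolP [c] /(congr1 (meval (fun=> 0 : K))).
  rewrite meval1 raddf_sum big1 => [/eqP|l _]; first by rewrite oner_eq0.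
  rewrite /= mevalM /AQ_rel raddf_sum big1 ?mulr0 // => s _.
  rewrite raddf_sum big1 // => t _ /=.
  rewrite mevalD mevalM mevalXU mul0r addr0 raddf_sum big1 // => i _ /=.
  by rewrite mevalM mevalXU mul0r.
- move=> a u v /asboolP [c ->] /asboolP [d ->].
  apply/asboolP; exists (fun l => a * c l + d l).
  rewrite mulr_sumr -big_split; apply: eq_bigr => l _ /=.
  by rewrite mulrA mulrDl.
Qed.

HB.instance Definition _ := isIdealr.Build AQ_poly AQ_ideal AQ_ideal_closed.

Definition AQ : comAlgType K := poly_quot AQ_ideal.

Definition AQ_gr (k : nat) (a : AQ) : Prop :=
  @poly_quot_gr K #|AQ_var| AQ_ideal k a.

End AQ.

(* Main.v *)
(* AQ is a quadratic complete intersection, and such an algebra is Koszul.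

   For quadrics r_l in m variables, the dual of K[x]/(r) is U(L) with
   L = L_1 + L_2, L_1 = K^m, L_2 central with basis y_l, and bracket given by
   the Hessians: [e_i, e_j] = sum_l (d_i d_j r_l) y_l. The cochain complex of L
   is then the Koszul complex K[x] (x) /\(eps_1, ..., eps_d) with differential
   eps_l |-> r_l, so H(L) = K[x]/(r) as soon as this complex is exact away from
   exterior degree 0.

   Exactness holds when the leading monomials of the r_l for some weights are
   pairwise coprime: the monomial complex has an explicit contracting homotopy,
   and the other terms have lower weight. For AQ, the leading monomial of r[l]
   is h[s]^2 if l = 2s, and f^1[s] g_1[s+1] if l = 2s+1. *)
Require Import Defs.
From HB Require Import structures.
From mathcomp Require Import all_boot all_order all_fingroup all_algebra.
From mathcomp Require Import boolp reals complex mpoly.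
From mathcomp Require monalg.
From mathcomp Require Import zify ring.

Set Implicit Arguments.
Unset Strict Implicit.
Unset Printing Implicit Defensive.

Import GRing.Theory Num.Theory.
Local Open Scope ring_scope.

(** * The Koszul complex *)

(** The weights come from convexity. With modes shifted to start at 0, place h[s] at 2s, f^i[s] at
    2s+1 and g_i[t] at 2t-1. The two factors of every monomial of r[l] then have positions of sum
    2l, so the sum of their squares is least, namely 2l^2, when both lie at l. The parity of l
    decides between h h and f g, and a penalty on i singles out one f^i g_i. Leading monomials for
    different l are coprime because their variables lie at different positions.

    The obstacle in the duality is that A^! has only quadratic relations, while centrality of L_2 is
    a cubic statement. It follows from the shape of r[l]: up to a scalar, every y_l is the
    anticommutator of an f with a g and also of two h's, and no term mixes h with f or g.

    Cochains are compared with the Koszul complex by iterated contraction, and Euler's formula, in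
    characteristic 0, inverts this map. The bracket is the double supercommutator of two
    contractions with the differential, so the Chevalley-Eilenberg formula results from moving the
    differential past contractions. *)

Section KoszulModel.
Variables (K : numFieldType) (m d : nat).
Local Notation P := {mpoly K[m]}.

(* Q S is the coefficient of \prod_(l in S) eps_l, in increasing order. *)
Definition ext : Type := {ffun {set 'I_d} -> {mpoly K[m]}}.
HB.instance Definition _ := GRing.Lmodule.on ext.

Implicit Types (S : {set 'I_d}) (Q : ext) (l k : 'I_d).

(** The sign of bringing eps_l to its place in the ordered product. The strict inequality leaves l
    itself out, so the same sign serves for inserting and for removing eps_l. *)
Definition ext_sign l S : K := (-1) ^+ #|[set k in S | (k < l)%N]|.

Lemma sg_sq l S : ext_sign l S * ext_sign l S = 1.
Proof. by rewrite /ext_sign -expr2 sqrr_sign. Qed.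

Lemma sgU l k S : k \notin S -> ext_sign l (k |: S) = (-1) ^+ (k < l)%N * ext_sign l S.
Proof.
move=> kS; rewrite /ext_sign -exprD; congr (_ ^+ _).
have -> : [set j in k |: S | (j < l)%N] =
    if (k < l)%N then k |: [set j in S | (j < l)%N] else [set j in S | (j < l)%N].
  apply/setP=> j; case: ifP => kl; rewrite !inE;
    by case: (eqVneq j k) => [->|] //=; rewrite kl ?andbF.
by case: ifP => // _; rewrite cardsU1 inE (negPf kS).
Qed.

Lemma sg_anti l k : l != k -> (-1) ^+ (l < k)%N = - (-1) ^+ (k < l)%N :> K.
Proof.
by case: ltngtP => [||/val_inj->]; rewrite ?eqxx ?expr1 ?expr0 ?opprK.
Qed.

(** Exactly one of k < l and l < k holds, so only one of the two orders of insertion picks up an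
    extra sign. *)
Lemma sg_swap l k S : l != k -> l \notin S -> k \notin S ->
  ext_sign l S * ext_sign k (l |: S) = - (ext_sign k S * ext_sign l (k |: S)).
Proof. by move=> lk lS kS; rewrite !sgU // (sg_anti lk); ring. Qed.

Lemma sg_cross l k S : l != k -> l \notin S -> k \in S ->
  ext_sign l S * ext_sign k (l |: S) = - (ext_sign k S * ext_sign l (S :\ k)).
Proof.
move=> lk lS kS; have kS' : k \notin S :\ k by rewrite !inE eqxx.
rewrite sgU // -{1 2 3}(setD1K kS) !sgU // ltnn mul1r (sg_anti lk).
have := sqrr_sign K (k < l)%N; set e := _ ^+ (k < l)%N => e2.
set a := ext_sign l _; set b := ext_sign k _.
by transitivity (- (e ^+ 2) * a * b); [ring | rewrite e2; ring].
Qed.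

Lemma sgD1 l S : l \in S -> ext_sign l (S :\ l) = ext_sign l S.
Proof. by move=> lS; rewrite -{2}(setD1K lS) sgU ?inE ?eqxx // ltnn mul1r. Qed.

Definition contr l Q : ext :=
  [ffun S : {set 'I_d} => if l \in S then 0 else ext_sign l S *: Q (l |: S)].
Definition wedge l Q : ext :=
  [ffun S : {set 'I_d} => if l \in S then ext_sign l S *: Q (S :\ l) else 0].
Definition parity Q : ext := [ffun S : {set 'I_d} => (-1) ^+ #|S| *: Q S].
Definition coefwise (f : P -> P) Q : ext := [ffun S : {set 'I_d} => f (Q S)].

Fact contr_linear l : linear (contr l).
Proof.
move=> c Q R; apply/ffunP=> S; rewrite !ffunE; case: ifP => _.
  by rewrite scaler0 addr0.
by rewrite scalerDr !scalerA mulrC.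
Qed.
HB.instance Definition _ l := GRing.isLinear.Build K ext ext _ (contr l) (contr_linear l).

Fact wedge_linear l : linear (wedge l).
Proof.
move=> c Q R; apply/ffunP=> S; rewrite !ffunE; case: ifP => _.
  by rewrite scalerDr !scalerA mulrC.
by rewrite scaler0 addr0.
Qed.
HB.instance Definition _ l := GRing.isLinear.Build K ext ext _ (wedge l) (wedge_linear l).

Fact parity_linear : linear parity.
Proof.
by move=> c Q R; apply/ffunP=> S; rewrite !ffunE scalerDr !scalerA mulrC.
Qed.
HB.instance Definition _ := GRing.isLinear.Build K ext ext _ parity parity_linear.

Fact coefwise_linear (f : {linear P -> P}) : linear (coefwise f).
Proof. by move=> c Q R; apply/ffunP=> S; rewrite !ffunE linearP. Qed.
HB.instance Definition _ (f : {linear P -> P}) :=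
  GRing.isLinear.Build K ext ext _ (coefwise f) (coefwise_linear f).

Lemma setU1A l k S : l |: (k |: S) = k |: (l |: S).
Proof. by rewrite setUA (setUC [set l]) -setUA. Qed.

Lemma contrC l k Q : contr l (contr k Q) = - contr k (contr l Q).
Proof.
apply/ffunP=> S; rewrite !ffunE !inE.
case: (eqVneq l k) => [->|lk]; first by rewrite ?eqxx /= !(scaler0, oppr0) !if_same oppr0.
rewrite /=.
case: ifPn => lS; case: ifPn => kS; rewrite ?scaler0 ?oppr0 //.
by rewrite !scalerA setU1A -scaleNr (sg_swap lk).
Qed.

Lemma contr_wedge l k Q :
  contr l (wedge k Q) = (l == k)%:R *: Q - wedge k (contr l Q).
Proof.
apply/ffunP=> S; rewrite !ffunE !inE.
case: (eqVneq l k) => [<-|lk] /=.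
  rewrite scale1r ?eqxx /=; case: ifPn => lS; rewrite ?subr0.
    by rewrite scalerA sgD1 // setD1K // sg_sq scale1r subrr.
  by rewrite scalerA setU1K // sgU // ltnn mul1r sg_sq scale1r.
rewrite scale0r sub0r /=.
case: ifPn => lS; case: ifPn => kS; rewrite ?scaler0 ?oppr0 //.
rewrite !scalerA -scaleNr (sg_cross lk) //; congr (_ *: Q _).
by apply/setP=> j; rewrite !inE; case: (eqVneq j l) => [->|]; rewrite ?lk.
Qed.

Lemma wedge_contr l Q S :
  wedge l (contr l Q) S = if l \in S then Q S else 0.
Proof.
rewrite !ffunE !inE eqxx /=; case: ifP => // lS.
by rewrite scalerA sgD1 // setD1K // sg_sq scale1r.
Qed.

Lemma parity_contr l Q : parity (contr l Q) = - contr l (parity Q).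
Proof.
apply/ffunP=> S; rewrite !ffunE; case: ifPn => lS; first by rewrite scaler0 oppr0.
by rewrite cardsU1 lS exprS mulN1r scaleNr scalerN opprK scalerA mulrC scalerA.
Qed.

Lemma contr_parity l Q : contr l (parity Q) = - parity (contr l Q).
Proof. by rewrite parity_contr opprK. Qed.

Lemma parity_wedge l Q : parity (wedge l Q) = - wedge l (parity Q).
Proof.
apply/ffunP=> S; rewrite !ffunE; case: ifPn => lS; last by rewrite scaler0 oppr0.
by rewrite (cardsD1 l) lS exprS mulN1r scaleNr scalerA mulrC -scalerA.
Qed.

Lemma parityK : involutive parity.
Proof. by move=> Q; apply/ffunP=> S; rewrite !ffunE scalerA -expr2 sqrr_sign scale1r. Qed.

Lemma coefwise_parity (f : {linear P -> P}) Q : coefwise f (parity Q) = parity (coefwise f Q).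
Proof. by apply/ffunP=> S; rewrite !ffunE linearZ. Qed.

Lemma coefwise_contr (f : {linear P -> P}) l Q : coefwise f (contr l Q) = contr l (coefwise f Q).
Proof. by apply/ffunP=> S; rewrite !ffunE (fun_if f) linear0 linearZ. Qed.

Lemma coefwise_wedge (f : {linear P -> P}) l Q : coefwise f (wedge l Q) = wedge l (coefwise f Q).
Proof. by apply/ffunP=> S; rewrite !ffunE (fun_if f) linear0 linearZ. Qed.

Definition xmul (p : P) : P -> P := fun q => p * q.
Fact xmul_linear p : linear (xmul p).
Proof. by move=> c q r; rewrite /xmul mulrDr scalerAr. Qed.
HB.instance Definition _ p := GRing.isLinear.Build K P P _ (xmul p) (xmul_linear p).

(* The degree in L of the dual basis vector. *)
Definition bdeg (u : 'I_m + 'I_d) : nat := if u is inl _ then 1 else 2.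
Definition bsign u v : K := - (-1) ^+ (bdeg u * bdeg v)%N.

(* The parity twist makes contractions of degrees 1 and 2 anticommute, as the signs
   of the Chevalley-Eilenberg complex require. *)
Definition biota (u : 'I_m + 'I_d) Q : ext :=
  match u with inl i => parity (coefwise (mderiv i) Q) | inr l => contr l Q end.
Definition bmul (u : 'I_m + 'I_d) Q : ext :=
  match u with inl i => parity (coefwise (xmul 'X_i) Q) | inr l => wedge l Q end.

Fact biota_linear u : linear (biota u).
Proof. by case: u => [i|l] c Q R /=; rewrite !linearP. Qed.
HB.instance Definition _ u := GRing.isLinear.Build K ext ext _ (biota u) (biota_linear u).

Fact bmul_linear u : linear (bmul u).
Proof. by case: u => [i|l] c Q R /=; rewrite !linearP. Qed.
HB.instance Definition _ u := GRing.isLinear.Build K ext ext _ (bmul u) (bmul_linear u).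

Lemma bsign_sq u v : bsign u v * bsign u v = 1.
Proof. by rewrite /bsign mulrNN -expr2 sqrr_sign. Qed.

Lemma bsign11 i j : bsign (inl i) (inl j) = 1.
Proof. by rewrite /bsign expr1 opprK. Qed.

Lemma bsign12 i l : bsign (inl i) (inr l) = -1.
Proof. by rewrite /bsign /= mul1n sqrrN expr1n. Qed.

Lemma bsign2 l u : bsign (inr l) u = -1.
Proof. by rewrite /bsign exprM sqrrN expr1n expr1n. Qed.

Lemma biotaC u v Q : biota u (biota v Q) = bsign u v *: biota v (biota u Q).
Proof.
case: u v => [i|l] [j|k] /=.
- rewrite bsign11 scale1r !coefwise_parity; congr (parity (parity _)); apply/ffunP=> S.
  by rewrite !ffunE /= mderiv_comm.
- by rewrite bsign12 scaleN1r coefwise_contr parity_contr.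
- by rewrite bsign2 scaleN1r coefwise_contr parity_contr opprK.
- by rewrite bsign2 scaleN1r contrC.
Qed.

(** Two indices in L_1: the parity twists cancel and the Leibniz rule d_i x_j = delta_ij + x_j d_i
    remains. Two indices in L_2: this is the Clifford relation. In the mixed cases the twist makes
    the operators anticommute. *)
Lemma biota_bmul u v Q :
  biota u (bmul v Q) = (u == v)%:R *: Q + bsign u v *: bmul v (biota u Q).
Proof.
case: u v => [i|l] [j|k] /=.
- rewrite bsign11 scale1r !coefwise_parity !parityK; apply/ffunP=> S.
  rewrite !ffunE /= /xmul mderivM mderivX mnm1E.
  case: (eqVneq i j) => [->|ij].
    rewrite !eqxx (_ : U_(j) - U_(j) = 0)%MM; last by apply/mnmP=> a; rewrite mnmBE subnn mnm0E.
    by rewrite mpolyX0 scale1r mul1r scale1r.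
  rewrite (_ : inl _ == _ = false); last by apply/eqP=> -[]; exact/eqP.
  by rewrite !scale0r mul0r.
- by rewrite bsign12 scale0r add0r scaleN1r coefwise_wedge parity_wedge.
- by rewrite bsign2 scale0r add0r scaleN1r coefwise_contr parity_contr opprK.
- by rewrite bsign2 scaleN1r contr_wedge.
Qed.

Lemma mcoeffMXif (p : P) (c b : 'X_{1..m}) :
  (p * 'X_[c])@_b = if (c <= b)%MM then p@_(b - c) else 0.
Proof.
case: ifPn => cb; first by rewrite -{1}(submK cb) addmC mcoeffMX.
apply: memN_msupp_eq0; rewrite (perm_mem (msuppMX _ _)).
by apply: contra cb => /mapP[a _ ->]; exact: lem_addr.
Qed.

Lemma mpoly_euler (p : P) b : (\sum_i 'X_i * p^`M(i))@_b = (mdeg b)%:R * p@_b.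
Proof.
rewrite raddf_sum mdegE natr_sum mulr_suml; apply: eq_bigr => i _ /=.
rewrite mulrC mcoeffMXif lep1mP.
case: ifPn => [bi|/negPn/eqP ->]; last by rewrite mul0r.
rewrite mcoeff_deriv submK ?lep1mP // mnmBE mnm1E eqxx subn1 prednK ?lt0n //.
by rewrite mulr_natl.
Qed.

Definition euler Q : ext := \sum_u bmul u (biota u Q).

Lemma eulerE Q S b : (euler Q S)@_b = (mdeg b + #|S|)%:R * (Q S)@_b.
Proof.
rewrite /euler sum_ffunE raddf_sum /= big_sumType /= natrD mulrDl.
congr (_ + _).
  rewrite -mpoly_euler raddf_sum; apply: eq_bigr => i _ /=.
  by rewrite coefwise_parity parityK !ffunE.
rewrite (eq_bigr (fun l => if l \in S then (Q S)@_b else 0)); last first.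
  by move=> l _; rewrite wedge_contr; case: ifP; rewrite ?mcoeff0.
by rewrite -big_mkcond /= sumr_const mulr_natl.
Qed.
End KoszulModel.

(** * The Koszul dual Lie superalgebra *)

Section QuadricLie.
Variables (K : numFieldType) (m d : nat) (r : 'I_d -> {mpoly K[m]}).

(** Evaluation at 0 makes this a scalar for any r; for quadrics it is the whole second derivative,
    by [deriv2_const]. *)
Definition hess l i j : K := ((r l)^`M(j)^`M(i))@_0%MM.

Definition qcar := ('rV[K]_m * 'rV[K]_d)%type.
HB.instance Definition _ := GRing.Lmodule.on qcar.

Definition qgr (k : nat) (x : qcar) : Prop :=
  match k with 1 => x.2 = 0 | 2 => x.1 = 0 | _ => x = 0 end.

Definition qbr (x y : qcar) : qcar :=
  (0, \row_l \sum_i \sum_j x.1 0 i * y.1 0 j * hess l i j).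

Lemma hessC l i j : hess l i j = hess l j i.
Proof. by rewrite /hess mderiv_comm. Qed.

Lemma qgr_grading : grading qgr.
Proof.
split.
- by case=> [|[|[|k]]].
- move=> [|[|[|k]]] c u v /=; try (by move=> -> ->; rewrite scaler0 addr0);
    by move=> -> ->; rewrite scaler0 addr0.
- move=> v;
  exists 3, (fun k => match k return qcar with 1 => (v.1, 0) | 2 => (0, v.2) | _ => 0 end).
  split; first by case=> [|[|[|k]]].
  rewrite !big_ord_recr big_ord0 /= !add0r; case: v => a b /=.
  by rewrite /GRing.add /= /add_pair /= addr0 add0r.
- move=> N c hc; have c0 k : k \notin [:: 1; 2]%N -> c k = 0.
    by move: (hc k); case: k => [|[|[|k]]].
  move=> hs k kN.
  have hs1 : (\sum_(j < N) c j).1 = 0 by rewrite hs.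
  have hs2 : (\sum_(j < N) c j).2 = 0 by rewrite hs.
  have E1 : (\sum_(j < N) c j).1 = \sum_(j < N) (c j).1.
    by elim/big_rec2: _ => // i a b _ <-.
  have E2 : (\sum_(j < N) c j).2 = \sum_(j < N) (c j).2.
    by elim/big_rec2: _ => // i a b _ <-.
  move: (hc k) kN; case: k => [|[|[|k]]] //= hk kN.
  + move: hs1; rewrite E1 (bigD1 (Ordinal kN)) //= big1 ?addr0.
      by case: (c 1%N) hk => a b /= -> ->.
    move=> [[|[|[|i]]] iN] //= _; first by rewrite c0.
      by have := hc 2%N.
    by rewrite c0.
  + move: hs2; rewrite E2 (bigD1 (Ordinal kN)) //= big1 ?addr0.
      by case: (c 2%N) hk => a b /= -> ->.
    move=> [[|[|[|i]]] iN] //= _; first by rewrite c0.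
      by have := hc 1%N.
    by rewrite c0.
Qed.

Lemma qbrE (x y : qcar) l : (qbr x y).2 0 l = \sum_i \sum_j x.1 0 i * y.1 0 j * hess l i j.
Proof. by rewrite mxE. Qed.

Lemma qbr_eq0l (x y : qcar) : x.1 = 0 -> qbr x y = 0.
Proof.
move=> x0; congr (_, _); apply/rowP=> l; rewrite !mxE big1 // => i _.
by rewrite big1 // => j _; rewrite x0 mxE !mul0r.
Qed.

Lemma qbrC (x y : qcar) : qbr x y = qbr y x.
Proof.
congr (_, _); apply/rowP=> l; rewrite !mxE exchange_big /=.
by do 2!apply: eq_bigr => ? _; rewrite hessC (mulrC (x.1 _ _)).
Qed.

Lemma qbr_eq0r (x y : qcar) : y.1 = 0 -> qbr x y = 0.
Proof. by rewrite qbrC; exact: qbr_eq0l. Qed.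

Lemma qbr_linl (c : K) (x y z : qcar) : qbr (c *: x + y) z = c *: qbr x z + qbr y z.
Proof.
congr (_, _); first by rewrite /= scaler0 addr0.
apply/rowP=> l; rewrite !mxE mulr_sumr -big_split /=; apply: eq_bigr => i _.
rewrite mulr_sumr -big_split /=; apply: eq_bigr => j _.
by rewrite !mxE; ring.
Qed.

Lemma qbr_linr (c : K) (x y z : qcar) : qbr z (c *: x + y) = c *: qbr z x + qbr z y.
Proof. by rewrite !(qbrC z) qbr_linl. Qed.

Lemma qgr_neq1 k x : qgr k x -> k != 1%N -> x.1 = 0.
Proof. by case: k => [|[|[|k]]] //= -> . Qed.

Lemma qgr_neq2 k x : qgr k x -> k != 2 -> x.2 = 0.
Proof. by case: k => [|[|[|k]]] //= -> . Qed.

Lemma qbr_gr i j x y : qgr i x -> qgr j y -> qgr (i + j)%N (qbr x y).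
Proof.
case: (eqVneq i 1%N) => [->|i1] hx; last first.
  by move=> _; rewrite qbr_eq0l ?(qgr_neq1 hx) //; case: (i + j)%N => [|[|[|k]]].
case: (eqVneq j 1%N) => [->|j1] hy //.
by rewrite qbr_eq0r ?(qgr_neq1 hy) //; case: (1 + j)%N => [|[|[|k]]].
Qed.

Lemma qbr_skew i j x y : qgr i x -> qgr j y ->
  qbr x y = - (-1) ^+ (i * j)%N *: qbr y x.
Proof.
case: (eqVneq i 1%N) => [->|i1] hx; last first.
  by rewrite qbr_eq0l ?qbr_eq0r ?scaler0 ?(qgr_neq1 hx).
case: (eqVneq j 1%N) => [->|j1] hy; last first.
  by rewrite qbr_eq0r ?qbr_eq0l ?scaler0 ?(qgr_neq1 hy).
by rewrite expr1 opprK scale1r qbrC.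
Qed.

(** Brackets lie in L_2, which is central, so all three double brackets vanish. *)
Lemma qbr_jacobi i j k x y z : qgr i x -> qgr j y -> qgr k z ->
  qbr x (qbr y z) = qbr (qbr x y) z + (-1) ^+ (i * j)%N *: qbr y (qbr x z).
Proof.
have h a b : (qbr a b).1 = 0 by [].
by rewrite (qbr_eq0r x (h y z)) (qbr_eq0l z (h x y)) (qbr_eq0r y (h x z)) scaler0 addr0.
Qed.

Definition qlie : gradedLieSuper K := GradedLieSuper qgr_grading
  (fun x h => h) qbr_linl qbr_linr qbr_gr qbr_skew qbr_jacobi.

Local Notation P := {mpoly K[m]}.
Local Notation E := (ext K m d).
Implicit Types (Q R : E) (x y : qcar) (u v : 'I_m + 'I_d).

Definition coord x u : K := match u with inl i => x.1 0 i | inr l => x.2 0 l end.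

Lemma coordP c x y u : coord (c *: x + y) u = c * coord x u + coord y u.
Proof. by case: u => i; rewrite /= !mxE. Qed.

Lemma coord_deg k x u : qgr k x -> bdeg u != k -> coord x u = 0.
Proof.
case: u => i hx /=; rewrite eq_sym => hk.
  by rewrite (qgr_neq1 hx hk) mxE.
by rewrite (qgr_neq2 hx hk) mxE.
Qed.

(* Contraction by x in L of the cochains of L. *)
Definition iota_ x Q : E := \sum_u coord x u *: biota u Q.

Fact iota_linear x : linear (iota_ x).
Proof.
move=> c Q R; rewrite /iota_ scaler_sumr -big_split; apply: eq_bigr => u _ /=.
by rewrite linearP scalerDr !scalerA mulrC.
Qed.
HB.instance Definition _ x := GRing.isLinear.Build K E E _ (iota_ x) (iota_linear x).

Lemma iota_P c x y Q : iota_ (c *: x + y) Q = c *: iota_ x Q + iota_ y Q.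
Proof.
rewrite /iota_ scaler_sumr -big_split; apply: eq_bigr => u _ /=.
by rewrite coordP scalerDl scalerA.
Qed.

Definition ksign (a b : nat) : K := - (-1) ^+ (a * b)%N.

Lemma iota_C a b x y Q : qgr a x -> qgr b y ->
  iota_ x (iota_ y Q) = ksign a b *: iota_ y (iota_ x Q).
Proof.
move=> hx hy; rewrite /iota_ scaler_sumr.
under eq_bigr do rewrite linear_sum scaler_sumr.
rewrite exchange_big /=; apply: eq_bigr => v _.
rewrite !(scaler_sumr, linear_sum); apply: eq_bigr => u _ /=.
rewrite !linearZ /= biotaC !scalerA.
have [ua|ua] := eqVneq (bdeg u) a; last by rewrite (coord_deg hx ua) !(mul0r, mulr0) !scale0r.
have [vb|vb] := eqVneq (bdeg v) b; last by rewrite (coord_deg hy vb) !(mul0r, mulr0) !scale0r.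
by rewrite /bsign ua vb /ksign; congr (_ *: _); ring.
Qed.

Definition ev0 Q : K := (Q set0)@_0%MM.

Fact ev0_linear : linear_for *%R ev0.
Proof. by move=> c Q R; rewrite /ev0 !ffunE linearP. Qed.
HB.instance Definition _ := GRing.isLinear.Build K E K _ ev0 ev0_linear.

Definition koszul_diff Q : E := \sum_l coefwise (xmul (r l)) (contr l Q).

Fact koszul_diff_linear : linear koszul_diff.
Proof.
move=> c Q R; rewrite /koszul_diff scaler_sumr -big_split; apply: eq_bigr => l _ /=.
by rewrite !linearP.
Qed.
HB.instance Definition _ := GRing.isLinear.Build K E E _ koszul_diff koszul_diff_linear.

(* The anticommutator of the contraction by the i-th basis vector of L_1 with
   koszul_diff. *)
Definition diff_comm_var i Q : E := parity (\sum_l coefwise (xmul (r l)^`M(i)) (contr l Q)).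

Fact diff_comm_var_linear i : linear (diff_comm_var i).
Proof.
move=> c Q R; rewrite /diff_comm_var -linearP; congr (parity _).
rewrite scaler_sumr -big_split; apply: eq_bigr => l _ /=.
by rewrite !linearP.
Qed.
HB.instance Definition _ i := GRing.isLinear.Build K E E _ (diff_comm_var i) (diff_comm_var_linear i).

Definition diff_comm x Q : E := \sum_i x.1 0 i *: diff_comm_var i Q.

(** Contractions by eps anticommute with [koszul_diff]. A derivative also hits the coefficient r_l,
    and this produces the extra term. *)
Lemma biota_koszul_diff u Q : biota u (koszul_diff Q) =
  - koszul_diff (biota u Q) + (if u is inl i then diff_comm_var i Q else 0).
Proof.
case: u => [i|k] /=; last first.
  rewrite addr0 /koszul_diff linear_sum -sumrN; apply: eq_bigr => l _ /=.
  by rewrite -!coefwise_contr contrC linearN.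
rewrite /koszul_diff /diff_comm_var !linear_sum -big_split; apply: eq_bigr => l _ /=.
rewrite contr_parity linearN opprK /= coefwise_parity -linearD; congr (parity _).
rewrite -coefwise_contr; apply/ffunP=> S; rewrite !ffunE /= /xmul.
by case: ifP => _; [rewrite !(mulr0, mderiv0) ?addr0 | rewrite mderivM addrC].
Qed.

Hypothesis hr : forall l, r l \is 2.-homog.

Lemma deriv2_const l i j : (r l)^`M(j)^`M(i) = (hess l i j)%:MP.
Proof.
apply/mpolyP=> b; rewrite /hess mcoeffC; case: (eqVneq b 0%MM) => [->|b0]; first by rewrite mulr1.
rewrite mulr0 !mcoeff_deriv; apply/eqP; rewrite mulrn_eq0 /= mulrn_eq0 /=.
rewrite (dhomog_nemf_coeff (hr l)) /= ?eqxx // !mdegD !mdeg1.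
by apply: contra b0; rewrite addn1 addn1 !eqSS mdeg_eq0.
Qed.

(** Differentiating r_l a second time leaves the constant [hess]: this is how the bracket of L
    enters. *)
Lemma biota_diff_comm_var u j Q : biota u (diff_comm_var j Q) =
  (if u is inl i then \sum_l hess l i j *: contr l Q else 0)
   + (-1) ^+ bdeg u *: diff_comm_var j (biota u Q).
Proof.
case: u => [i|k] /=; last first.
  rewrite add0r sqrrN expr1n scale1r /diff_comm_var contr_parity -[LHS](linearN (@parity K m d)); congr (parity _).
  rewrite linear_sum -sumrN; apply: eq_bigr => l _ /=.
  by rewrite -coefwise_contr contrC linearN opprK.
rewrite expr1 scaleN1r /diff_comm_var !linear_sum -big_split; apply: eq_bigr => l _ /=.
rewrite contr_parity !linearN opprK /= !coefwise_parity !parityK -coefwise_contr; apply/ffunP=> S.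
rewrite !ffunE /= /xmul; case: ifP => _.
  by rewrite !(mulr0, mderiv0) scaler0 addr0.
by rewrite mderivM deriv2_const mul_mpolyC.
Qed.

End QuadricLie.

(** * Commuting the Koszul differential past contractions *)

Section Cochains.
Variables (K : numFieldType) (m d : nat) (r : 'I_d -> {mpoly K[m]}).
Hypothesis hr : forall l, r l \is 2.-homog.
Local Notation P := {mpoly K[m]}.
Local Notation E := (ext K m d).
Local Notation L := (qcar K m d).
Local Notation br := (qbr r).
Local Notation delta := (koszul_diff r).
Local Notation iA := (diff_comm r).
Implicit Types (Q R : E) (x y : L) (u v : 'I_m + 'I_d).

Fact diff_comm_linear x : linear (iA x).
Proof.
move=> c Q R; rewrite /diff_comm scaler_sumr -big_split; apply: eq_bigr => i _ /=.
by rewrite linearP scalerDr !scalerA mulrC.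
Qed.
HB.instance Definition _ x := GRing.isLinear.Build K E E _ (iA x) (diff_comm_linear x).

Lemma iota_koszul_diff x Q : iota_ x (delta Q) = - delta (iota_ x Q) + iA x Q.
Proof.
rewrite /iota_ (linear_sum delta) -sumrN.
rewrite (eq_bigr (fun u => - delta (coord x u *: biota u Q) +
   coord x u *: (if u is inl i then diff_comm_var r i Q else 0))); last first.
  by move=> u _; rewrite biota_koszul_diff scalerDr linearZ scalerN.
rewrite big_split /=; congr (_ + _).
by rewrite big_sumType /= [X in _ + X]big1 ?addr0 // => l _; rewrite scaler0.
Qed.

(** With [iota_koszul_diff], this exhibits the bracket of L as the derived bracket of contractions
    with respect to [delta]. *)
Lemma iota_diff_comm k x y Q : qgr k x ->
  iota_ x (iA y Q) = iota_ (br x y) Q + (-1) ^+ k *: iA y (iota_ x Q).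
Proof.
move=> hx; rewrite {1}/diff_comm linear_sum /=.
rewrite (eq_bigr (fun j => y.1 0 j *: (\sum_u coord x u *:
    (if u is inl i then \sum_l hess r l i j *: contr l Q else 0)) +
    (-1) ^+ k *: (y.1 0 j *: diff_comm_var r j (iota_ x Q)))); last first.
  move=> j _; rewrite linearZ /= {1}/iota_ scalerA mulrC -scalerA -scalerDr; congr (_ *: _).
  rewrite /iota_ linear_sum scaler_sumr -big_split; apply: eq_bigr => u _ /=.
  rewrite biota_diff_comm_var // scalerDr [in RHS]linearZ /= !scalerA; congr (_ + _).
  have [<-|uk] := eqVneq (bdeg u) k; first by rewrite mulrC.
  by rewrite (coord_deg hx uk) mul0r mulr0.
rewrite big_split /= -scaler_sumr; congr (_ + _).
have sumL (F : 'I_m -> E) : \sum_u coord x u *: (if u is inl i then F i else 0) =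
    \sum_i x.1 0 i *: F i.
  by rewrite big_sumType /= [X in _ + X]big1 ?addr0 // => l _; rewrite scaler0.
have -> : iota_ (br x y) Q = \sum_l (br x y).2 0 l *: contr l Q.
  by rewrite /iota_ big_sumType /= big1 ?add0r // => i _; rewrite mxE scale0r.
under eq_bigr do rewrite sumL scaler_sumr.
transitivity (\sum_j \sum_i \sum_l (x.1 0 i * y.1 0 j * hess r l i j) *: contr l Q).
  apply: eq_bigr => j _; apply: eq_bigr => i _; rewrite !scaler_sumr.
  by apply: eq_bigr => l _; rewrite !scalerA (mulrC (y.1 _ _)).
rewrite exchange_big /=; under eq_bigr do rewrite exchange_big /=.
rewrite exchange_big /=; apply: eq_bigr => l _; rewrite qbrE scaler_suml.
by apply: eq_bigr => i _; rewrite scaler_suml.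
Qed.

Definition iotas (s : seq L) Q : E := foldr (@iota_ K m d) Q s.

Lemma iotas_cat s t Q : iotas (s ++ t) Q = iotas s (iotas t Q).
Proof. exact: foldr_cat. Qed.

Fact iotas_linear s : linear (iotas s).
Proof. by elim: s => [|x s IH] c Q R //=; rewrite IH linearP. Qed.
HB.instance Definition _ s := GRing.isLinear.Build K E E _ (iotas s) (iotas_linear s).

Lemma iotas_koszul_diff s Q : iotas s (delta Q) = (-1) ^+ size s *: delta (iotas s Q) +
  \sum_(0 <= j < size s) (-1) ^+ (size s - j.+1) *:
     iotas (take j s) (iA (nth 0 s j) (iotas (drop j.+1 s) Q)).
Proof.
elim: s => [|x s IH]; first by rewrite big_nil expr0 scale1r addr0.
rewrite [LHS]/= -/(iotas s (delta Q)) IH linearD linearZ /= iota_koszul_diff scalerDr scalerN.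
rewrite exprS mulN1r scaleNr -addrA; congr (_ + _).
rewrite big_nat_recl //= drop0 subn1; congr (_ + _).
by rewrite linear_sum; apply: eq_bigr => j _; rewrite linearZ.
Qed.

(* In a list of pairs (k, x), k is the degree of x. *)
Definition pdeg (s : seq (nat * L)) : nat := (\sum_(a <- s) a.1)%N.
Definition allhom (s : seq (nat * L)) := {in s, forall a, qgr a.1 a.2}.

Lemma iotas_diff_comm (s : seq (nat * L)) y Q : allhom s ->
  iotas (unzip2 s) (iA y Q) = (-1) ^+ pdeg s *: iA y (iotas (unzip2 s) Q) +
  \sum_(0 <= i < size s) (-1) ^+ pdeg (drop i.+1 s) *:
     iotas (unzip2 (take i s)) (iota_ (br (nth 0 (unzip2 s) i) y) (iotas (unzip2 (drop i.+1 s)) Q)).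
Proof.
elim: s => [|[k x] s IH] hs; first by rewrite big_nil /pdeg big_nil expr0 scale1r addr0.
have hx : qgr k x by apply: (hs (k, x)); rewrite inE eqxx.
rewrite [LHS]/= IH; last by move=> a sa; apply: hs; rewrite inE sa orbT.
rewrite linearD linearZ /= (iota_diff_comm _ _ hx) scalerDr scalerA -exprD.
rewrite /pdeg big_cons /= addnC [in LHS]addrAC [in LHS]addrC.
rewrite big_nat_recl //= drop0 addrA [X in X + _ = _]addrC addrA; congr (_ + _).
  exact: addrC.
by rewrite linear_sum; apply: eq_bigr => j _; rewrite linearZ.
Qed.

Lemma ev0_koszul_diff Q : ev0 (delta Q) = 0.
Proof.
rewrite /ev0 sum_ffunE raddf_sum big1 // => l _ /=; rewrite !ffunE /= /xmul rmorphM /=.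
have -> : (r l)@_0 = 0; last by rewrite mul0r.
by rewrite (dhomog_nemf_coeff (hr l)) //= mdeg0.
Qed.

Lemma ev0_diff_comm x Q : ev0 (iA x Q) = 0.
Proof.
rewrite /diff_comm linear_sum big1 // => i _; rewrite linearZ /= /diff_comm_var /ev0 ffunE mcoeffZ.
rewrite sum_ffunE raddf_sum big1 ?mulr0 // => l _ /=; rewrite !ffunE /= /xmul rmorphM /=.
have -> : ((r l)^`M(i))@_0 = 0; last by rewrite mul0r.
by rewrite mcoeff_deriv (dhomog_nemf_coeff (hr l)) ?mul0rn //= mdegD mdeg0 mdeg1.
Qed.

(** [delta] is moved to the left through the contractions, leaving a commutator [iA] at each j,
    which is then moved left in turn, leaving a bracket at each i < j. The terms where [delta] or
    [iA] reaches the front die under [ev0], since r_l and its first derivatives have no constant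
    term. *)
Lemma ev0_iotas_koszul_diff (s : seq (nat * L)) Q : allhom s ->
  ev0 (iotas (unzip2 s) (delta Q)) =
  \sum_(0 <= j < size s) \sum_(0 <= i < j)
    (-1) ^+ (size s - j.+1 + (nth 0 (unzip1 s) j) * pdeg (drop i.+1 (take j s)))%N *
    ev0 (iotas (unzip2 (take i (take j s)) ++
               br (nth 0 (unzip2 s) i) (nth 0 (unzip2 s) j) ::
               unzip2 (drop i.+1 (take j s)) ++ unzip2 (drop j.+1 s)) Q).
Proof.
move=> hs; rewrite iotas_koszul_diff linearD linearZ /= ev0_koszul_diff mulr0 add0r.
rewrite linear_sum size_map; apply: eq_big_nat => j /andP[_ js].
rewrite linearZ /= -map_take iotas_diff_comm; last by move=> a /mem_take; exact: hs.
have hj : qgr (nth 0 (unzip1 s) j)%N (nth 0 (unzip2 s) j).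
  by rewrite !(nth_map (0%N, 0)) //; apply: hs; exact: mem_nth.
rewrite linearD linearZ /= ev0_diff_comm mulr0 add0r linear_sum mulr_sumr.
rewrite size_takel ?(ltnW js) //; apply: eq_big_nat => i /andP[_ ij].
rewrite linearZ /= mulrA iotas_cat /= iotas_cat -map_drop.
have -> : nth 0 (unzip2 (take j s)) i = nth 0 (unzip2 s) i by rewrite /unzip2 map_take nth_take.
(* The sign obtained lacks the factor k_j of the Chevalley-Eilenberg sign. For k_j = 1 this makes no
   difference, and otherwise the bracket with x_j vanishes. *)
have [j1|j1] := eqVneq (nth 0 (unzip1 s) j)%N 1%N; first by rewrite j1 mul1n exprD.
rewrite (qbr_eq0r _ _ (qgr_neq1 hj j1)).
have z R : iota_ 0 R = 0 :> E.
  by rewrite /iota_ big1 // => u _; case: u => a; rewrite /= mxE scale0r.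
by rewrite z linear0 linear0 !mulr0.
Qed.

End Cochains.

(** * The comparison of the Koszul complex with the cochain complex *)

Section Inversions.
Variables (K : fieldType) (V : lmodType K) (n : nat).
Variables (op : 'I_n -> V -> V) (c : 'I_n -> 'I_n -> K).
Hypothesis op_scale : forall a t v, op a (t *: v) = t *: op a v.
Hypothesis opC : forall a b v, op a (op b v) = c a b *: op b (op a v).

Implicit Types (a b : 'I_n) (s t : seq 'I_n) (v : V).

(* The factor produced by sorting s, when op a and op b commute up to c a b. *)
Fixpoint inv_sign (s : seq 'I_n) : K :=
  if s is a :: s' then (\prod_(b <- s' | (b < a)%N) c a b) * inv_sign s' else 1.

Lemma foldr_pull (s1 : seq 'I_n) a (s2 : seq 'I_n) v :
  foldr op v (s1 ++ a :: s2) = (\prod_(b <- s1) c b a) *: op a (foldr op v (s1 ++ s2)).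
Proof.
elim: s1 => [|b s1 IH] /=; first by rewrite big_nil scale1r.
by rewrite IH op_scale opC scalerA big_cons mulrC.
Qed.

Lemma inv_sign_pull (s1 : seq 'I_n) a (s2 : seq 'I_n) : {in s1 ++ s2, forall b : 'I_n, (a < b)%N} ->
  inv_sign (s1 ++ a :: s2) = (\prod_(b <- s1) c b a) * inv_sign (s1 ++ s2).
Proof.
elim: s1 => [|b s1 IH] /= ab.
  rewrite big_nil mul1r big_seq_cond big1 ?mul1r // => b /andP[bs].
  by rewrite ltnNge (ltnW (ab b bs)).
rewrite IH => [|e es]; last by apply: ab; rewrite inE es orbT.
rewrite !big_cat !big_cons /= ab ?inE ?eqxx //; ring.
Qed.

(** The head of t, the smallest letter, is pulled to the front of s; the factors collected are those
    of the inversions of s in which it is the smaller letter. *)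
Lemma foldr_sort s t v : perm_eq s t -> sorted (fun a b : 'I_n => (a < b)%N) t ->
  foldr op v s = inv_sign s *: foldr op v t.
Proof.
elim: t s => [|a t IH] s; first by move/perm_nilP ->; rewrite /= scale1r.
move=> st sort_t; have sa : a \in s by rewrite (perm_mem st) inE eqxx.
case/splitPr: s / sa st => s1 s2; rewrite perm_catC cat_cons perm_cons perm_catC => st.
rewrite foldr_pull inv_sign_pull; last first.
  move=> b; rewrite (perm_mem st) => bt.
  have tr : transitive (fun a b : 'I_n => (a < b)%N) by move=> ? ? ?; exact: ltn_trans.
  by move: sort_t; rewrite /= path_sortedE // => /andP[/allP + _]; exact.
rewrite (IH _ st) ?(path_sorted sort_t) // op_scale scalerA //.
Qed.

Lemma inv_sign_prod p (g : 'I_p -> 'I_n) :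
  \prod_(i < p) \prod_(j < p | (i < j)%N && (g j < g i)%N) c (g i) (g j) =
  inv_sign [seq g i | i <- enum 'I_p].
Proof.
elim: p g => [|p IH] g.
  by rewrite big_ord0 (size0nil (size_enum_ord 0)).
rewrite big_ord_recl enum_ordSl /= -map_comp -(IH (g \o lift ord0)); congr (_ * _).
  rewrite big_mkcond big_ord_recl /= mul1r big_map big_enum_cond /=.
  by rewrite [RHS]big_mkcond.
apply: eq_bigr => i _.
by rewrite big_mkcond big_ord_recl /= mul1r -big_mkcond.
Qed.

End Inversions.

Section ExtCochain.
Variables (K : numFieldType) (m d : nat) (r : 'I_d -> {mpoly K[m]}).
Hypothesis hr : forall l, r l \is 2.-homog.
Local Notation P := {mpoly K[m]}.
Local Notation E := (ext K m d).
Local Notation L := (qlie r).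
Local Notation br := (qbr r).
Local Notation delta := (koszul_diff r).
Implicit Types (Q R : E).

(** Contract with the arguments, the last one first, and take the constant term. Iterated
    derivatives turn a polynomial into a symmetric form without dividing by factorials. Q may be
    inhomogeneous: only its part of total degree p in x and eps is seen. *)
Definition ext_cochain p Q : cochain L p := fun x => ev0 (iotas [seq x i | i <- enum 'I_p] Q).
Arguments ext_cochain : clear implicits.

Lemma Psi_linear p c Q R x : ext_cochain p (c *: Q + R) x = c * ext_cochain p Q x + ext_cochain p R x.
Proof. by rewrite /ext_cochain !linearP. Qed.

Lemma PsiZ p c Q x : ext_cochain p (c *: Q) x = c * ext_cochain p Q x.
Proof. by rewrite /ext_cochain !linearZ. Qed.

Lemma Psi0 p x : ext_cochain p 0 x = 0.
Proof. by rewrite /ext_cochain !linear0. Qed.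

Lemma PsiD p Q R x : ext_cochain p (Q + R) x = ext_cochain p Q x + ext_cochain p R x.
Proof. by rewrite /ext_cochain !linearD. Qed.

Lemma PsiB p Q R x : ext_cochain p (Q - R) x = ext_cochain p Q x - ext_cochain p R x.
Proof. by rewrite /ext_cochain !linearB. Qed.

Lemma Psi_multilinear p Q : multilinear (ext_cochain p Q).
Proof.
move=> i x c u v upd; rewrite /ext_cochain.
have [e1 [e2 [-> i1 i2]]] : exists e1 e2, [/\ enum 'I_p = e1 ++ i :: e2, i \notin e1 & i \notin e2].
  have ie : i \in enum 'I_p by rewrite mem_enum.
  have := enum_uniq 'I_p; case/splitPr: (enum _) / ie => e1 e2.
  rewrite cat_uniq /= negb_or => /and4P[_ /andP[i1 _] i2 _].
  by exists e1, e2.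
have E (e : seq 'I_p) w : i \notin e -> [seq upd w j | j <- e] = [seq x j | j <- e].
  move=> ie; apply/eq_in_map => j je; rewrite ffunE.
  by case: eqVneq => // ji; rewrite -ji je in ie.
rewrite !map_cat !iotas_cat /= !E // !ffunE eqxx.
by rewrite iota_P !linearP.
Qed.

Lemma Psi_alternating p Q : super_alternating (ext_cochain p Q).
Proof.
move=> k x s hx; rewrite /ext_cochain.
pose op := fun i => @iota_ K m d (x i); pose c := fun i j => ksign K (k i) (k j).
have opZ a t R : op a (t *: R) = t *: op a R by rewrite /op linearZ.
have opC a b R : op a (op b R) = c a b *: op b (op a R) by exact: (iota_C _ (hx a) (hx b)).
have iE e : iotas [seq x i | i <- e] Q = foldr op Q e by rewrite /iotas foldr_map.
rewrite [super_sign K k s](inv_sign_prod c s) iE.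
have -> : [seq [ffun i => x (s i)] i | i <- enum 'I_p] =
    [seq x i | i <- [seq s i | i <- enum 'I_p]].
  by rewrite -[RHS]map_comp; apply: eq_map => i; rewrite ffunE.
rewrite iE (foldr_sort opZ opC (t := enum 'I_p)) ?linearZ //.
- apply: uniq_perm; last 1 first.
  + move=> i; rewrite mem_enum; apply/mapP; exists (s^-1%g i); first by rewrite mem_enum.
    by rewrite permKV.
  + by rewrite map_inj_uniq ?enum_uniq //; exact: perm_inj.
  + exact: enum_uniq.
- have := iota_ltn_sorted 0 p; rewrite -val_enum_ord sorted_map.
  exact: sub_sorted.
Qed.

Lemma Psi_cochain p Q : is_cochain (ext_cochain p Q).
Proof. by split; [exact: Psi_multilinear | exact: Psi_alternating]. Qed.

(** Moving [delta] past the p - j arguments that follow x_j costs (-1)^(p-j); the factor (-1)^p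
    turns this into the (-1)^j of [is_differential]. *)
Lemma Psi_differential p Q :
  is_differential (ext_cochain p Q) (ext_cochain p.+1 ((-1) ^+ p *: delta Q)).
Proof.
move=> k x hx; rewrite PsiZ /ext_cochain.
pose s := [seq (k i, x i : qcar K m d) | i <- enum 'I_p.+1].
have s2 : unzip2 s = [seq x i | i <- enum 'I_p.+1] by rewrite /unzip1 /unzip2 -[LHS]map_comp.
have s1 : unzip1 s = [seq k i | i <- enum 'I_p.+1] by rewrite /unzip1 /unzip2 -[LHS]map_comp.
have hs : allhom s by move=> a /mapP[i _ ->]; exact: hx.
have sz : size s = p.+1 by rewrite size_map size_enum_ord.
rewrite -s2 (ev0_iotas_koszul_diff hr) // sz big_mkord mulr_sumr; apply: eq_bigr => j _.
rewrite mulr_sumr (big_nat_widen _ _ p.+1) ?(ltnW (ltn_ord j)) // big_mkord.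
apply: eq_big => [i|i ij]; first by rewrite andTb.
have nth1 (l : 'I_p.+1) : nth 0%N (unzip1 s) l = k l.
  by rewrite s1 (nth_map j) ?size_enum_ord // nth_ord_enum.
have nth2 (l : 'I_p.+1) : nth 0 (unzip2 s) l = x l.
  by rewrite s2 (nth_map j) ?size_enum_ord // nth_ord_enum.
have jp : (j <= p)%N by rewrite -ltnS.
rewrite nth1 !nth2 subSS mulrA; congr (_ * _); last (congr (ev0 _); congr (foldr _ _ _)).
  have -> : pdeg (drop i.+1 (take j s)) = (\sum_(l < p.+1 | (i < l < j)%N) k l)%N.
    rewrite /pdeg (big_nth (0%N, 0)) size_drop size_takel ?sz ?(ltnW (ltn_ord j)) //.
    under [RHS]eq_bigr do rewrite -nth1.
    rewrite -(big_mkord (fun l => (i < l < j)%N) (nth 0%N (unzip1 s))).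
    rewrite -(big_nat_widen 0 j p.+1 (fun l => (i < l)%N)) ?(ltnW (ltn_ord j)) //.
    rewrite -(big_nat_widenl i.+1 0 j xpredT) // -[in RHS](add0n i.+1) big_addn.
    apply: eq_big_nat => l /andP[_ lj].
    have lij : (l + i.+1 < j)%N by rewrite addnC -ltn_subRL.
    rewrite nth_drop nth_take addnC // (nth_map (0%N, 0)) // sz.
    exact: leq_trans lij (ltnW (ltn_ord j)).
  rewrite -exprD; set X := (k j * _)%N.
  have -> : (p + (p - j + X) = j + X + (p - j).*2)%N by lia.
  by rewrite -[LHS]signr_odd oddD odd_double addbF signr_odd.
have szX : size (unzip2 s) = p.+1 by rewrite size_map.
have -> : unzip2 (take i (take j s)) = take i (take j (unzip2 s)) by rewrite /unzip2 !map_take.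
have -> : unzip2 (drop i.+1 (take j s)) = drop i.+1 (take j (unzip2 s)).
  by rewrite /unzip2 map_drop map_take.
have -> : unzip2 (drop j.+1 s) = drop j.+1 (unzip2 s) by rewrite /unzip2 map_drop.
have jX : (j <= size (unzip2 s))%N by rewrite szX ltnW.
have sizeT : size (take i (take j (unzip2 s))) = i by rewrite !size_takel // ltnW.
(* Both lists have length p. Position a holds the bracket if a = i, and otherwise x_a or x_(a+1)
   according to whether a < j or a >= j. The cases a < i, a > i and a = i are treated in this
   order. *)
apply: (@eq_from_nth _ 0).
  rewrite size_map size_enum_ord size_cat /= size_cat sizeT !size_drop size_takel // szX subSS.
  by move: ij jp; clear; move: (nat_of_ord i) (nat_of_ord j) => {}i {}j; lia.
move=> a; rewrite size_cat /= size_cat sizeT !size_drop size_takel // szX subSS => ha.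
have ap : (a < p)%N.
  by move: ij jp ha; clear; move: (nat_of_ord i) (nat_of_ord j) => {}i {}j; lia.
rewrite (nth_map (Ordinal ap)) ?size_enum_ord // (nth_ord_enum _ (Ordinal ap)) ffunE.
rewrite nth_cat sizeT.
rewrite -val_eqE /=.
case: ltngtP => ai.
- rewrite !nth_take // ?(ltn_trans ai) // -(nth2 (lift j (Ordinal ap))) /= /bump leqNgt (ltn_trans ai ij) /= add0n.
  by rewrite ltn_eqF.
- rewrite -[(a - i)%N]prednK ?subn_gt0 //= nth_cat size_drop size_takel // nth_drop.
  have e : (i.+1 + (a - i).-1 = a)%N by rewrite addSnnS prednK ?subn_gt0 // subnKC // ltnW.
  rewrite -(nth2 (lift j (Ordinal ap))) /=.
  case: (leqP j a) => ja.
    have -> : bump j a = a.+1 by rewrite /bump ja.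
    rewrite (gtn_eqF (ltnW (ai : (i.+1 < a.+1)%N))).
    have -> : ((a - i).-1 < j - i.+1)%N = false.
      by apply/negbTE; move: ij ja ai; clear; move: (nat_of_ord i) (nat_of_ord j) => {}i {}j; lia.
    rewrite nth_drop; congr nth.
    by move: ij ja ai; clear; move: (nat_of_ord i) (nat_of_ord j) => {}i {}j; lia.
  have -> : bump j a = a by rewrite /bump leqNgt ja.
  rewrite gtn_eqF // e.
  have -> : ((a - i).-1 < j - i.+1)%N.
    by move: ij ja ai; clear; move: (nat_of_ord i) (nat_of_ord j) => {}i {}j; lia.
  by rewrite nth_take.
- have -> : bump j a = i by rewrite /bump ai leqNgt (ij : (i < j)%N).
  by rewrite [X in nth _ _ X](_ : _ = 0%N) ?eqxx // ai subnn.
Qed.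
End ExtCochain.
Arguments ext_cochain {K m d} r p Q _.
Arguments Psi_differential {K m d r} hr p Q.

(** * Splitting off the last argument of a cochain *)

Section Snoc.
Variables (T : Type) (p : nat).

(** The last argument is the one contracted first in [ext_cochain], so appending w amounts to
    replacing Q by its contraction with w ([Psi_snoc]). *)
Definition fsnoc (y : {ffun 'I_p -> T}) (u : T) : {ffun 'I_p.+1 -> T} :=
  [ffun i => if unlift ord_max i is Some j then y j else u].
Definition finit (x : {ffun 'I_p.+1 -> T}) : {ffun 'I_p -> T} :=
  [ffun i => x (lift ord_max i)].

Lemma fsnoc_lift y u i : fsnoc y u (lift ord_max i) = y i.
Proof. by rewrite ffunE liftK. Qed.

Lemma fsnoc_max y u : fsnoc y u ord_max = u.
Proof. by rewrite ffunE unlift_none. Qed.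

Lemma fsnocK x : fsnoc (finit x) (x ord_max) = x.
Proof.
by apply/ffunP=> i; rewrite ffunE; case: unliftP => [j|] ->; rewrite ?ffunE.
Qed.

Lemma fsnoc_enum y u :
  [seq fsnoc y u i | i <- enum 'I_p.+1] = rcons [seq y i | i <- enum 'I_p] u.
Proof.
rewrite enum_ordSr map_rcons fsnoc_max; congr rcons.
rewrite -[LHS]map_comp; apply: eq_map => i /=; rewrite -(fsnoc_lift y u).
by congr (fsnoc _ _ _); apply: val_inj; rewrite /= /bump leqNgt ltn_ord.
Qed.

End Snoc.

Lemma ord0_false (i : 'I_0) : False.
Proof. by case: i. Qed.

(** * Every cochain comes from exactly one element of the Koszul complex *)

Section PsiBijective.
Variables (K : numFieldType) (m d : nat) (r : 'I_d -> {mpoly K[m]}).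
Local Notation P := {mpoly K[m]}.
Local Notation E := (ext K m d).
Local Notation L := (qlie r).
Local Notation Psi := (ext_cochain r).
Implicit Types (Q R : E) (u v : 'I_m + 'I_d).

Lemma Psi_snoc p Q (y : {ffun 'I_p -> L}) (w : L) :
  Psi p.+1 Q (fsnoc y w) = Psi p (iota_ w Q) y.
Proof. by rewrite /ext_cochain fsnoc_enum -cats1 iotas_cat. Qed.

Definition bas u : L :=
  match u with inl i => (delta_mx 0 i, 0) | inr l => (0, delta_mx 0 l) end.

Lemma coord_bas u v : coord (bas u) v = (u == v)%:R.
Proof. by case: u v => [i|l] [j|k]; rewrite /= !mxE ?eqxx //= eq_sym. Qed.

Lemma bas_gr u : lie_gr (bdeg u) (bas u).
Proof. by case: u. Qed.

Lemma iota_bas u Q : iota_ (bas u) Q = biota u Q.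
Proof.
rewrite /iota_ (bigD1 u) //= coord_bas eqxx scale1r big1 ?addr0 // => v.
by rewrite coord_bas eq_sym => /negPf ->; rewrite scale0r.
Qed.

Lemma coord_inj (x y : L) : coord x =1 coord y -> x = y.
Proof.
case: x y => [x1 x2] [y1 y2] h; congr (_, _); apply/rowP=> i.
  exact: (h (inl i)).
exact: (h (inr i)).
Qed.

Lemma coord_lincomb (T : Type) (s : seq T) (c : T -> K) (G : T -> L) u :
  coord (\sum_(i <- s) c i *: G i) u = \sum_(i <- s) c i * coord (G i) u.
Proof.
elim: s => [|i s IH]; last by rewrite !big_cons coordP IH.
by rewrite !big_nil; case: u => i; rewrite /= mxE.
Qed.

Lemma coord_sum (x : L) : x = \sum_u coord x u *: bas u.
Proof.
apply: coord_inj => v; rewrite coord_lincomb (bigD1 v) //= coord_bas eqxx mulr1.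
by rewrite big1 ?addr0 // => u; rewrite coord_bas => /negPf ->; rewrite mulr0.
Qed.

Lemma lincomb_morph (V : lmodType K) (F : L -> V) :
  (forall c x y, F (c *: x + y) = c *: F x + F y) ->
  forall (T : Type) (s : seq T) (c : T -> K) (G : T -> L),
  F (\sum_(i <- s) c i *: G i) = \sum_(i <- s) c i *: F (G i).
Proof.
move=> FL T s c G; have F0 : F 0 = 0.
  by have := FL (-1) 0 0; rewrite scaler0 addr0 scaleN1r addNr.
by elim: s => [|i s IH]; rewrite ?big_nil // !big_cons FL IH.
Qed.

Lemma linear_coord (F : L -> K) (w : L) :
  (forall c x y, F (c *: x + y) = c * F x + F y) ->
  F w = \sum_u coord w u * F (bas u).
Proof.
by move=> FL; rewrite {1}(coord_sum w) (lincomb_morph (V := K^o) (F := F)).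
Qed.

Lemma qbr_bas i j :
  qbr r (bas (inl i)) (bas (inl j)) = \sum_l hess r l i j *: bas (inr l).
Proof.
apply: coord_inj => u; rewrite (coord_lincomb _ _ (fun l => bas (inr l))).
under eq_bigr do rewrite coord_bas.
case: u => [a|k] /=; first by rewrite mxE big1 // => l _; rewrite mulr0.
rewrite (bigD1 k) //= eqxx mulr1 big1 ?addr0 => [|l lk]; last first.
  by rewrite (_ : inr l == inr k = false) ?mulr0 //; apply: contraNF lk => /eqP[->].
rewrite mxE (bigD1 i) //= (bigD1 j) //= !mxE !eqxx !mul1r.
rewrite !big1 ?addr0 // => [a /negPf ai|a /negPf aj].
  by rewrite big1 // => b _; rewrite mxE ai andbF !mul0r.
by rewrite !mxE aj andbF mulr0 mul0r.
Qed.

Fact euler_linear : linear (@euler K m d).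
Proof.
move=> c Q R; rewrite /euler scaler_sumr -big_split; apply: eq_bigr => u _ /=.
by rewrite !linearP.
Qed.
HB.instance Definition _ := GRing.isLinear.Build K E E _ (@euler K m d) euler_linear.

Lemma euler_biota v Q : euler (biota v Q) = biota v (euler Q) - biota v Q.
Proof.
rewrite /euler linear_sum /=.
under [in RHS]eq_bigr do rewrite biota_bmul.
rewrite big_split /= [X in _ = X + _ - _](bigD1 v) //= eqxx scale1r [\sum_(i | i != v) _]big1 ?addr0; last first.
  by move=> u; rewrite eq_sym => /negPf ->; rewrite scale0r.
rewrite addrAC subrr add0r; apply: eq_bigr => u _.
by rewrite biotaC linearZ /= /bsign mulnC.
Qed.

Lemma euler_eq0 (c : K) Q : (forall (S : {set 'I_d}) (b : 'X_{1..m}), (mdeg b + #|S|)%:R != c \/ (Q S)@_b = 0) ->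
  euler Q = c *: Q -> Q = 0.
Proof.
move=> hc hQ; apply/ffunP=> S; apply/mpolyP=> b; rewrite ffunE mcoeff0.
have [cN|//] := hc S b.
have := eulerE Q S b; rewrite hQ ffunE mcoeffZ => /eqP.
by rewrite -subr_eq0 -mulrBl mulf_eq0 subr_eq0 eq_sym (negPf cN) => /eqP.
Qed.

Lemma euler_neg Q (n : nat) : euler Q = - n.+1%:R *: Q -> Q = 0.
Proof.
apply: euler_eq0 => S b; left; rewrite -subr_eq0 opprK -natrD pnatr_eq0.
by rewrite addnS.
Qed.

(* [euler Q = p *: Q] says that Q is a p-cochain: x_i and eps_l both have cochain
   degree 1. *)
Lemma Psi_inj p Q :
  (forall t : 'I_p -> 'I_m + 'I_d, Psi p Q [ffun i => bas (t i)] = 0) ->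
  euler Q = p%:R *: Q -> Q = 0.
Proof.
elim: p Q => [|p IH] Q hQ eQ.
  apply: euler_eq0 (eQ) => S b.
  have [S0|S0] := eqVneq S set0; have [b0|b0] := eqVneq b 0%MM.
  - right; rewrite S0 b0; move: (hQ (fun i => False_rect _ (ord0_false i))).
    by rewrite /ext_cochain (size0nil (size_enum_ord 0)).
  - left; rewrite pnatr_eq0 addn_eq0 mdeg_eq0 (negPf b0) //.
  - left; rewrite pnatr_eq0 addn_eq0 cards_eq0 (negPf S0) andbF //.
  - left; rewrite pnatr_eq0 addn_eq0 cards_eq0 (negPf S0) andbF //.
(* By induction every contraction of Q vanishes, hence so does [euler Q], which is p + 1 times Q. *)
have z u : biota u Q = 0.
  apply: IH; last by rewrite euler_biota eQ linearZ /= -natr1 scalerDl scale1r addrK.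
  move=> t; have := hQ (fun i => if unlift ord_max i is Some j then t j else u).
  rewrite -iota_bas -Psi_snoc => <-; congr (Psi _ _ _).
  by apply/ffunP=> i; rewrite !ffunE; case: unlift => // j; rewrite ffunE.
have : euler Q = 0 by rewrite /euler big1 // => u _; rewrite z linear0.
by rewrite eQ => /eqP; rewrite scaler_eq0 pnatr_eq0 => /eqP.
Qed.

Lemma super_sign_snoc p (k : 'I_p -> nat) (b : nat) (s : 'S_p) :
  super_sign K (fun i => if unlift ord_max i is Some j then k j else b)
    (lift_perm ord_max ord_max s) = super_sign K k s.
Proof.
rewrite /super_sign big_ord_recr /= [X in _ * X]big1 ?mulr1; last first.
  by move=> j /andP[]; rewrite ltnNge -ltnS ltn_ord.
have wl (i : 'I_p) : widen_ord (leqnSn p) i = lift ord_max i.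
  by apply: val_inj; rewrite /= /bump leqNgt ltn_ord.
apply: eq_bigr => i _; rewrite big_mkcond big_ord_recr /= lift_perm_id !wl lift_perm_lift.
rewrite [X in _ * X]ifF ?mulr1; last first.
  by apply/negP => /andP[_]; rewrite ltnNge -ltnS ltn_ord.
rewrite [RHS]big_mkcond; apply: eq_bigr => j _; rewrite !wl lift_perm_lift !liftK.
by rewrite !lift_max.
Qed.

Lemma cochain_snoc p (f : cochain L p.+1) u :
  is_cochain f -> is_cochain (fun y => f (fsnoc y (bas u))).
Proof.
case=> fm fa; split.
  move=> i x c w1 w2 upd.
  have E w : fsnoc (upd w) (bas u) =
      [ffun j => if j == lift ord_max i then w else fsnoc x (bas u) j].
    apply/ffunP=> j; rewrite !ffunE; case: unliftP => [a|] ->.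
      by rewrite ffunE (inj_eq lift_inj).
    by rewrite (negPf (neq_lift _ _)).
  by rewrite !E; exact: fm.
move=> k x s hx.
pose k' := fun i => if unlift ord_max i is Some j then k j else bdeg u.
have hx' : homogeneous k' (fsnoc x (bas u)).
  by move=> i; rewrite ffunE /k'; case: unliftP => [j|] _ //; exact: bas_gr.
rewrite -(super_sign_snoc k (bdeg u)) -(fa _ _ (lift_perm ord_max ord_max s) hx').
congr f; apply/ffunP=> i; rewrite [RHS]ffunE.
case: (unliftP ord_max i) => [j|] ->; first by rewrite lift_perm_lift !fsnoc_lift ffunE.
by rewrite lift_perm_id !fsnoc_max.
Qed.

Lemma cochain_linear_last p (f : cochain L p.+1) (y : {ffun 'I_p -> L}) c w1 w2 :
  is_cochain f ->
  f (fsnoc y (c *: w1 + w2)) = c * f (fsnoc y w1) + f (fsnoc y w2).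
Proof.
case=> fm _; have E w : fsnoc y w = [ffun j => if j == ord_max then w else fsnoc y 0 j].
  apply/ffunP=> j; rewrite !ffunE; case: unliftP => [a|] ->; last by rewrite eqxx.
  by rewrite eq_sym (negPf (neq_lift _ _)).
by rewrite (E (_ + _)) (E w1) (E w2); exact: (fm ord_max (fsnoc y 0) c w1 w2).
Qed.

(** The transposition of the last two positions has that pair as its only inversion. *)
Lemma super_sign_last p (k : 'I_p.+2 -> nat) (a := lift ord_max ord_max : 'I_p.+2) :
  super_sign K k (tperm a ord_max) = ksign K (k a) (k ord_max).
Proof.
have av : a = p :> nat by rewrite /a lift_max.
clearbody a.
have aM : (a < (ord_max : 'I_p.+2))%N by rewrite av.
rewrite /super_sign (bigD1 a) //= (bigD1 ord_max) /=; last by rewrite aM tpermL tpermR.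
rewrite tpermL tpermR [X in _ * X * _]big1; last first.
  move=> j /andP[/andP[aj _] /eqP jM]; case: jM; apply: val_inj => /=.
  by have := ltn_ord j; move: aj; rewrite av; lia.
rewrite big1 ?mulr1 => [|i ia]; first by rewrite /ksign mulnC.
rewrite big1 // => j /andP[ij sji]; exfalso.
have {}ia : nat_of_ord i != p by apply: contra ia => /eqP ip; apply/eqP/val_inj; rewrite /= ip av.
have jM := ltn_ord j; have iM := ltn_ord i.
have si : tperm a ord_max i = i.
  by rewrite tpermD //; apply/eqP => /(congr1 val) /=; lia.
move: sji; rewrite si; case: tpermP => [_|_|_ _] /=; lia.
Qed.

Lemma cochain_swap_last p (f : cochain L p.+2) (t : 'I_p -> 'I_m + 'I_d) u v
    (y := [ffun i => bas (t i)]) : is_cochain f ->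
  f (fsnoc (fsnoc y (bas u)) (bas v)) = bsign K u v * f (fsnoc (fsnoc y (bas v)) (bas u)).
Proof.
case=> _ fa; pose a : 'I_p.+2 := lift ord_max ord_max.
pose k := fun i : 'I_p.+2 => if unlift ord_max i is Some j then
   (if unlift ord_max j is Some l then bdeg (t l) else bdeg v) else bdeg u.
pose x := fsnoc (fsnoc y (bas v)) (bas u).
have kx : k ord_max = bdeg u by rewrite /k unlift_none.
have ka : k a = bdeg v by rewrite /k liftK unlift_none.
have hx : homogeneous k x.
  move=> i; rewrite /x /k ffunE; case: unliftP => [j|] _; last exact: bas_gr.
  rewrite ffunE; case: unliftP => [l|] _; last exact: bas_gr.
  by rewrite ffunE; exact: bas_gr.
have /esym := fa k x (tperm a ord_max) hx; rewrite super_sign_last ka kx.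
rewrite /bsign -/(ksign K _ _) /ksign mulnC => ->; congr f; apply/ffunP=> i.
rewrite [RHS]ffunE; case: tpermP => [->|->|/eqP ia /eqP im].
- by rewrite /x fsnoc_max /a fsnoc_lift fsnoc_max.
- by rewrite /x fsnoc_max /a fsnoc_lift fsnoc_max.
- move: ia; rewrite /x; case: (unliftP ord_max i) im => [j ->|->]; last by rewrite eqxx.
  move=> _; rewrite (inj_eq lift_inj) !fsnoc_lift.
  by case: (unliftP ord_max j) => [l ->|->]; rewrite ?eqxx // !fsnoc_lift.
Qed.

(* The contractions Q_u of a preimage of f are known by induction, and satisfy
   the compatibility that lets Euler's formula Q = p^-1 sum_u u Q_u integrate
   them. *)
Lemma Psi_surj p (f : cochain L p) : is_cochain f ->
  exists2 Q, euler Q = p%:R *: Q & forall x, f x = Psi p Q x.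
Proof.
elim: p f => [|p IH] f hf.
  exists [ffun S : {set 'I_d} => if S == set0 then (f [ffun i => 0])%:MP else 0 : P].
    apply/ffunP=> S; apply/mpolyP=> b; rewrite eulerE scale0r !ffunE mcoeff0.
    case: eqVneq => [->|_]; last by rewrite mcoeff0 mulr0.
    rewrite cards0 addn0 mcoeffC; case: eqVneq => [->|_]; last by rewrite !mulr0.
    by rewrite mdeg0 mul0r.
  move=> x; rewrite /ext_cochain (size0nil (size_enum_ord 0)) /= /ev0 ffunE eqxx mcoeffC eqxx mulr1.
  by congr f; apply/ffunP=> -[].
have /boolp.choice[QQ hQQ] : forall u, exists Q : E, euler Q = p%:R *: Q /\
    forall y, f (fsnoc y (bas u)) = Psi p Q y.
  by move=> u; have [Q eQ hQ] := IH _ (cochain_snoc u hf); exists Q; split.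
have eQ u : euler (QQ u) = p%:R *: QQ u by case: (hQQ u).
have fQ u y : f (fsnoc y (bas u)) = Psi p (QQ u) y by case: (hQQ u).
have compat u v : biota v (QQ u) = bsign K v u *: biota u (QQ v).
  (* For p = 0 the contractions would have total degree -1, so they vanish. Otherwise [Psi_inj]
     reduces the equality to exchanging the last two arguments of f. *)
  case: p => [|p] in f hf IH QQ hQQ eQ fQ *.
    have z w w' : biota w (QQ w') = 0.
      by apply: (euler_neg (n := 0)); rewrite euler_biota eQ scale0r linear0 sub0r scaleN1r.
    by rewrite !z scaler0.
  apply/eqP; rewrite -subr_eq0; apply/eqP; apply: (Psi_inj (p := p)).
    move=> t; set y := (X in Psi _ _ X).
    rewrite PsiB PsiZ -!iota_bas -!Psi_snoc -!fQ cochain_swap_last //.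
    by rewrite subrr.
  have e w w' : euler (biota w (QQ w')) = p%:R *: biota w (QQ w').
    by rewrite euler_biota eQ linearZ /= -natr1 scalerDl scale1r addrK.
  by rewrite linearB linearZ /= !e scalerBr !scalerA mulrC.
pose Q := p.+1%:R^-1 *: \sum_u bmul u (QQ u).
have p1 : p.+1%:R != 0 :> K by rewrite pnatr_eq0.
(* Passing [biota v] through the sum gives [QQ v] once from the commutator, and by compatibility
   [euler (QQ v)], that is p times [QQ v], from the rest: p + 1 copies in all. *)
have bQ v : biota v Q = QQ v.
  rewrite /Q linearZ linear_sum /=; under eq_bigr do rewrite biota_bmul.
  rewrite big_split /= (bigD1 v) //= eqxx scale1r [\sum_(i | i != v) _]big1 ?addr0; last first.
    by move=> u; rewrite eq_sym => /negPf ->; rewrite scale0r.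
  rewrite (eq_bigr (fun u => bmul u (biota u (QQ v)))) => [|u _]; last first.
    by rewrite compat linearZ /= scalerA bsign_sq scale1r.
  rewrite -/(euler _) eQ -{1}[QQ v]scale1r -scalerDl scalerA addrC natr1 mulVf //.
  by rewrite scale1r.
exists Q.
  rewrite {1}/euler; under eq_bigr do rewrite bQ.
  by rewrite /Q scalerA mulfV // scale1r.
move=> x; rewrite -(fsnocK x); set y := finit x; set w := x ord_max.
rewrite (linear_coord w (F := fun w => f (fsnoc y w))); last first.
  by move=> c w1 w2; exact: cochain_linear_last.
rewrite (linear_coord w (F := fun w => Psi p.+1 Q (fsnoc y w))); last first.
  by move=> c w1 w2; apply: cochain_linear_last; exact: Psi_cochain.
by apply: eq_bigr => u _; rewrite fQ Psi_snoc iota_bas bQ.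
Qed.

End PsiBijective.

(** * Exactness of the Koszul complex *)

Section Exactness.
Variables (K : numFieldType) (m d : nat) (r : 'I_d -> {mpoly K[m]}).
Variables (mu : 'I_d -> 'X_{1..m}) (val : 'I_d -> 'X_{1..m} -> nat) (wt : 'I_m -> nat).
Local Notation P := {mpoly K[m]}.
Local Notation E := (ext K m d).
Local Notation delta := (koszul_diff r).
Local Notation sg := (ext_sign K).
Implicit Types (Q R z : E) (S : {set 'I_d}) (b g : 'X_{1..m}) (l k : 'I_d).

Definition mweight b : nat := (\sum_i b i * wt i)%N.

(* [val l] is the exponent of mu l in a monomial; valD says that the mu l are
   pairwise coprime. *)
Hypothesis valD : forall l k b, val l (b + mu k)%MM = (val l b + (l == k))%N.
Hypothesis val_le : forall l b, val l b != 0%N -> (mu l <= b)%MM.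
Hypothesis lower : forall l b, b \in msupp (r l - 'X_[mu l]) -> (mweight b < mweight (mu l))%N.

Lemma mweightD b g : mweight (b + g)%MM = (mweight b + mweight g)%N.
Proof.
by rewrite /mweight -big_split; apply: eq_bigr => i _; rewrite mnmDE mulnDl.
Qed.

Lemma mu_leE l b : (mu l <= b)%MM = (val l b != 0%N).
Proof.
apply/idP/idP => [h|]; last exact: val_le.
by rewrite -(submK h) valD eqxx addn1.
Qed.

Definition vsum b : nat := (\sum_l val l b)%N.

Lemma vsumD b k : vsum (b + mu k)%MM = (vsum b).+1.
Proof.
rewrite /vsum (eq_bigr (fun l => (val l b + (l == k))%N)) => [|l _]; last exact: valD.
by rewrite big_split /= (bigD1 k) //= [in X in (_ + X)%N](bigD1 k) //= eqxx
  [X in (1 + X)%N]big1 ?addn1 // => l /negPf ->.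
Qed.

(* The homotopy divides by mu l and multiplies by eps_l, with weight the
   exponent of mu l over the total exponent in x and eps: this is Euler's formula
   for the Koszul complex of the independent variables mu l. *)
Definition divmu l (n : nat) (p : P) : P :=
  \sum_(b <- msupp p) (p@_b * ((val l b)%:R / (n.-1 + vsum b)%:R)) *: 'X_[b - mu l].

(** Division by mu l lowers the total x-exponent by one while the homotopy raises the exterior
    degree by one, so the denominator is the same seen from the source monomial g + mu l or from the
    target g. *)
Lemma divmuE l n p g : (0 < n)%N ->
  (divmu l n p)@_g = (val l g).+1%:R / (n + vsum g)%:R * p@_(g + mu l).
Proof.
move=> n0; rewrite /divmu raddf_sum /=.
under eq_bigr do rewrite mcoeffZ mcoeffX.
have [gp|gp] := boolP ((g + mu l)%MM \in msupp p); last first.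
  rewrite (memN_msupp_eq0 gp) mulr0 big_seq big1 // => b bp.
  (* Where mu l does not divide b, the truncated difference b - mu l is meaningless, and the factor
     val l b = 0 removes it. *)
  have [v0|v0] := eqVneq (val l b) 0%N; first by rewrite v0 mul0r mulr0 mul0r.
  case: eqVneq => [e|_]; rewrite ?mulr0 //.
  by rewrite -e submK ?val_le // bp in gp.
rewrite (bigD1_seq _ gp) ?msupp_uniq //= addmK eqxx mulr1 valD eqxx addn1 vsumD.
rewrite addnS -addSn prednK // mulrC big1 ?addr0 // => b bg.
have [v0|v0] := eqVneq (val l b) 0%N; first by rewrite v0 mul0r mulr0 mul0r.
case: eqVneq => [e|_]; rewrite ?mulr0 //.
by rewrite -e submK ?val_le // eqxx in bg.
Qed.

Definition htpy Q : E :=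
  [ffun S : {set 'I_d} => \sum_(l in S) sg l S *: divmu l #|S| (Q (S :\ l))].

Lemma htpyE Q S g : (htpy Q S)@_g = \sum_(k in S)
  sg k S * ((val k g).+1%:R / (#|S| + vsum g)%:R * (Q (S :\ k))@_(g + mu k)).
Proof.
rewrite ffunE raddf_sum; apply: eq_bigr => k kS /=; rewrite mcoeffZ divmuE //.
by apply/card_gt0P; exists k.
Qed.

(* [deltal] comes from the terms of lower weight. *)
Definition delta0 Q : E := \sum_l coefwise (xmul 'X_[mu l]) (contr l Q).
Definition deltal Q : E := \sum_l coefwise (xmul (r l - 'X_[mu l])) (contr l Q).

Lemma delta_split Q : delta Q = delta0 Q + deltal Q.
Proof.
rewrite -big_split; apply: eq_bigr => l _ /=; apply/ffunP=> S.
by rewrite !ffunE /= /xmul -mulrDl addrC subrK.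
Qed.

Lemma delta0E Q S g : (delta0 Q S)@_g =
  \sum_(l | (l \notin S) && (mu l <= g)%MM) sg l S * (Q (l |: S))@_(g - mu l).
Proof.
rewrite sum_ffunE raddf_sum [RHS]big_mkcond; apply: eq_bigr => l _ /=.
rewrite !ffunE /= /xmul; case: ifP => lS /=; first by rewrite mulr0 mcoeff0.
by rewrite mulrC mcoeffMXif mcoeffZ.
Qed.

(** The terms that insert l and remove k, for l outside S and k in S, occur in both composites with
    opposite signs, by [sg_cross]. The diagonal terms add up to the sum of val l g over l outside S
    plus that of val k g + 1 over k in S, which is the denominator N. Nonemptiness of S makes N
    nonzero. *)
Lemma htpy_identity Q S g : S != set0 ->
  (delta0 (htpy Q) S)@_g + (htpy (delta0 Q) S)@_g = (Q S)@_g.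
Proof.
move=> S0; rewrite delta0E htpyE.
set N := (#|S| + vsum g)%:R : K.
have N0 : N != 0 by rewrite pnatr_eq0 addn_eq0 cards_eq0 (negPf S0).
have A l : l \notin S -> (mu l <= g)%MM ->
  sg l S * (htpy Q (l |: S))@_(g - mu l) = (val l g)%:R / N * (Q S)@_g +
   \sum_(k in S) sg l S * sg k (l |: S) * ((val k g).+1%:R / N *
        (Q (l |: (S :\ k)))@_(g - mu l + mu k)).
  move=> lS lg; have vg k : val k g = (val k (g - mu l)%MM + (k == l))%N.
    by rewrite -valD submK.
  rewrite htpyE cardsU1 lS /= add1n addSnnS -(vsumD _ l) submK // -/N.
  rewrite big_setU1 //= mulrDr; congr (_ + _).
    rewrite mulrA sgU // ltnn mul1r sg_sq mul1r submK // setU1K //.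
    by rewrite vg eqxx addn1.
  rewrite mulr_sumr; apply: eq_bigr => k kS; rewrite mulrA.
  have kl : k != l by apply: contraNneq lS => <-.
  rewrite [in val k g]vg (negPf kl) addn0; congr (_ * (_ * (Q _)@__)).
  by apply/setP=> j; rewrite !inE; case: (eqVneq j l) => [->|]; rewrite // eq_sym (negPf kl).
have B k : k \in S ->
  sg k S * ((val k g).+1%:R / N * (delta0 Q (S :\ k))@_(g + mu k)) =
   (val k g).+1%:R / N * (Q S)@_g -
   \sum_(l | (l \notin S) && (mu l <= g)%MM) sg l S * sg k (l |: S) *
      ((val k g).+1%:R / N * (Q (l |: (S :\ k)))@_(g - mu l + mu k)).
  move=> kS; rewrite delta0E (bigD1 k) /=; last by rewrite !inE eqxx lem_addl.
  rewrite addmK setD1K // sgD1 // mulrDr mulrDr; congr (_ + _).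
    by rewrite mulrCA; congr (_ * _); rewrite mulrA sg_sq mul1r.
  rewrite !mulr_sumr -sumrN; apply: eq_big => [l|l /andP[/andP[lS lg] lk]].
    rewrite !inE negb_and negbK andbC; case: (eqVneq l k) => [->|lk] /=; first by rewrite kS.
    by rewrite !mu_leE valD (negPf lk) addn0.
  have {}lS : l \notin S by move: lS; rewrite !inE (negPf lk) /=.
  have {}lg : (mu l <= g)%MM by move: lg; rewrite !mu_leE valD (negPf lk) addn0.
  rewrite (sg_cross _ lk lS kS) mulNr opprK.
  have -> : (g - mu l + mu k = g + mu k - mu l)%MM by rewrite addmC addmBA // addmC.
  by ring.
rewrite (eq_bigr _ (fun l h => A l (andP h).1 (andP h).2)) (eq_bigr _ B).
rewrite !big_split /= sumrN [X in _ + X + _ = _]exchange_big /= addrACA subrr addr0.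
rewrite -!mulr_suml -mulrDl -[RHS]mul1r; congr (_ * _).
rewrite -mulrDl -[RHS](mulfV N0); congr (_ / _).
have -> : \sum_(l | (l \notin S) && (mu l <= g)%MM) (val l g)%:R = \sum_(l | l \notin S) (val l g)%:R :> K.
  rewrite big_mkcondr; apply: eq_bigr => l _; rewrite mu_leE.
  by case: eqVneq => [->|].
rewrite /N natrD /vsum addrC (bigID (mem S) xpredT) natrD !natr_sum addrA; congr (_ + _).
by rewrite -sum1_card natr_sum -big_split; apply: eq_bigr => k _; rewrite /= -natrD add1n.
Qed.

(** eps_l receives the weight of mu l, so that the homotopy respects the bound and [deltal] lowers
    it. The inequality is strict, hence the bound 0 forces Q = 0 and starts the induction. *)
Definition wbound (N : nat) Q := forall S b, (Q S)@_b != 0 ->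
  (mweight b + \sum_(l in S) mweight (mu l) < N)%N.

Lemma sum_neq0 (I : finType) (C : pred I) (F : I -> K) :
  \sum_(i | C i) F i != 0 -> exists2 i, C i & F i != 0.
Proof.
move=> h; have [/existsP[i /andP[Ci Fi]]|] := boolP [exists i, C i && (F i != 0)].
  by exists i.
rewrite negb_exists => /forallP a; case/negP: h; rewrite big1 // => i Ci.
by have := a i; rewrite Ci /= negbK => /eqP.
Qed.

Lemma wbound_htpy N Q : wbound N Q -> wbound N (htpy Q).
Proof.
move=> hQ S b; rewrite htpyE => /sum_neq0[k kS]; rewrite !mulf_eq0 !negb_or => /and3P[_ _ /hQ].
rewrite mweightD (big_setD1 k kS) /=; apply: leq_ltn_trans.
by rewrite addnA.
Qed.

Lemma wbound_deltal N Q : wbound N.+1 Q -> wbound N (deltal Q).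
Proof.
move=> hQ S b; rewrite sum_ffunE raddf_sum => /sum_neq0[l _] /=.
rewrite !ffunE /= /xmul; case: ifPn => lS; first by rewrite mulr0 mcoeff0 eqxx.
rewrite -scalerAr mcoeffZ mulf_eq0 negb_or => /andP[_].
rewrite -mcoeff_msupp => /msuppM_le /allpairsP[[b1 b2] /= [h1 h2 ->]].
have := lower h1; move: h2; rewrite mcoeff_msupp => /hQ.
rewrite big_setU1 //= mweightD; move: (mweight _) (mweight _) (mweight _) (\sum_(_ in _) _)%N.
by move=> x y z t; lia.
Qed.

(** Contractions anticommute while multiplications commute, so the square equals its own
    opposite. *)
Lemma koszul_diff_sq Q : delta (delta Q) = 0.
Proof.
pose F l k : E := coefwise (xmul (r l)) (contr l (coefwise (xmul (r k)) (contr k Q))).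
have e : delta (delta Q) = \sum_l \sum_k F l k.
  apply: eq_bigr => l _; rewrite /F [X in contr l X]/koszul_diff.
  by rewrite (linear_sum (contr l)) (linear_sum (coefwise (xmul (r l)))).
have : delta (delta Q) = - delta (delta Q).
  rewrite {1}e exchange_big e -sumrN; apply: eq_bigr => l _.
  rewrite -sumrN; apply: eq_bigr => k _; rewrite /F -!coefwise_contr contrC.
  by apply/ffunP=> S; rewrite !ffunE /= /xmul !mulrN mulrCA.
move/eqP; rewrite -subr_eq0 opprK -mulr2n -scaler_nat scaler_eq0 pnatr_eq0.
by move/eqP.
Qed.

Lemma koszul_diff_set0 Q : (forall S, S != set0 -> Q S = 0) -> delta Q = 0.
Proof.
move=> Q0; rewrite /koszul_diff big1 // => l _; apply/ffunP=> S; rewrite !ffunE /= /xmul.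
case: ifP => _; first by rewrite mulr0.
by rewrite Q0 ?scaler0 ?mulr0 //; apply/set0Pn; exists l; rewrite !inE eqxx.
Qed.

(* Subtracting delta (htpy z) from z leaves a cycle of lower weight. *)
Theorem koszul_exact z : delta z = 0 ->
  exists y, forall S, S != set0 -> (z - delta y) S = 0.
Proof.
have [N] : exists N, wbound N z.
  exists (\sum_S \sum_(b <- msupp (z S)) (mweight b + \sum_(l in S) mweight (mu l)).+1)%N.
  move=> S b; rewrite -mcoeff_msupp => bS.
  by rewrite (bigD1 S) //= (big_rem b bS) /= -addnA leq_addr.
elim: N z => [|N IH] z hz dz.
  exists 0 => S _; rewrite linear0 subr0; apply/mpolyP=> b; rewrite mcoeff0; apply/eqP.
  by apply: contraT => /hz.
(* Off [set0], [htpy_identity] and delta0 z = - deltal z give z - delta (htpy z) = z'. Each term of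
   z' contains one [deltal], so its weight bound drops. *)
pose z' : E := - (htpy (deltal z) + deltal (htpy z)).
have d0 : delta0 z = - deltal z by apply/eqP; rewrite -addr_eq0 -delta_split dz.
pose w := z - delta (htpy z) - z'.
have w0 S : S != set0 -> w S = 0.
  move=> S0; apply/mpolyP=> g; rewrite mcoeff0 /w /z' delta_split.
  have := htpy_identity z g S0; rewrite d0.
  have -> : (htpy (- deltal z) S)@_g = - (htpy (deltal z) S)@_g.
    rewrite !htpyE -[RHS]sumrN; apply: eq_bigr => k _.
    by rewrite ffunE mcoeffN !mulrN.
  by rewrite !ffunE !(mcoeffD, mcoeffN) => <-; ring.
(* The discrepancy w lies in exterior degree 0, where [delta] vanishes; hence z' is again a cycle
   and the induction applies to it. *)
have dw : delta w = 0 by exact: koszul_diff_set0.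
have zw : z' = z - delta (htpy z) - w by rewrite /w opprB addrC subrK.
have [||y hy] := IH z'.
- have h1 := wbound_htpy (wbound_deltal hz).
  have h2 := wbound_deltal (wbound_htpy hz).
  move=> S b; have -> : z' S = - (htpy (deltal z) S + deltal (htpy z) S).
    by rewrite ffunE; congr (- _); rewrite ffunE.
  rewrite mcoeffN mcoeffD oppr_eq0 => h.
  have [e|/h1 //] := eqVneq ((htpy (deltal z) S)@_b) 0.
  by apply: h2; move: h; rewrite e add0r.
- by rewrite zw (linearB delta _ w) (linearB delta z) /= dw dz koszul_diff_sq !subr0.
exists (htpy z + y) => S S0.
have -> : z - delta (htpy z + y) = (z' - delta y) + w.
  by rewrite zw (linearD delta) opprD addrA [RHS]addrAC subrK.
by rewrite ffunE hy // w0 // addr0.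
Qed.

End Exactness.

(** * Products of cochains *)

Section Shuffles.
Variables (R : comNzRingType) (p q : nat).
Local Notation n := (p + q)%N.
Local Notation A0 := [set lshift q i | i : 'I_p].
Implicit Types (A : {set 'I_n}) (s : 'S_n).

Lemma card_lshift : #|A0| = p.
Proof. by rewrite card_imset ?card_ord //; exact: lshift_inj. Qed.

Lemma perm_onto_set A : #|A| = p -> exists t : 'S_n, t @: A0 = A.
Proof.
move=> cA; pose e := enum A ++ enum (~: A).
have se : size e = n.
  by rewrite size_cat -!cardE cardsC card_ord.
have ue : uniq e.
  rewrite cat_uniq !enum_uniq /= andbT; apply/hasPn => i.
  by rewrite !mem_enum inE.
pose f (i : 'I_n) := nth i e i.
have f_inj : injective f.
  move=> i j; rewrite /f (set_nth_default j) ?se // => /eqP.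
  by rewrite nth_uniq ?se // => /eqP/val_inj.
exists (perm f_inj); apply/eqP; rewrite eqEcard card_imset; last exact: perm_inj.
rewrite card_lshift cA leqnn andbT; apply/subsetP=> _ /imsetP[_ /imsetP[i _ ->] ->].
rewrite permE /f nth_cat /= -cardE cA ltn_ord -mem_enum mem_nth //.
by rewrite -cardE cA.
Qed.

(** Composition with a permutation carrying one p-subset to another shows that all these sets have
    the same size; there is one for each of the binomial(n, p) subsets, and together they exhaust
    the n! permutations. *)
Lemma card_perm_imset A : #|A| = p ->
  #|[set s : 'S_n | s @: A0 == A]| = (p`! * q`!)%N.
Proof.
pose c0 := #|[set s : 'S_n | s @: A0 == A0]|.
have cE (B : {set 'I_n}) : #|B| = p -> #|[set s : 'S_n | s @: A0 == B]| = c0.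
  move=> /perm_onto_set[t <-]; rewrite /c0 -!sum1_card.
  rewrite (reindex_inj (mulIg t)); apply: eq_bigl => s; rewrite !inE.
  have -> : (s * t)%g @: A0 = t @: (s @: A0).
    by rewrite -[RHS]imset_comp; apply: eq_imset => i; rewrite permM.
  by apply: (inj_eq (imset_inj _)); exact: perm_inj.
move=> cA; rewrite cE //.
have : \sum_(B : {set 'I_n} | #|B| == p) #|[set s : 'S_n | s @: A0 == B]| = n`!.
  rewrite -(card_Sn n) -sum1_card (partition_big (fun s : 'S_n => s @: A0) (fun B => #|B| == p)).
    by apply: eq_bigr => B _; rewrite -sum1_card; apply: eq_bigl => s; rewrite inE.
  by move=> s _; rewrite card_imset ?card_lshift //; exact: perm_inj.
rewrite (eq_bigr (fun=> c0)) => [|B /eqP]; last exact: cE.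
rewrite sum_nat_const -cardsE card_draws card_ord -(bin_fact (leq_addr q p)) addKn.
by move/eqP; rewrite eqn_pmul2l ?bin_gt0 ?leq_addr // => /eqP.
Qed.

Lemma sum_perm_imset (F : {set 'I_n} -> R) :
  (forall A, #|A| != p -> F A = 0) ->
  \sum_(s : 'S_n) F (s @: A0) = (p`! * q`!)%:R * \sum_A F A.
Proof.
move=> F0; rewrite (partition_big (fun s : 'S_n => s @: A0) xpredT) //= mulr_sumr.
apply: eq_bigr => A _; have [cA|/F0 e] := eqVneq #|A| p.
  rewrite (eq_bigr (fun=> F A)) => [|s /eqP -> //].
  by rewrite sumr_const -(card_perm_imset cA) mulr_natl cardsE.
by rewrite e mulr0 big1 // => s /eqP ->.
Qed.

End Shuffles.

(** * The iterated Leibniz rule *)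

Section Leibniz.
Variables (R : comNzRingType) (I : finType) (D : I -> R -> R).
Hypothesis DD : forall i, {morph D i : x y / x + y}.
Hypothesis DM : forall i x y, D i (x * y) = D i x * y + x * D i y.

(** Each derivation in e hits x or y, and A records those that hit x. *)
Lemma leibniz_set (e : seq I) x y : uniq e ->
  foldr D (x * y) e = \sum_(A : {set I} | A \subset [set i in e])
    foldr D x [seq i <- e | i \in A] * foldr D y [seq i <- e | i \notin A].
Proof.
elim: e => [|a e IH] /=.
  have -> : [set i in [::]] = set0 :> {set I} by apply/setP=> i; rewrite !inE.
  by rewrite (big_pred1 set0) // => A /=; rewrite subset0.
case/andP => ae ue; rewrite IH //.
have DS (r : seq {set I}) C (F : {set I} -> R) :
    D a (\sum_(A <- r | C A) F A) = \sum_(A <- r | C A) D a (F A).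
  have D0 : D a 0 = 0 by apply: (addIr (D a 0)); rewrite -DD !add0r.
  by elim/big_rec2: _ => // A u v _ <-; rewrite DD.
rewrite DS (bigID (fun A : {set I} => a \in A)) /= addrC.
have aE (A : {set I}) : A \subset [set i in e] -> a \notin A.
  by move=> /subsetP h; apply/negP => /h; rewrite inE (negPf ae).
have fE (A : {set I}) : [seq i <- e | i \in a |: A] = [seq i <- e | i \in A].
  by apply: eq_in_filter => i ie; rewrite !inE; case: eqVneq => // ia; rewrite -ia ie in ae.
have fE' (A : {set I}) : [seq i <- e | i \notin a |: A] = [seq i <- e | i \notin A].
  by apply: eq_in_filter => i ie; rewrite !inE; case: eqVneq => // ia; rewrite -ia ie in ae.
rewrite [in RHS](bigID (fun A : {set I} => a \in A)) /=.
rewrite [\sum_(_ | _ && (a \in _)) D a _]big1 ?addr0; last first.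
  by move=> A /andP[/aE /negPf ->].
rewrite [in RHS](reindex_onto (fun A => a |: A) (fun A => A :\ a)) /=; last first.
  by move=> A /andP[_ aA]; rewrite setD1K.
have cE (A : {set I}) : ((a |: A \subset [set i in a :: e]) && (a \in a |: A)) && ((a |: A) :\ a == A) =
    (A \subset [set i in e]).
  apply/andP/idP => [[/andP[h _] /eqP eA]|h].
    have aA : a \notin A by rewrite -eA !inE eqxx.
    apply/subsetP => i iA; move/subsetP/(_ i): h; rewrite !inE iA orbT => /(_ isT).
    by case/orP => // /eqP ia; rewrite -ia iA in aA.
  rewrite !inE eqxx setU1K ?eqxx ?aE // andbT; split => //.
  by apply/subsetP=> i; rewrite !inE => /orP[->//|/(subsetP h)]; rewrite inE => ->; rewrite orbT.
have cE' (A : {set I}) : (A \subset [set i in a :: e]) && (a \notin A) = (A \subset [set i in e]) && (a \notin A).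
  apply/andP/andP => -[h aA]; split=> //; apply/subsetP=> i iA; move/subsetP/(_ i iA): h;
    rewrite !inE.
    by case/orP => // /eqP ia; rewrite -ia iA in aA.
  by move=> ->; rewrite orbT.
rewrite (eq_bigl _ _ cE) (eq_bigl _ _ cE').
have e1 (F : {set I} -> R) : \sum_(A : {set I} | (A \subset [set i in e]) && (a \notin A)) F A =
    \sum_(A : {set I} | A \subset [set i in e]) F A.
  by apply: eq_bigl => A; rewrite andb_idr // => /aE.
rewrite !e1.
rewrite -big_split /=; apply: eq_bigr => A /aE aA.
by rewrite setU11 (negPf aA) /= DM fE fE'.
Qed.
End Leibniz.

Section PsiProduct.
Variables (K : numFieldType) (m d : nat) (r : 'I_d -> {mpoly K[m]}).
Local Notation P := {mpoly K[m]}.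
Local Notation E := (ext K m d).
Local Notation L := (qlie r).
Local Notation Psi := (ext_cochain r).

Definition ext_poly (f : P) : E := [ffun S : {set 'I_d} => if S == set0 then f else 0].

Fact ext_poly_linear : linear ext_poly.
Proof.
move=> c f g; apply/ffunP=> S; rewrite !ffunE; case: ifP => // _.
by rewrite scaler0 addr0.
Qed.
HB.instance Definition _ := GRing.isLinear.Build K P E _ ext_poly ext_poly_linear.

(* On the cochains of exterior degree 0, the contraction by x is the directional
   derivative along the component of x in L_1. *)
Definition dirder (x : L) (f : P) : P := \sum_i x.1 0 i *: f^`M(i).

Lemma iota_ext_poly (x : L) f : iota_ x (ext_poly f) = ext_poly (dirder x f).
Proof.
rewrite /iota_ big_sumType /= [X in _ + X]big1 ?addr0 => [|l _]; last first.
  rewrite (_ : contr _ _ = 0) ?scaler0 //; apply/ffunP=> S; rewrite !ffunE.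
  case: ifP => // _; rewrite ifF ?scaler0 //; apply/negbTE/set0Pn; exists l.
  by rewrite !inE eqxx.
rewrite /dirder linear_sum; apply: eq_bigr => i _; rewrite linearZ /=; congr (_ *: _).
apply/ffunP=> S; rewrite !ffunE; case: ifP => [/eqP ->|_].
  by rewrite cards0 scale1r.
by rewrite /= mderiv0 scaler0.
Qed.

Lemma PsiE p (f : P) x : Psi p (ext_poly f) x = (foldr dirder f [seq x i | i <- enum 'I_p])@_0.
Proof.
rewrite /ext_cochain; set s := map _ _.
have -> : iotas s (ext_poly f) = ext_poly (foldr dirder f s).
  by elim: s => //= y s ->; rewrite iota_ext_poly.
by rewrite /ev0 ffunE eqxx.
Qed.

Lemma dirder_linear (x : L) : linear (dirder x).
Proof.
move=> c f g; rewrite /dirder scaler_sumr -big_split; apply: eq_bigr => i _ /=.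
by rewrite linearP scalerDr !scalerA mulrC.
Qed.
HB.instance Definition _ x := GRing.isLinear.Build K P P _ (dirder x) (dirder_linear x).

Lemma dirderM x f g : dirder x (f * g) = dirder x f * g + f * dirder x g.
Proof.
rewrite /dirder mulr_suml mulr_sumr -big_split; apply: eq_bigr => i _ /=.
by rewrite mderivM scalerDr scalerAl scalerAr.
Qed.

Lemma dirderC x y f : dirder x (dirder y f) = dirder y (dirder x f).
Proof.
rewrite /dirder; under eq_bigr => i _ do rewrite (linear_sum (mderiv i)) scaler_sumr.
rewrite exchange_big; apply: eq_bigr => j _ /=.
rewrite [in RHS](linear_sum (mderiv j)) [RHS]scaler_sumr; apply: eq_bigr => i _ /=.
by rewrite !mderivZ mderiv_comm !scalerA mulrC.
Qed.

Lemma dirder_coef p (f : P) (s : seq L) b : f \is p.-homog ->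
  (mdeg b + size s)%N != p -> (foldr dirder f s)@_b = 0.
Proof.
move=> hf; elim: s b => [|x s IH] b /= hb.
  by rewrite (dhomog_nemf_coeff hf) //; rewrite addn0 in hb.
rewrite /dirder raddf_sum big1 // => i _ /=; rewrite mcoeffZ mcoeff_deriv IH ?mul0rn ?mulr0 //.
by rewrite mdegD mdeg1 addn1 addSnnS.
Qed.

Lemma foldr_dirder_perm n (x : {ffun 'I_n -> L}) f (e : seq 'I_n) (A : {set 'I_n}) :
  perm_eq e (enum A) ->
  foldr dirder f [seq x i | i <- e] = foldr dirder f [seq x i | i <- enum A].
Proof.
move=> eA; rewrite !foldr_map.
pose op i := dirder (x i).
have opZ a t g : op a (t *: g) = t *: op a g by rewrite /op linearZ.
have opC a b g : op a (op b g) = 1 *: op b (op a g) by rewrite scale1r /op dirderC.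
rewrite (foldr_sort (c := fun _ _ => 1) opZ opC f eA); last first.
  rewrite /enum_mem; apply: sorted_filter; first by move=> ? ? ?; exact: ltn_trans.
  have := iota_ltn_sorted 0 n; rewrite -val_enum_ord sorted_map enumT.
  exact: sub_sorted.
have -> s : inv_sign (fun _ _ => 1) s = 1 :> K; last by rewrite scale1r.
by elim: s => //= a s ->; rewrite mulr1 big1.
Qed.

Lemma foldr_dirder0 (s : seq L) (x : L) f : x \in s -> x.1 = 0 -> foldr dirder f s = 0.
Proof.
move=> xs x0; case/splitPr: s / xs => s1 s2; rewrite foldr_cat /=.
have -> g : dirder x g = 0.
  by rewrite /dirder big1 // => i _; rewrite x0 mxE scale0r.
by elim: s1 => //= y s ->; rewrite linear0.
Qed.

(** An argument of degree other than 1 kills every summand, and if all degrees are 1 every sign is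
    1, so the signs disappear. The permutations are then grouped by the image A of the first p
    positions, and the iterated Leibniz rule evaluates the sum over A. *)
Lemma Psi_mul p q f g : f \is p.-homog -> g \is q.-homog ->
  is_product (Psi p (ext_poly f)) (Psi q (ext_poly g)) (Psi (p + q) (ext_poly (f * g))).
Proof.
move=> hf hg; split; first exact: Psi_cochain.
move=> k x hx.
transitivity (\sum_(s : 'S_(p + q))
  Psi p (ext_poly f) [ffun i => x (s (lshift q i))] *
  Psi q (ext_poly g) [ffun i => x (s (rshift p i))]); last first.
  have [/forallP k1|] := boolP [forall i, k i == 1%N].
    apply: eq_bigr => s _; rewrite [super_sign _ _ _]big1 ?mul1r // => i _.
    by rewrite big1 // => j _; rewrite !(eqP (k1 _)) expr1 opprK.
  rewrite negb_forall => /existsP[i0 k0].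
  have x0 : (x i0).1 = 0 := qgr_neq1 (hx i0) k0.
  apply: eq_bigr => s _; suff -> : Psi p (ext_poly f) [ffun i => x (s (lshift q i))] *
    Psi q (ext_poly g) [ffun i => x (s (rshift p i))] = 0 by rewrite mulr0.
  rewrite !PsiE -(permKV s i0) in x0 *; case: (splitP (s^-1%g i0)) => [j|j] ej.
    have e : s^-1%g i0 = lshift q j by exact: val_inj.
    rewrite (foldr_dirder0 (x := x i0)) ?mcoeff0 ?mul0r //; last by rewrite -x0 permKV.
    by apply/mapP; exists j; rewrite ?mem_enum // ffunE -e permKV.
  have e : s^-1%g i0 = rshift p j by exact: val_inj.
  rewrite [X in _ * X@__](foldr_dirder0 (x := x i0)) ?mcoeff0 ?mulr0 //; last by rewrite -x0 permKV.
  by apply/mapP; exists j; rewrite ?mem_enum // ffunE -e permKV.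
pose F (A : {set 'I_(p + q)}) : K := (foldr dirder f [seq x i | i <- enum A])@_0 *
   (foldr dirder g [seq x i | i <- enum (~: A)])@_0.
transitivity (\sum_(s : 'S_(p + q)) F (s @: [set lshift q i | i : 'I_p])); last first.
  apply: eq_bigr => s _; rewrite !PsiE /F; congr (_ * _); congr (mcoeff _ _).
    rewrite -(@foldr_dirder_perm _ x f [seq s (lshift q i) | i <- enum 'I_p]).
      by rewrite -[in LHS]map_comp; congr foldr; apply: eq_map => i; rewrite /= ffunE.
    apply: uniq_perm; rewrite ?enum_uniq //.
      by rewrite map_inj_uniq ?enum_uniq //; apply: inj_comp; [exact: perm_inj | exact: lshift_inj].
    move=> i; rewrite mem_enum; apply/mapP/imsetP => [[j _ ->]|[_ /imsetP[j _ ->] ->]].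
      by exists (lshift q j) => //; exact: imset_f.
    by exists j; rewrite ?mem_enum.
  rewrite -(@foldr_dirder_perm _ x g [seq s (rshift p i) | i <- enum 'I_q]).
    by rewrite -[in LHS]map_comp; congr foldr; apply: eq_map => i; rewrite /= ffunE.
  apply: uniq_perm; rewrite ?enum_uniq //.
    by rewrite map_inj_uniq ?enum_uniq //; apply: inj_comp; [exact: perm_inj | exact: rshift_inj].
  move=> i; rewrite mem_enum inE; apply/mapP/idP => [[j _ ->]|h].
    by apply/negP => /imsetP[_ /imsetP[a _ ->]] /perm_inj /eqP; rewrite eq_rlshift.
  case: (splitP (s^-1%g i)) => [j|j] ej.
    case/negP: h; apply/imsetP; exists (lshift q j); first exact: imset_f.
    by rewrite -(permKV s i); congr (s _); exact: val_inj.
  exists j; rewrite ?mem_enum //.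
  by rewrite -(permKV s i); congr (s _); exact: val_inj.
(* A subset of the wrong size applies the wrong number of derivatives to f, and then the constant
   term is 0 by homogeneity. *)
rewrite sum_perm_imset; last first.
  move=> A cA; rewrite /F (dirder_coef hf) ?mul0r // mdeg0 add0n size_map -cardE //.
congr (_ * _); rewrite PsiE foldr_map.
rewrite (leibniz_set (D := fun i => dirder (x i))) ?enum_uniq //; first last.
- by move=> i a b; exact: dirderM.
- by move=> i a b; rewrite linearD.
rewrite raddf_sum /= big_mkcond; apply: eq_bigr => A _.
rewrite ifT; last by apply/subsetP => i _; rewrite inE mem_enum.
rewrite rmorphM /= /F !foldr_map; congr (_ * _); congr (mcoeff _ (foldr _ _ _)).
  by rewrite enumT; apply: eq_filter.
by rewrite enumT; apply: eq_filter => i; rewrite /= inE.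
Qed.
End PsiProduct.

(** * Algebras with quadratic relations *)

Section ScaleCommutation.
Variables (K : fieldType) (A : lalgType K) (c : K).
Implicit Types p q x : A.

(** This and the next lemma are the inductive steps of [tensor_scaleAr]; in the next one, z stands
    for the scalar c inside the algebra and g for a generator. *)
Lemma scale_mulr_lin (a : K) p p' q :
  c *: (p * q) = p * (c *: q) -> c *: (p' * q) = p' * (c *: q) ->
  c *: ((a *: p + p') * q) = (a *: p + p') * (c *: q).
Proof. by move=> h h'; rewrite !mulrDl scalerDr h' -!scalerAl -h !scalerA mulrC. Qed.

Lemma scale_mulr_comm (z : A) g p q :
  (forall x, z * x = c *: x) -> z * g = g * z -> c *: (p * q) = p * (c *: q) ->
  c *: (g * p * q) = g * p * (c *: q).
Proof. by move=> zE zg h; rewrite -!mulrA -h -!zE mulrA zg -mulrA. Qed.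

End ScaleCommutation.

Local Notation repr := generic_quotient.repr.

(** * The quotient of a noncommutative algebra by a two-sided ideal *)

Section TwoSidedQuotient.
Variables (K : fieldType) (T : algType K) (gens : T -> Prop).
Implicit Types p q : T.

Definition rel_ideal : {pred T} := fun p => `[< two_sided_ideal gens p >].

Lemma rel_idealP p : reflect (two_sided_ideal gens p) (p \in rel_ideal).
Proof. exact: asboolP. Qed.

Lemma two_sided_ideal0 : two_sided_ideal gens 0.
Proof.
exists 0%N, (fun=> 0), (fun=> 0), (fun=> 0); split; first by case.
by rewrite big_ord0.
Qed.

Lemma two_sided_idealD p q :
  two_sided_ideal gens p -> two_sided_ideal gens q -> two_sided_ideal gens (p + q).
Proof.
move=> [d [a [s [b [hs ->]]]]] [d' [a' [s' [b' [hs' ->]]]]].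
pose cat (f : 'I_d -> T) (g : 'I_d' -> T) (i : 'I_(d + d')) :=
  match split i with inl j => f j | inr j => g j end.
exists (d + d')%N, (cat a a'), (cat s s'), (cat b b'); split.
  by move=> i; rewrite /cat; case: split.
rewrite big_split_ord /=; congr (_ + _); apply: eq_bigr => i _; rewrite /cat.
  by case: splitP => j /= e; [rewrite (val_inj e : i = j) | have := ltn_ord i; rewrite e; lia].
case: splitP => j /= e; first by have := ltn_ord j; rewrite -e; lia.
by have -> : i = j by apply: val_inj; apply: (addnI e).
Qed.

Lemma two_sided_idealM x p y : two_sided_ideal gens p -> two_sided_ideal gens (x * p * y).
Proof.
move=> [d [a [s [b [hs ->]]]]].
exists d, (fun i => x * a i), s, (fun i => b i * y); split => //.
by rewrite mulr_sumr mulr_suml; apply: eq_bigr => i _; rewrite !mulrA.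
Qed.

Fact rel_ideal_zmod : zmod_closed rel_ideal.
Proof.
split; first exact/rel_idealP/two_sided_ideal0.
move=> p q /rel_idealP hp /rel_idealP hq; apply/rel_idealP.
apply: two_sided_idealD hp _.
by have := two_sided_idealM (-1) 1 hq; rewrite mulN1r mulr1.
Qed.
HB.instance Definition _ := GRing.isZmodClosed.Build T rel_ideal rel_ideal_zmod.

Lemma rel_idealMl x p : p \in rel_ideal -> x * p \in rel_ideal.
Proof. by move=> /rel_idealP/(two_sided_idealM x 1); rewrite mulr1 => /rel_idealP. Qed.

Lemma rel_idealMr x p : p \in rel_ideal -> p * x \in rel_ideal.
Proof. by move=> /rel_idealP/(two_sided_idealM 1 x); rewrite mul1r => /rel_idealP. Qed.

Hypothesis gens1 : ~ two_sided_ideal gens 1.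

(* Properness of the ideal is an argument of the type, so that the quotient has a
   canonical structure of nontrivial ring. *)
Definition tquot_of & ~ two_sided_ideal gens 1 := Quotient.quot rel_ideal.
Local Notation tquot := (tquot_of gens1).
HB.instance Definition _ := GRing.Zmodule.on tquot.
HB.instance Definition _ := ZmodQuotient.on tquot.

Local Notation pi := (\pi_tquot%qT : T -> tquot).

Lemma piP p q : reflect (pi p = pi q) (p - q \in rel_ideal).
Proof. by rewrite Quotient.idealrBE; apply: (iffP eqP). Qed.

Lemma pi0P p : reflect (pi p = 0) (p \in rel_ideal).
Proof. rewrite -{2}(subr0 p); apply: (iffP (piP p 0)) => ->; first exact: raddf0.
exact/esym/(raddf0 pi).
Qed.

Definition tq_mul (x y : tquot) : tquot := pi (repr x * repr y).

Lemma repr_pi p : repr (pi p) - p \in rel_ideal.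
Proof. by apply/piP; rewrite reprK. Qed.

Lemma pi_tq_mul p q : pi (p * q) = tq_mul (pi p) (pi q).
Proof.
apply/esym/piP.
have -> : repr (pi p) * repr (pi q) - p * q =
    (repr (pi p) - p) * repr (pi q) + p * (repr (pi q) - q).
  by rewrite mulrBl mulrBr addrA subrK.
by apply: rpredD; [apply: rel_idealMr | apply: rel_idealMl]; exact: repr_pi.
Qed.

Lemma tq_surj (x : tquot) : exists p, x = pi p.
Proof. by exists (repr x); exact/esym/reprK. Qed.

Definition tq_one : tquot := pi 1.

Fact tq_mulA : associative tq_mul.
Proof.
move=> x y z; have [[[p ->] [q ->]] [s ->]] := (tq_surj x, tq_surj y, tq_surj z).
by rewrite -!pi_tq_mul mulrA.
Qed.
Fact tq_mul1 : left_id tq_one tq_mul.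
Proof. by move=> x; have [p ->] := tq_surj x; rewrite -pi_tq_mul mul1r. Qed.
Fact tq_1mul : right_id tq_one tq_mul.
Proof. by move=> x; have [p ->] := tq_surj x; rewrite -pi_tq_mul mulr1. Qed.
Fact tq_mulDl : left_distributive tq_mul +%R.
Proof.
move=> x y z; have [[[p ->] [q ->]] [s ->]] := (tq_surj x, tq_surj y, tq_surj z).
by rewrite -(raddfD pi) -!pi_tq_mul mulrDl (raddfD pi).
Qed.
Fact tq_mulDr : right_distributive tq_mul +%R.
Proof.
move=> x y z; have [[[p ->] [q ->]] [s ->]] := (tq_surj x, tq_surj y, tq_surj z).
by rewrite -(raddfD pi) -!pi_tq_mul mulrDr (raddfD pi).
Qed.
Fact tq_1neq0 : tq_one != 0.
Proof. by apply/eqP => /pi0P /rel_idealP. Qed.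

HB.instance Definition _ := GRing.Zmodule_isNzRing.Build tquot
  tq_mulA tq_mul1 tq_1mul tq_mulDl tq_mulDr tq_1neq0.

Definition tq_scale (c : K) (x : tquot) : tquot := pi (c *: repr x).

Lemma pi_scale c p : pi (c *: p) = tq_scale c (pi p).
Proof.
apply/esym/piP; rewrite -scalerBr -[X in c *: X]mul1r scalerAl.
by apply: rel_idealMl; exact: repr_pi.
Qed.

Fact tq_scaleA a b x : tq_scale a (tq_scale b x) = tq_scale (a * b) x.
Proof. by have [p ->] := tq_surj x; rewrite -!pi_scale scalerA. Qed.
Fact tq_scale1 : left_id 1 tq_scale.
Proof. by move=> x; have [p ->] := tq_surj x; rewrite -pi_scale scale1r. Qed.
Fact tq_scaleDr : right_distributive tq_scale +%R.
Proof.
move=> a x y; have [[p ->] [q ->]] := (tq_surj x, tq_surj y).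
by rewrite -(raddfD pi) -!pi_scale scalerDr (raddfD pi).
Qed.
Fact tq_scaleDl x : {morph tq_scale^~ x : a b / a + b}.
Proof.
by move=> a b; have [p ->] := tq_surj x; rewrite -!pi_scale scalerDl (raddfD pi).
Qed.

HB.instance Definition _ := GRing.Zmodule_isLmodule.Build K tquot
  tq_scaleA tq_scale1 tq_scaleDr tq_scaleDl.

Lemma tq_mulE p q : pi p * pi q = pi (p * q). Proof. exact/esym/pi_tq_mul. Qed.
Lemma tq_scaleE c p : c *: pi p = pi (c *: p). Proof. exact/esym/pi_scale. Qed.

Fact tq_scaleAl (a : K) (x y : tquot) : a *: (x * y) = (a *: x) * y.
Proof.
have [[p ->] [q ->]] := (tq_surj x, tq_surj y).
by rewrite tq_mulE !tq_scaleE tq_mulE scalerAl.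
Qed.
HB.instance Definition _ := GRing.Lmodule_isLalgebra.Build K tquot tq_scaleAl.

Fact tq_scaleAr (a : K) (x y : tquot) : a *: (x * y) = x * (a *: y).
Proof.
have [[p ->] [q ->]] := (tq_surj x, tq_surj y).
by rewrite tq_mulE !tq_scaleE tq_mulE scalerAr.
Qed.
HB.instance Definition _ := GRing.Lalgebra_isAlgebra.Build K tquot tq_scaleAr.

Definition tq_pi (p : T) : tquot := pi p.

Lemma tq_pi1 : tq_pi 1 = 1. Proof. by []. Qed.

Lemma tq_piP c p q : tq_pi (c *: p + q) = c *: tq_pi p + tq_pi q.
Proof. by rewrite /tq_pi (raddfD pi) tq_scaleE. Qed.

Lemma tq_piM p q : tq_pi (p * q) = tq_pi p * tq_pi q.
Proof. exact: pi_tq_mul. Qed.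

Lemma tq_pi_surj (x : tquot) : exists p, tq_pi p = x.
Proof. by have [p ->] := tq_surj x; exists p. Qed.

Lemma tq_pi_eq0 p : tq_pi p = 0 <-> two_sided_ideal gens p.
Proof. by split=> [/pi0P/rel_idealP|h] //; apply/pi0P/rel_idealP. Qed.

End TwoSidedQuotient.

(** * Tensor algebras and algebras with quadratic presentations *)

Module TensorQuotient.
Import monalg.

Section TensorTheory.
Variables (K : fieldType) (m : nat).
Definition tensor_lalg : lalgType K := tensor_alg K m.
Local Notation T := tensor_lalg.

Definition tgen (i : 'I_m) : T := << fmu i >>.

Lemma tensor_word_cons (i : 'I_m) (s : seq 'I_m) :
  (<< FMonom (i :: s) >> : T) = tgen i * << FMonom s >>.
Proof.
rewrite /tgen malgM_def fgmulUU mulr1; congr (<< _ >>).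
by rewrite [RHS]fmmulE fmuE.
Qed.

Lemma tensor_word_nil : (<< FMonom [::] >> : T) = 1.
Proof. by rewrite -fmoneE. Qed.

Lemma tensor_ind (S : T -> Prop) : S 1 ->
  (forall (c : K) p q, S p -> S q -> S (c *: p + q)) ->
  (forall i p, S p -> S (tgen i * p)) -> forall p, S p.
Proof.
move=> S1 SL Sg p.
have S0 : S 0 by have := SL (-1) _ _ S1 S1; rewrite scaleN1r addNr.
have Sw (k : {fmonom 'I_m}) : S << k >>.
  case: k => s; elim: s => [|i s IH]; first by rewrite tensor_word_nil.
  by rewrite tensor_word_cons; exact: Sg.
rewrite [p]monalgE; elim/big_rec: _ => // k q _ Sq.
have -> : << mcoeff k p *g k >> = mcoeff k p *: (<< k >> : T).
  by rewrite -[RHS]mul_malgC malgM_def fgmulUU mulr1 mul1m.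
exact: SL.
Qed.

Lemma tensor_scaleAr (c : K) (p q : T) : c *: (p * q) = p * (c *: q).
Proof.
elim/tensor_ind: p => [|a p p' h h'|i p h].
- by rewrite (mul1r q) (mul1r (c *: q)).
- exact: scale_mulr_lin.
- apply: (@scale_mulr_comm K T c c%:MP) h => [x|]; first exact: mul_malgC.
  by rewrite /tgen malgM_def fgmulUU [in RHS]malgM_def fgmulUU mulr1 mul1r mul1m mulm1.
Qed.

Definition tensor_algT : Type := tensor_lalg.
HB.instance Definition _ := GRing.Lalgebra.on tensor_algT.
HB.instance Definition _ := GRing.Lalgebra_isAlgebra.Build K tensor_algT tensor_scaleAr.

Section Eval.
Variables (B : algType K) (v : 'I_m -> B).
Local Notation te := (tensor_eval v).

Fact word_eval_mmorphism : mmorphism (word_eval v).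
Proof.
split=> [x y|]; rewrite /word_eval.
  have -> : fmonom_val (mmul x y) = fmonom_val x ++ fmonom_val y by rewrite [mmul _ _]fmmulE.
  by rewrite big_cat.
have -> : fmonom_val (mone : {fmonom 'I_m}) = [::] by rewrite [mone]fmoneE.
by rewrite big_nil.
Qed.
HB.instance Definition _ := isMultiplicative.Build {fmonom 'I_m} B (word_eval v)
  word_eval_mmorphism.

Lemma tensor_eval_linear (c : K) (p q : T) : te (c *: p + q) = c *: te p + te q.
Proof.
by rewrite /tensor_eval mmapD mmapZ /= mulr_algl.
Qed.

Lemma tensor_eval_monoid : (te (1 : T) = 1) * (forall p q : T, te (p * q) = te p * te q).
Proof.
have [h1 h2] : multiplicative te; last by split.
apply: commr_mmap_is_multiplicative => g k k'.
by rewrite /GRing.comm /= mulr_algl mulr_algr.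
Qed.

Lemma tensor_eval_gen i : te (tgen i) = v i.
Proof. by rewrite /te /tgen mmapU /= scale1r mul1r /word_eval fmuE big_seq1. Qed.

End Eval.

Lemma tensor2E (a : 'M[K]_m) : tensor2 a = \sum_i \sum_j a i j *: (tgen i * tgen j).
Proof. by []. Qed.

Lemma tensor_eval0 (B : algType K) (v : 'I_m -> B) : tensor_eval v (0 : T) = 0.
Proof.
by have := tensor_eval_linear v (-1) 0 0; rewrite scaler0 addr0 scaleN1r addNr.
Qed.

Lemma tensor_eval_sum (B : algType K) (v : 'I_m -> B) I (e : seq I) (F : I -> T) :
  tensor_eval v (\sum_(i <- e) F i) = \sum_(i <- e) tensor_eval v (F i).
Proof.
elim: e => [|i e IH]; first by rewrite !big_nil tensor_eval0.
rewrite !big_cons -IH -[in LHS](scale1r (F i)).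
by rewrite tensor_eval_linear scale1r.
Qed.

Lemma tensor_eval2 (B : algType K) (v : 'I_m -> B) (a : 'M[K]_m) :
  tensor_eval v (tensor2 a) = \sum_i \sum_j a i j *: (v i * v j).
Proof.
rewrite tensor2E tensor_eval_sum; apply: eq_bigr => i _.
rewrite tensor_eval_sum; apply: eq_bigr => j _.
rewrite -(addr0 (a i j *: _)) tensor_eval_linear tensor_eval0 addr0.
by rewrite (tensor_eval_monoid v).2 !tensor_eval_gen.
Qed.

End TensorTheory.
Section TensorQuotient.
Variables (K : fieldType) (m : nat) (S : 'M[K]_m -> Prop).
Local Notation T := (tensor_algT K m).
Local Notation gens := (fun q : T => exists2 a, S a & q = tensor2 a).

(** Sending all generators to 0 in K kills every quadratic tensor but not 1. *)
Lemma tensor_ideal1 : ~ two_sided_ideal gens 1.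
Proof.
move=> [d [a [s [b [hs e]]]]].
pose v : 'I_m -> K^o := fun=> 0.
have := (tensor_eval_monoid v).1; rewrite e tensor_eval_sum big1 => [/eqP|i _].
  by rewrite eq_sym oner_eq0.
rewrite !(tensor_eval_monoid v).2; have [c _ ->] := hs i.
rewrite tensor_eval2 [X in _ * X * _]big1 ?mulr0 ?mul0r // => j _.
by rewrite big1 // => k _; rewrite /v mulr0 scaler0.
Qed.

Definition tq_alg : algType K := tquot_of tensor_ideal1.
Definition tq_gen (i : 'I_m) : tq_alg := tq_pi tensor_ideal1 (tgen K i).

Lemma tensor_eval_tq p : tensor_eval tq_gen p = tq_pi tensor_ideal1 p.
Proof.
elim/tensor_ind: p => [|c p q hp hq|i p hp].
- by rewrite (tensor_eval_monoid _).1 tq_pi1.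
- by rewrite tensor_eval_linear hp hq tq_piP.
- by rewrite (tensor_eval_monoid _).2 tensor_eval_gen hp tq_piM.
Qed.

Lemma tq_presented : presented_by tq_gen S.
Proof.
split; first by move=> b; have [p <-] := tq_pi_surj b; exists p; exact: tensor_eval_tq.
by move=> p; rewrite tensor_eval_tq tq_pi_eq0.
Qed.

End TensorQuotient.

Section Universal.
Variables (K : fieldType) (m : nat) (S : 'M[K]_m -> Prop).
Variables (U : algType K) (v : 'I_m -> U) (hU : presented_by v S).
Variables (B : algType K) (f : 'I_m -> B).
Hypothesis hf : forall a, S a -> \sum_i \sum_j a i j *: (f i * f j) = 0.

Lemma tensor_eval_ideal p : tensor_eval v p = 0 -> tensor_eval f p = 0.
Proof.
case: hU => _ h /h [d [a [s [b [hs ->]]]]].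
rewrite tensor_eval_sum big1 // => i _; rewrite !(tensor_eval_monoid f).2.
have [c Sc ->] := hs i.
by rewrite tensor_eval2 hf // mulr0 mul0r.
Qed.

Lemma presented_rel a : S a -> \sum_i \sum_j a i j *: (v i * v j) = 0.
Proof.
move=> Sa; rewrite -tensor_eval2; case: hU => _ h; apply/h.
exists 1%N, (fun=> 1), (fun=> tensor2 a), (fun=> 1); split; first by exists a.
by rewrite big_ord1 mul1r mulr1.
Qed.

Lemma presented_ind (C : U -> Prop) : C 1 ->
  (forall (c : K) x y, C x -> C y -> C (c *: x + y)) ->
  (forall i x, C x -> C (v i * x)) -> forall x, C x.
Proof.
move=> C1 CL Cv x; case: hU => h _; have [p <-] := h x.
elim/tensor_ind: p => [|c p q hp hq|i p hp].
- by rewrite (tensor_eval_monoid v).1.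
- by rewrite tensor_eval_linear; exact: CL.
- by rewrite (tensor_eval_monoid v).2 tensor_eval_gen; exact: Cv.
Qed.

Lemma presented_comm : (forall i j, v i * v j = v j * v i) ->
  forall i x, x * v i = v i * x.
Proof.
move=> vC i; elim/presented_ind => [|c x y hx hy|j x hx]; first by rewrite mul1r mulr1.
  by rewrite mulrDl mulrDr -scalerAl -scalerAr hx hy.
by rewrite -mulrA hx mulrA vC -mulrA.
Qed.

Lemma presented_universal : exists2 F : {lrmorphism U -> B}, (forall i, F (v i) = f i) &
  forall G : {lrmorphism U -> B}, (forall i, G (v i) = f i) -> G =1 F.
Proof.
have /choice[rep hrep] : forall b : U, exists p, tensor_eval v p = b by case: hU.
(* F is computed on a chosen preimage in T(W); [FE] shows that any other preimage gives the same
   value. *)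
pose F b := tensor_eval f (rep b).
have FE p : F (tensor_eval v p) = tensor_eval f p.
  apply/eqP; rewrite -subr_eq0 -scaleN1r addrC -tensor_eval_linear; apply/eqP.
  apply: tensor_eval_ideal; rewrite tensor_eval_linear hrep.
  by rewrite scaleN1r addNr.
have Flin : linear F.
  move=> c x y; rewrite -[x]hrep -[y]hrep -tensor_eval_linear !FE.
  exact: tensor_eval_linear.
have Fmul : monoid_morphism F.
  split; first by rewrite -(tensor_eval_monoid v).1 FE (tensor_eval_monoid f).1.
  move=> x y; rewrite -[x]hrep -[y]hrep -(tensor_eval_monoid v).2 !FE.
  exact: (tensor_eval_monoid f).2.
pose F1 := GRing.isLinear.Build K U B _ F Flin.
pose F2 := GRing.isMonoidMorphism.Build U B F Fmul.
pose FF : {lrmorphism U -> B} := HB.pack F F1 F2.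
exists FF => [i|G hG x].
  by rewrite /= -(tensor_eval_gen v) FE tensor_eval_gen.
rewrite -[x]hrep /= FE; elim/tensor_ind: (rep x) => [|c p q hp hq|i p hp].
- by rewrite (tensor_eval_monoid v).1 (tensor_eval_monoid f).1 rmorph1.
- by rewrite !tensor_eval_linear (linearP G) /= hp hq.
- by rewrite (tensor_eval_monoid v).2 (tensor_eval_monoid f).2 rmorphM /= hp !tensor_eval_gen hG.
Qed.

End Universal.

End TensorQuotient.

(** * Quotients of polynomial rings by quadrics *)

Section PolynomialQuotient.
Variables (K : fieldType) (m : nat) (I : idealr {mpoly K[m]}).
Local Notation P := {mpoly K[m]}.
Local Notation A := (poly_quot I).
Local Notation pi := (\pi_A%qT : P -> A).
Implicit Types (p q : P).

Lemma quotP p q : pi p = pi q <-> p - q \in I.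
Proof. by rewrite Quotient.idealrBE; split=> [->|/eqP]. Qed.

Lemma quot0P p : pi p = 0 <-> p \in I.
Proof. by have := quotP p 0; rewrite subr0 raddf0. Qed.

Lemma quotZ c p : pi (c *: p) = c *: pi p.
Proof. by rewrite -mul_mpolyC rmorphM. Qed.

Lemma quotD p q : pi (p + q) = pi p + pi q.
Proof. exact: raddfD. Qed.

Lemma quot_sum (T : Type) (s : seq T) (C : pred T) (F : T -> P) :
  pi (\sum_(i <- s | C i) F i) = \sum_(i <- s | C i) pi (F i).
Proof. exact: raddf_sum. Qed.

Lemma quot_surj (x : A) : exists p, x = pi p.
Proof. by exists (generic_quotient.repr x); rewrite reprK. Qed.

Lemma quot_repr p : generic_quotient.repr (pi p) - p \in I.
Proof. by apply/quotP; rewrite reprK. Qed.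

Definition qvar (i : 'I_m) : A := pi 'X_i.

Lemma quadratic_relsE (a : 'M[K]_m) :
  quadratic_rels qvar a <-> \sum_i \sum_j a i j *: ('X_i * 'X_j) \in I.
Proof.
have e : pi (\sum_i \sum_j a i j *: ('X_i * 'X_j)) = \sum_i \sum_j a i j *: (qvar i * qvar j).
  rewrite quot_sum; apply: eq_bigr => i _; rewrite quot_sum; apply: eq_bigr => j _.
  by rewrite quotZ rmorphM.
rewrite /quadratic_rels -e; exact: quot0P.
Qed.

End PolynomialQuotient.

Section QuadraticQuotient.
Variables (K : numFieldType) (m d : nat) (r : 'I_d -> {mpoly K[m]}).
Variable I : idealr {mpoly K[m]}.
Local Notation P := {mpoly K[m]}.
Local Notation A := (poly_quot I).
Local Notation pi := (\pi_A%qT : P -> A).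
Local Notation qv := (@qvar K m I).
Hypothesis hr : forall l, r l \is 2.-homog.
Hypothesis hI : forall p, p \in I <-> exists c : 'I_d -> P, p = \sum_l c l * r l.
Implicit Types (p q : P) (b : 'X_{1..m}).

Lemma ideal_gen l : r l \in I.
Proof.
apply/hI; exists (fun k => (k == l)%:R).
rewrite (bigD1 l) //= eqxx mul1r big1 ?addr0 // => k /negPf ->.
by rewrite mul0r.
Qed.

Lemma ideal_low p b : p \in I -> (mdeg b < 2)%N -> p@_b = 0.
Proof.
move=> /hI[c ->] b2; rewrite raddf_sum big1 // => l _; apply/eqP.
rewrite mcoeff_eq0; apply/negP => /msuppM_le /allpairsP[[b1 b3] /= [_ h e]].
have := dhomogP _ _ _ (hr l) _ h; rewrite /= => e3.
by move: b2; rewrite e mdegD e3 ltnNge leq_addl.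
Qed.

(** Splitting the coefficients c_l into homogeneous parts, only those of degree k - 2 contribute in
    degree k, and they stay in the ideal. *)
Lemma ideal_pihomog k p : p \in I -> pihomog mdeg k p \in I.
Proof.
move=> /hI[c ->]; rewrite raddf_sum rpred_sum // => l _ /=.
rewrite {1}(pihomog_partitionE (leqnn (msize (c l)))) mulr_suml raddf_sum rpred_sum // => j _ /=.
have h : pihomog mdeg j (c l) * r l \is (j + 2).-homog by rewrite dhomogM ?pihomogP.
have [e|ne] := eqVneq (j + 2)%N k.
  by rewrite -e pihomog_dE // idealMr ?ideal_gen.
by rewrite (pihomog_ne0 _ h) ?rpred0 // eq_sym.
Qed.

Lemma homog0_const p : p \is 0.-homog -> p = (p@_0)%:MP.
Proof.
move=> h; apply/mpolyP=> b; rewrite mcoeffC; case: (eqVneq b 0%MM) => [->|b0].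
  by rewrite mulr1.
by rewrite mulr0 (dhomog_nemf_coeff h) //= mdeg_eq0.
Qed.

Lemma homog1_expand p : p \is 1.-homog -> p = \sum_i p@_U_(i) *: 'X_i.
Proof.
move=> h; apply/mpolyP=> b; rewrite raddf_sum /=.
under eq_bigr do rewrite mcoeffZ mcoeffX.
have [/eqP/mdeg1P[i /eqP ->]|b1] := eqVneq (mdeg b) 1%N.
  rewrite (bigD1 i) //= eqxx mulr1 big1 ?addr0 // => j ji.
  by rewrite eq_mnm1 (negPf ji) mulr0.
rewrite (dhomog_nemf_coeff h) // big1 // => i _.
case: eqVneq => [e|_]; last by rewrite mulr0.
by rewrite -e mdeg1 in b1.
Qed.

Lemma quot_grading : grading (@poly_quot_gr K m I).
Proof.
split.
- by move=> k; exists 0; rewrite ?rpred0 // raddf0.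
- move=> k c u v [p hp ->] [q hq ->]; exists (c *: p + q); last by rewrite quotD quotZ.
  by rewrite rpredD ?rpredZ.
- move=> v; have [p ->] := quot_surj v.
  exists (msize p), (fun k => pi (pihomog mdeg k p)); split.
    by move=> k; exists (pihomog mdeg k p) => //; exact: pihomogP.
  by rewrite -quot_sum -pihomog_partitionE.
- move=> N c hc; have /choice[q hq] : forall k, exists q, q \is k.-homog /\ c k = pi q.
    by move=> k; have [q] := hc k; exists q.
  rewrite (eq_bigr (fun k : 'I_N => pi (q k))) => [|k _]; last by case: (hq k).
  rewrite -quot_sum => /quot0P h k kN; case: (hq k) => _ ->; apply/quot0P.
  have := ideal_pihomog k h; rewrite raddf_sum (bigD1 (Ordinal kN)) //= big1 ?addr0.
    by rewrite pihomog_dE //; case: (hq k).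
  move=> j jk; apply: (@pihomog_ne0 _ _ _ j); last by case: (hq j).
  by apply: contra jk => /eqP e; apply/eqP/val_inj.
Qed.

Lemma quot_degree0 (a : A) : poly_quot_gr 0 a <-> exists c : K, a = c%:A.
Proof.
split=> [[p hp ->]|[c ->]].
  by exists (p@_0); rewrite {1}(homog0_const hp) -alg_mpolyC quotZ rmorph1.
exists (c%:MP); last by rewrite -alg_mpolyC quotZ rmorph1.
by apply/dhomogP => b; rewrite msuppC; case: eqP => // _; rewrite inE => /eqP ->; exact: mdeg0.
Qed.

Lemma quot_degree1 : basis_of_pred (@poly_quot_gr K m I 1) qv.
Proof.
split=> [v|c].
  split=> [[p hp ->]|[c ->]].
    exists (fun i => p@_U_(i)); rewrite {1}(homog1_expand hp) quot_sum.
    by apply: eq_bigr => i _; rewrite quotZ.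
  exists (\sum_i c i *: 'X_i).
    by rewrite rpred_sum // => i _; rewrite rpredZ // dhomogX /= mdeg1.
  by rewrite quot_sum; apply: eq_bigr => i _; rewrite quotZ.
have -> : \sum_i c i *: qv i = pi (\sum_i c i *: 'X_i).
  by rewrite quot_sum; apply: eq_bigr => i _; rewrite quotZ.
move=> /quot0P h j; have := ideal_low h (b := U_(j)%MM); rewrite mdeg1 => /(_ isT).
rewrite raddf_sum (bigD1 j) //= mcoeffZ mcoeffX eqxx mulr1 big1 ?addr0 // => i ij.
by rewrite mcoeffZ mcoeffX eq_mnm1 (negPf ij) mulr0.
Qed.

Lemma homog_euler k p : p \is k.-homog -> k%:R *: p = \sum_i 'X_i * p^`M(i).
Proof.
move=> h; apply/mpolyP=> b; rewrite mpoly_euler mcoeffZ.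
have [->//|bk] := eqVneq (mdeg b) k.
by rewrite (dhomog_nemf_coeff h bk) !mulr0.
Qed.

Lemma homog_deriv k p i : p \is k.+1.-homog -> p^`M(i) \is k.-homog.
Proof.
move=> h; apply/dhomogP => b; rewrite mcoeff_msupp mcoeff_deriv mulrn_eq0 negb_or /=.
rewrite -mcoeff_msupp => /(dhomogP _ _ _ h) /=.
by rewrite mdegD mdeg1 addn1 => -[].
Qed.

(** Euler's formula, applied to r_l and then to its linear partial derivatives. *)
Lemma quad_expand l : r l = \sum_i \sum_j (2^-1 * hess r l i j) *: ('X_i * 'X_j).
Proof.
have two : 2 != 0 :> K by rewrite pnatr_eq0.
apply: (scalerI two); rewrite (homog_euler (hr l)) scaler_sumr.
apply: eq_bigr => i _; have := homog_euler (homog_deriv i (hr l)).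
rewrite scale1r => ->; rewrite mulr_sumr scaler_sumr; apply: eq_bigr => j _.
rewrite deriv2_const // hessC mulrA mulrC mul_mpolyC scalerA mulrA mulfV // mul1r.
by [].
Qed.

(** r_l and its first derivatives vanish at 0, so only the constant terms of the coefficients
    survive: in degree 2 the ideal is just the span of the r_l. *)
Lemma hess_ideal p : p \in I -> exists c : 'I_d -> K, forall i j,
  (p^`M(j)^`M(i))@_0 = \sum_l c l * hess r l i j.
Proof.
move=> /hI[c ->]; exists (fun l => (c l)@_0) => i j.
rewrite (raddf_sum (mderiv j)) (raddf_sum (mderiv i)) (raddf_sum (mcoeff 0%MM)).
apply: eq_bigr => l _ /=; have r0 : (r l)@_0 = 0 by rewrite (dhomog_nemf_coeff (hr l)) //= mdeg0.
have r1 k : ((r l)^`M(k))@_0 = 0.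
  by rewrite (dhomog_nemf_coeff (homog_deriv k (hr l))) //= mdeg0.
rewrite mderivM mderivD !mderivM !mcoeffD !rmorphM /= r0 !r1 !mulr0 !add0r.
by [].
Qed.

Lemma deriv2_varM (i j k l : 'I_m) : (('X_k * 'X_l : P)^`M(j)^`M(i))@_0 =
  ((k == i) && (l == j))%:R + ((k == j) && (l == i))%:R :> K.
Proof.
have X1 (s t : 'I_m) : ('X_s : P)^`M(t) = (s == t)%:R.
  rewrite mderivX mnm1E; case: eqVneq => [->|_]; last by rewrite scale0r.
  rewrite (_ : U_(t) - U_(t) = 0)%MM; last by apply/mnmP=> u; rewrite mnmBE subnn mnm0E.
  by rewrite mpolyX0 scale1r.
rewrite mderivM mderivD !X1 !mderivM !X1.
have nat0 (n : nat) (t : 'I_m) : (n%:R : P)^`M(t) = 0 by rewrite -mpolyC_nat mderivC.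
rewrite !nat0 !mul0r !mulr0 add0r addr0 mcoeffD -!natrM -!mpolyC_nat !mcoeffC eqxx !mulr1.
by rewrite addrC; case: (k == i); case: (l == j); case: (k == j); case: (l == i).
Qed.

Lemma hess_quadratic (a : 'M[K]_m) i j :
  ((\sum_k \sum_l a k l *: ('X_k * 'X_l))^`M(j)^`M(i))@_0 = a i j + a j i.
Proof.
rewrite (raddf_sum (mderiv j)) (raddf_sum (mderiv i)) (raddf_sum (mcoeff 0%MM)) /=.
under eq_bigr do rewrite (raddf_sum (mderiv j)) (raddf_sum (mderiv i)) (raddf_sum (mcoeff 0%MM)) /=.
under eq_bigr => k _ do under eq_bigr => l _ do rewrite !mderivZ mcoeffZ deriv2_varM mulrDr.
under eq_bigr do rewrite big_split /=.
rewrite big_split /=; congr (_ + _).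
  rewrite (bigD1 i) //= (bigD1 j) //= !eqxx mulr1 big1 ?addr0 => [|l /negPf lj];
    last by rewrite lj andbF mulr0.
  by rewrite big1 ?addr0 // => k /negPf ki; rewrite big1 // => l _; rewrite ki mulr0.
rewrite (bigD1 j) //= (bigD1 i) //= !eqxx mulr1 big1 ?addr0 => [|l /negPf lj];
  last by rewrite lj andbF mulr0.
by rewrite big1 ?addr0 // => k /negPf ki; rewrite big1 // => l _; rewrite ki mulr0.
Qed.

End QuadraticQuotient.

Import TensorQuotient.

Section MatrixSums.
Variables (K : fieldType) (m : nat) (V : lmodType K) (F : 'I_m -> 'I_m -> V).

Definition mxsum (a : 'M[K]_m) : V := \sum_i \sum_j a i j *: F i j.

Fact mxsum_linear : linear mxsum.
Proof.
move=> c a b; rewrite /mxsum scaler_sumr -big_split; apply: eq_bigr => i _ /=.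
rewrite scaler_sumr -big_split; apply: eq_bigr => j _ /=.
by rewrite !mxE scalerDl scalerA.
Qed.
HB.instance Definition _ := GRing.isLinear.Build K 'M[K]_m V _ mxsum mxsum_linear.

Lemma mxsum_delta k l : mxsum (delta_mx k l) = F k l.
Proof.
rewrite /mxsum (bigD1 k) //= (bigD1 l) //= mxE !eqxx scale1r.
rewrite !big1 ?addr0 // => [i /negPf ik|j /negPf jl]; last by rewrite mxE jl andbF scale0r.
by rewrite big1 // => j _; rewrite mxE ik scale0r.
Qed.

End MatrixSums.

(** * The quotient as a quadratic algebra *)

Section QuotientPresentation.
Variables (K : fieldType) (m d : nat) (h : 'I_d -> 'M[K]_m).
Variable I : idealr {mpoly K[m]}.
Local Notation P := {mpoly K[m]}.
Local Notation A := (poly_quot I).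
Local Notation pi := (\pi_A%qT : P -> A).
Local Notation quad := (mxsum (fun i j => 'X_i * 'X_j : P)).
Hypothesis hI : forall p, p \in I <-> exists c : 'I_d -> P, p = \sum_l c l * quad (h l).
Local Notation qv := (@qvar K m I).
Local Notation rels := (quadratic_rels qv).

Lemma tensor_eval_X_surj (f : P) : exists p, tensor_eval (fun i => 'X_i : P) p = f.
Proof.
pose te := tensor_eval (fun i => 'X_i : P).
pose C (f : P) := exists p, te p = f.
have CM f1 f2 : C f1 -> C f2 -> C (f1 * f2).
  by move=> [p <-] [q <-]; exists ((p : tensor_lalg K m) * q); exact: (tensor_eval_monoid _).2.
have C1 : C 1 by exists (1 : tensor_lalg K m); exact: (tensor_eval_monoid _).1.
have C0 : C 0 by exists (0 : tensor_lalg K m); exact: tensor_eval0.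
have CX b : C 'X_[b].
  rewrite mpolyXE_id; elim/big_rec: _ => // i x _ Cx; apply: (CM) => //.
  elim: (b i) => [|n IH] //; rewrite exprS; apply: (CM) => //.
  by exists (tgen K i); exact: tensor_eval_gen.
rewrite [f]mpolyE; elim/big_rec: _ => // b x _ [q qx]; have [p px] := CX b.
exists (f@_b *: (p : tensor_lalg K m) + q); rewrite tensor_eval_linear.
by rewrite [tensor_eval _ p]px [tensor_eval _ q]qx.
Qed.

Lemma tensor_eval_qvar p : tensor_eval qv p = pi (tensor_eval (fun i => 'X_i : P) p).
Proof.
elim/tensor_ind: p => [|c p q hp hq|i p hp].
- by rewrite !(tensor_eval_monoid _).1 rmorph1.
- by rewrite !tensor_eval_linear hp hq quotD quotZ.
- by rewrite !(tensor_eval_monoid _).2 hp !tensor_eval_gen rmorphM.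
Qed.

(** The commutators are among the quadratic relations, so the generators of U commute and evaluation
    at v factors through the polynomial ring. The quadrics are relations too, so this map kills the
    ideal. *)
Lemma quot_presented_le (U : algType K) (v : 'I_m -> U) : presented_by v rels ->
  forall p, tensor_eval qv p = 0 -> tensor_eval v p = 0.
Proof.
move=> hU p; rewrite tensor_eval_qvar => /quot0P /hI[c hc].
have vC i j : v i * v j = v j * v i.
  have ha : rels (delta_mx i j - delta_mx j i).
    apply/quadratic_relsE; rewrite -/(mxsum (fun i j => 'X_i * 'X_j) _).
    by rewrite linearB /= !mxsum_delta mulrC subrr rpred0.
  have := presented_rel hU ha; rewrite -/(mxsum (fun i j => v i * v j) _).
  by rewrite linearB /= !mxsum_delta => /eqP; rewrite subr_eq0 => /eqP.
have vcomm := presented_comm hU vC.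
pose g : P -> U := mmap (in_alg U) v.
have gM : multiplicative g.
  apply: commr_mmap_is_multiplicative => [i x|f b b']; first exact: vcomm.
  by rewrite /GRing.comm /= mulr_algl mulr_algr.
have gE q : g (tensor_eval (fun i => 'X_i : P) q) = tensor_eval v q.
  elim/tensor_ind: q => [|a q q' hq hq'|i q hq].
  - by rewrite !(tensor_eval_monoid _).1; exact: gM.2.
  - by rewrite !tensor_eval_linear /g mmapD mmapZ -/g -/(g _) -/(g _) hq hq' /= mulr_algl.
  - by rewrite !(tensor_eval_monoid _).2 gM.1 hq !tensor_eval_gen /g mmapX mmap1U.
rewrite -gE hc /g raddf_sum big1 // => l _ /=; rewrite -/g gM.1.
have -> : g (quad (h l)) = 0; last by rewrite mulr0.
have gX i j : g ('X_i * 'X_j) = v i * v j by rewrite gM.1 /g !mmapX !mmap1U.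
have -> : g (quad (h l)) = mxsum (fun i j => v i * v j) (h l).
  rewrite /g raddf_sum; apply: eq_bigr => i _; rewrite raddf_sum; apply: eq_bigr => j _ /=.
  by rewrite mmapZ -/(g _) gX /= mulr_algl.
apply: (presented_rel hU); apply/quadratic_relsE; rewrite -/(quad (h l)).
apply/hI; exists (fun k => (k == l)%:R).
by rewrite (bigD1 l) //= eqxx mul1r big1 ?addr0 // => k /negPf ->; rewrite mul0r.
Qed.

(** The algebra [tq_alg], presented by the same relations, is the test object: a tensor that
    vanishes in A vanishes there, hence lies in the ideal of the relations. *)
Lemma quot_presented : presented_by qv rels.
Proof.
split.
  move=> b; have [f ->] := quot_surj b; have [p <-] := tensor_eval_X_surj f.
  by exists p; rewrite tensor_eval_qvar.
have hU := tq_presented rels; have [_ e] := hU.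
move=> p; split=> [hp|/e]; first by apply/e; exact: quot_presented_le hU _ hp.
exact: (tensor_eval_ideal hU).
Qed.

End QuotientPresentation.

(** * Koszul duality *)

Section KoszulDual.
Variables (K : numFieldType) (m d : nat) (r : 'I_d -> {mpoly K[m]}).
Variable I : idealr {mpoly K[m]}.
Local Notation P := {mpoly K[m]}.
Local Notation A := (poly_quot I).
Local Notation pi := (\pi_A%qT : P -> A).
Hypothesis hr : forall l, r l \is 2.-homog.
Hypothesis hI : forall p, p \in I <-> exists c : 'I_d -> P, p = \sum_l c l * r l.
Local Notation qv := (@qvar K m I).
Local Notation rels := (quadratic_rels qv).

Implicit Types (a b : 'M[K]_m).

Lemma quot_quadratic : quadratic_algebra (@poly_quot_gr K m I) qv.
Proof.
split.
- exact: quot_grading hr hI.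
- move=> i j a b [p hp ->] [q hq ->]; exists (p * q); first exact: dhomogM.
  by rewrite rmorphM.
- exact: quot_degree0.
- exact: quot_degree1 hr hI.
- pose h l : 'M[K]_m := \matrix_(i, j) (2^-1 * hess r l i j).
  have hE l : r l = mxsum (fun i j => 'X_i * 'X_j : P) (h l).
    rewrite {1}(quad_expand hr l); apply: eq_bigr => i _; apply: eq_bigr => j _.
    by rewrite mxE.
  apply: (quot_presented (h := h)) => p; split.
    by move=> /hI[c ->]; exists c; apply: eq_bigr => l _; rewrite -hE.
  by move=> [c ->]; apply/hI; exists c; apply: eq_bigr => l _; rewrite -hE.
Qed.

Definition mxdot (a b : 'M[K]_m) : K := \sum_i \sum_j a i j * b i j.
Definition hessmx l : 'M[K]_m := \matrix_(i, j) hess r l i j.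

Lemma mxdotC a b : mxdot a b = mxdot b a.
Proof. by apply: eq_bigr => i _; apply: eq_bigr => j _; rewrite mulrC. Qed.

Lemma mxdotP (c : K) a a' b : mxdot (c *: a + a') b = c * mxdot a b + mxdot a' b.
Proof. exact: (linearP (mxsum (fun i j => b i j : K^o))). Qed.

Lemma mxdotD a a' b : mxdot (a + a') b = mxdot a b + mxdot a' b.
Proof. by rewrite -[a]scale1r mxdotP mul1r scale1r. Qed.

Lemma mxdotZ (c : K) a b : mxdot (c *: a) b = c * mxdot a b.
Proof.
rewrite -[c *: a]addr0 mxdotP [X in _ + X]big1 ?addr0 // => i _.
by rewrite big1 // => j _; rewrite mxE mul0r.
Qed.

Lemma mxdotB a a' b : mxdot (a - a') b = mxdot a b - mxdot a' b.
Proof. by rewrite mxdotD -scaleN1r mxdotZ mulN1r. Qed.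

Lemma mxdot_sum (T : Type) (s : seq T) (F : T -> 'M[K]_m) b :
  mxdot (\sum_(t <- s) F t) b = \sum_(t <- s) mxdot (F t) b.
Proof. exact: (linear_sum (mxsum (fun i j => b i j : K^o))). Qed.

Lemma mxdot_delta (i j : 'I_m) b : mxdot (delta_mx i j) b = b i j.
Proof. exact: (mxsum_delta (fun i j => b i j : K^o)). Qed.

(** A symmetric b pairs with a only through a + a^T, and for a quadratic relation a this is a
    combination of Hessians. *)
Lemma annihilator_suff b : (forall i j, b i j = b j i) ->
  (forall l, mxdot b (hessmx l) = 0) -> annihilator rels b.
Proof.
move=> bC bh a /quadratic_relsE /(hess_ideal hr hI)[c hc].
have hac i j : a i j + a j i = \sum_l c l * hess r l i j by rewrite -hc hess_quadratic.
apply/eqP; rewrite -(mulrI_eq0 _ (mulfI (_ : 2 != 0))) ?pnatr_eq0 //; apply/eqP.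
have -> : 2 * (\sum_i \sum_j a i j * b i j) = \sum_i \sum_j (a i j + a j i) * b i j.
  rewrite mulr_natl mulr2n {2}exchange_big -big_split; apply: eq_bigr => i _ /=.
  by rewrite -big_split; apply: eq_bigr => j _ /=; rewrite mulrDl (bC j i).
transitivity (\sum_l c l * mxdot b (hessmx l)); last first.
  by rewrite big1 // => l _; rewrite bh mulr0.
under [RHS]eq_bigr do rewrite /mxdot mulr_sumr.
rewrite [RHS]exchange_big; apply: eq_bigr => i _ /=.
under [RHS]eq_bigr do rewrite mulr_sumr.
rewrite [RHS]exchange_big; apply: eq_bigr => j _ /=.
by rewrite hac mulr_suml; apply: eq_bigr => l _; rewrite mxE; ring.
Qed.

Lemma annihilator_sym b (i j : 'I_m) : annihilator rels b -> b i j = b j i.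
Proof.
move=> hb; apply/eqP; rewrite -subr_eq0; apply/eqP.
have ha : rels (delta_mx i j - delta_mx j i).
  apply/quadratic_relsE; rewrite -/(mxsum (fun i j => 'X_i * 'X_j) _).
  by rewrite linearB /= !mxsum_delta mulrC subrr rpred0.
by have := hb _ ha; rewrite -/(mxdot _ b) mxdotB !mxdot_delta.
Qed.

Lemma annihilator_hess b l : annihilator rels b -> mxdot b (hessmx l) = 0.
Proof.
move=> hb.
have ha : rels (2^-1 *: hessmx l).
  apply/quadratic_relsE.
  have -> : \sum_i \sum_j (2^-1 *: hessmx l) i j *: ('X_i * 'X_j) = r l :> P.
    by rewrite [RHS](quad_expand hr l); apply: eq_bigr => i _; apply: eq_bigr => j _; rewrite !mxE.
  exact: ideal_gen hI l.
have := hb _ ha; rewrite -/(mxdot _ b) mxdotZ mxdotC => /eqP.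
by rewrite mulf_eq0 invr_eq0 pnatr_eq0 => /eqP.
Qed.

(** For each l, a pair of generators of L_1 with bracket exactly y_l. It makes L generated in degree
    1 and defines the image of y_l in U. *)
Variables (gi gj : 'I_d -> 'I_m).
Hypothesis hgen : forall l k, hess r k (gi l) (gj l) = (k == l)%:R.
(* The generators i and j anticommute with u in U, hence their anticommutator
   c y_l commutes with u. *)
Hypothesis hcentral : forall (l : 'I_d) (u : 'I_m), exists i j (c : K), [/\ c != 0,
  forall k, hess r k i j = c * (k == l)%:R, forall k, hess r k u i = 0 & forall k, hess r k u j = 0].

Section Enveloping.
Variables (U : algType K) (v : 'I_m -> U).
Hypothesis hU : presented_by v (annihilator rels).

(* The image of y_l in U. *)
Definition lsq l : U := v (gi l) * v (gj l) + v (gj l) * v (gi l).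

(** The symmetric tensor of (i, j), minus the combination of those of the pairs (gi l, gj l) with
    coefficients [hess r l i j], is orthogonal to all Hessians by [hgen], hence a relation of U. *)
Lemma anticomm i j : v i * v j + v j * v i = \sum_l hess r l i j *: lsq l.
Proof.
pose S (i j : 'I_m) : 'M[K]_m := delta_mx i j + delta_mx j i.
pose b := S i j - \sum_l hess r l i j *: S (gi l) (gj l).
have SC i' j' (t t' : 'I_m) : S i' j' t t' = S i' j' t' t.
  by rewrite /S !mxE addrC; congr (_ + _); rewrite andbC.
have Sdot i' j' l : mxdot (S i' j') (hessmx l) = 2 * hess r l i' j'.
  rewrite /S mxdotD !mxdot_delta !mxE (hessC r l j').
  by rewrite mulr_natl mulr2n.
have hb : annihilator rels b.
  apply: annihilator_suff => [a a'|l].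
    rewrite /b !mxE !summxE; congr (_ - _); first by have := SC i j a a'; rewrite !mxE.
    by apply: eq_bigr => l _; have := SC (gi l) (gj l) a a'; rewrite !mxE => ->.
  rewrite /b mxdotB mxdot_sum Sdot (bigD1 l) //= mxdotZ Sdot hgen eqxx mulr1.
  rewrite big1 ?addr0 => [|k kl]; first by rewrite mulrC subrr.
  by rewrite mxdotZ Sdot hgen eq_sym (negPf kl) !mulr0.
have := presented_rel hU hb; rewrite -/(mxsum (fun i j => v i * v j) b) /b linearB /=.
move/eqP; rewrite subr_eq0 => /eqP; rewrite /S linearD /= !mxsum_delta => ->.
rewrite linear_sum; apply: eq_bigr => l _ /=.
by rewrite linearZ linearD /= !mxsum_delta.
Qed.

Lemma lsq_central_gen l u : v u * lsq l = lsq l * v u.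
Proof.
have [i [j [c [c0 hl hi hj]]]] := hcentral l u.
have z (a : 'I_m) : (forall k, hess r k u a = 0) -> v u * v a = - (v a * v u).
  move=> ha; apply/eqP; rewrite -addr_eq0 anticomm big1 // => k _.
  by rewrite ha scale0r.
have e : v i * v j + v j * v i = c *: lsq l.
  rewrite anticomm (bigD1 l) //= hl eqxx mulr1 big1 ?addr0 // => k /negPf kl.
  by rewrite hl kl mulr0 scale0r.
have zi := z i hi; have zj := z j hj.
have : v u * (c *: lsq l) = (c *: lsq l) * v u.
  rewrite -e mulrDr mulrDl !mulrA zi zj !mulNr -!mulrA zi zj !mulrN !opprK.
  by [].
rewrite -scalerAl -scalerAr => /(scalerI c0); exact.
Qed.

Lemma lsqC l k : lsq l * lsq k = lsq k * lsq l.
Proof.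
have c u w : lsq l * (v u * v w) = v u * v w * lsq l.
  by rewrite mulrA -lsq_central_gen -mulrA -lsq_central_gen mulrA.
have -> : lsq k = v (gi k) * v (gj k) + v (gj k) * v (gi k) by [].
by rewrite [LHS]mulrDr [RHS]mulrDl !c.
Qed.

Definition genU (u : 'I_m + 'I_d) : U := match u with inl i => v i | inr l => lsq l end.
Definition iotaU (x : qlie r) : U := \sum_u coord x u *: genU u.

Lemma iotaU_linear : linear iotaU.
Proof.
move=> c x y; rewrite /iotaU scaler_sumr -big_split; apply: eq_bigr => u _ /=.
by rewrite coordP scalerDl scalerA.
Qed.

Lemma iotaU_bas u : iotaU (bas r u) = genU u.
Proof.
rewrite /iotaU (bigD1 u) //= coord_bas eqxx scale1r big1 ?addr0 // => w.
by rewrite coord_bas eq_sym => /negPf ->; rewrite scale0r.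
Qed.

Lemma iotaU_lie : lie_to_assoc iotaU.
Proof.
split; first exact: iotaU_linear.
move=> i j x y hx hy; rewrite /iotaU.
pose F u w : U := genU u * genU w - (-1) ^+ (bdeg u * bdeg w)%N *: (genU w * genU u).
transitivity (\sum_u \sum_w (coord x u * coord y w) *: F u w).
  have FE u w : F u w = if u is inl a then (if w is inl b then \sum_l hess r l a b *: lsq l else 0) else 0.
    case: u w => [a|l] [b|k]; rewrite /F /=.
    - by rewrite expr1 scaleN1r opprK anticomm.
    - by rewrite mul1n sqrrN expr1n scale1r lsq_central_gen subrr.
    - by rewrite muln1 sqrrN expr1n scale1r lsq_central_gen subrr.
    - by rewrite -signr_odd scale1r lsqC subrr.
  rewrite big_sumType /= [X in X + _]big1 ?add0r; last by move=> a _; rewrite mxE scale0r.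
  rewrite big_sumType /= [X in _ + X]big1 ?addr0; last first.
    by move=> l _; rewrite big1 // => w _; rewrite FE scaler0.
  under [RHS]eq_bigr => a _ do (rewrite big_sumType /= [X in _ + X]big1 ?addr0;
    last by move=> l _; rewrite FE scaler0).
  under [RHS]eq_bigr => a _ do under eq_bigr => b _ do rewrite FE scaler_sumr.
  under [RHS]eq_bigr do rewrite exchange_big /=.
  rewrite [RHS]exchange_big /=; apply: eq_bigr => l _; rewrite qbrE scaler_suml.
  apply: eq_bigr => a _; rewrite scaler_suml; apply: eq_bigr => b _.
  by rewrite scalerA.
have -> : iotaU x * iotaU y = \sum_u \sum_w (coord x u * coord y w) *: (genU u * genU w).
  rewrite /iotaU mulr_suml; apply: eq_bigr => u _; rewrite mulr_sumr; apply: eq_bigr => w _.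
  by rewrite -scalerAl -scalerAr scalerA.
have -> : iotaU y * iotaU x = \sum_u \sum_w (coord x u * coord y w) *: (genU w * genU u).
  rewrite /iotaU mulr_suml exchange_big /=; apply: eq_bigr => u _; rewrite mulr_sumr.
  by apply: eq_bigr => w _; rewrite -scalerAl -scalerAr scalerA mulrC.
rewrite scaler_sumr -sumrB; apply: eq_bigr => u _; rewrite scaler_sumr -sumrB.
apply: eq_bigr => w _; rewrite /F scalerBr !scalerA; congr (_ - _ *: _).
have [ui|ui] := eqVneq (bdeg u) i; last by rewrite (coord_deg hx ui) !(mul0r, mulr0).
have [wj|wj] := eqVneq (bdeg w) j; last by rewrite (coord_deg hy wj) !(mul0r, mulr0).
by rewrite ui wj mulrC.
Qed.

(** A morphism from L is determined by its values on the e_i. These satisfy the relations of U, so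
    the universal property of the presentation yields the extension, and the extension agrees with f
    on y_l because y_l is a bracket. *)
Lemma iotaU_enveloping : enveloping iotaU.
Proof.
split; first exact: iotaU_lie.
move=> B f [fL fB].
pose e i : qlie r := bas r (inl i).
have f2 i j : f (e i) * f (e j) + f (e j) * f (e i) = \sum_l hess r l i j *: f (bas r (inr l)).
  have := fB 1%N 1%N (e i) (e j) (bas_gr r (inl i)) (bas_gr r (inl j)).
  rewrite expr1 scaleN1r opprK => <-.
  by rewrite [lie_br _ _](qbr_bas r i j) (lincomb_morph fL).
(* Since b is symmetric, twice the sum is a combination of anticommutators. By [f2] the coefficient
   of f(y_l) is then the pairing of b with the l-th Hessian, which is 0. *)
have hf b : annihilator rels b -> \sum_i \sum_j b i j *: (f (e i) * f (e j)) = 0.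
  move=> hb; have two : 2 != 0 :> K by rewrite pnatr_eq0.
  apply: (scalerI two); rewrite scaler0 scaler_nat mulr2n {2}exchange_big -big_split /=.
  transitivity (\sum_i \sum_j \sum_l (b i j * hess r l i j) *: f (bas r (inr l))).
    apply: eq_bigr => i _; rewrite -big_split; apply: eq_bigr => j _ /=.
    rewrite (annihilator_sym j i hb) -scalerDr f2 scaler_sumr; apply: eq_bigr => l _.
    by rewrite scalerA.
  under eq_bigr do rewrite exchange_big /=.
  rewrite exchange_big /= big1 // => l _.
  have := annihilator_hess l hb; rewrite /mxdot => h0.
  under eq_bigr do rewrite -scaler_suml.
  rewrite -scaler_suml; have -> : \sum_i \sum_j b i j * hess r l i j = 0.
    by rewrite -[RHS]h0; apply: eq_bigr => i _; apply: eq_bigr => j _; rewrite mxE.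
  by rewrite scale0r.
have [F Fv Fu] := presented_universal hU hf.
have Fg u : F (genU u) = f (bas r u).
  case: u => [i|l] /=; first exact: Fv.
  rewrite /lsq rmorphD !rmorphM /= !Fv f2 (bigD1 l) //= hgen eqxx scale1r big1 ?addr0 // => k kl.
  by rewrite hgen (negPf kl) scale0r.
exists F => [x|G hG]; last first.
  apply: Fu => i; rewrite -(hG (bas r (inl i))); congr (G _).
  by rewrite iotaU_bas.
rewrite /iotaU linear_sum /=; under eq_bigr do rewrite linearZ /= Fg.
by rewrite -(lincomb_morph fL) -coord_sum.
Qed.

End Enveloping.

Lemma quot_koszul_dual : koszul_dual qv (fun i => bas r (inl i)).
Proof.
split.
- split=> [x|c hc i].
    split=> [x2|[c ->]].
      exists (x.1 0); rewrite {1}(coord_sum x) big_sumType /= [X in _ + X]big1 ?addr0 // => l _.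
      by rewrite x2 mxE scale0r.
    have [g0 gP _ _] := lie_grading (qlie r).
    elim/big_rec: _ => [|i y _ hy]; first exact: g0.
    exact: gP (bas_gr r (inl i)) hy.
  have : coord (\sum_i c i *: bas r (inl i)) (inl i) = 0 by rewrite hc /= mxE.
  rewrite coord_lincomb; under eq_bigr do rewrite coord_bas.
  rewrite (bigD1 i) //= eqxx mulr1 big1 ?addr0 // => j /negPf ji.
  by rewrite (_ : inl j == inl i = false) ?mulr0 //; apply: contraFF ji => /eqP[->].
- move=> S S0 SL SB S1 x.
  have S1' i : S (bas r (inl i)) by apply: S1; exact: (bas_gr r (inl i)).
  have Sb u : S (bas r u).
    case: u => [i|l]; first exact: S1'.
    have := SB _ _ (S1' (gi l)) (S1' (gj l)); congr S.
    rewrite [LHS]qbr_bas (bigD1 l) //= hgen eqxx scale1r big1 ?addr0 // => k kl.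
    by rewrite hgen (negPf kl) scale0r.
  rewrite (coord_sum x); elim/big_rec: _ => // u y _ Sy; exact: SL.
- exists (tq_alg (annihilator rels)), (iotaU (tq_gen (annihilator rels))); split.
    rewrite (_ : (fun i => _) = tq_gen (annihilator rels)); first exact: tq_presented.
    by apply/funext => i; exact: iotaU_bas.
  by apply: iotaU_enveloping; exact: tq_presented.
Qed.
End KoszulDual.

(** * Cohomology of the Koszul dual *)

Section Cohomology.
Variables (K : numFieldType) (m d : nat) (r : 'I_d -> {mpoly K[m]}).
Variable I : idealr {mpoly K[m]}.
Local Notation P := {mpoly K[m]}.
Local Notation E := (ext K m d).
Local Notation A := (poly_quot I).
Local Notation pi := (\pi_A%qT : P -> A).
Local Notation L := (qlie r).
Local Notation Psi := (ext_cochain r).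
Local Notation delta := (koszul_diff r).
Local Notation embed := (@ext_poly K m d).
Hypothesis hr : forall l, r l \is 2.-homog.
Hypothesis hI : forall p, p \in I <-> exists c : 'I_d -> P, p = \sum_l c l * r l.
Hypothesis hex : forall z : E, delta z = 0 ->
  exists y, forall S, S != set0 -> (z - delta y) S = 0.

Implicit Types (Q : E) (f g : P).

Lemma Psi_homog_part p f x : Psi p (embed f) x = Psi p (embed (pihomog mdeg p f)) x.
Proof.
rewrite {1}(pihomog_partitionE (leq_maxl (msize f) p.+1)) linear_sum.
have pk : (p < maxn (msize f) p.+1)%N by rewrite leq_max ltnSn orbT.
rewrite (bigD1 (Ordinal pk)) //= PsiD -[RHS]addr0; congr (_ + _).
elim/big_rec: _ => [|i Q ip hQ]; first exact: Psi0.
rewrite PsiD hQ addr0 PsiE (dirder_coef (pihomogP _ _ _)) //.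
rewrite mdeg0 add0n size_map size_enum_ord.
by apply: contra ip => /eqP e; apply/eqP/val_inj; exact: esym e.
Qed.

(** If f is the sum of the c_l r_l, a preimage is the sum of the c_l eps_l. *)
Lemma ext_poly_ideal f : f \in I -> exists Q, embed f = delta Q.
Proof.
move=> /hI[c ->]; exists (\sum_l wedge l (embed (c l))).
rewrite [in RHS](linear_sum delta) linear_sum; apply: eq_bigr => l _.
have ce k (h : P) : contr k (embed h) = 0.
  apply/ffunP=> S; rewrite !ffunE; case: ifP => // _.
  rewrite ifF ?scaler0 //; apply/negbTE/set0Pn; exists k; by rewrite !inE eqxx.
rewrite /= /koszul_diff (bigD1 l) //= contr_wedge eqxx scale1r ce linear0 subr0.
rewrite big1 ?addr0 => [|k kl]; last first.
  by rewrite contr_wedge (negPf kl) scale0r ce linear0 subr0 linear0.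
apply/ffunP=> S; rewrite !ffunE /= /xmul; case: ifP => _; last by rewrite mulr0.
by rewrite mulrC.
Qed.

Lemma coboundary_koszul_diff p Q : coboundary (Psi p (delta Q)).
Proof.
case: p => [|p] /=.
  by move=> x; rewrite /ext_cochain (size0nil (size_enum_ord 0)) /= (ev0_koszul_diff hr).
split; first exact: Psi_cochain.
exists (Psi p ((-1) ^+ p *: Q)); split; first exact: Psi_cochain.
have := Psi_differential hr p ((-1) ^+ p *: Q).
by rewrite linearZ /= scalerA -exprMn mulrNN mul1r expr1n scale1r.
Qed.

Lemma coboundary_ideal p f : f \in I -> coboundary (Psi p (embed f)).
Proof. by move=> /ext_poly_ideal[Q ->]; exact: coboundary_koszul_diff. Qed.

Lemma eulerP p Q : euler Q = p%:R *: Q <->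
  forall S b, (Q S)@_b != 0 -> (mdeg b + #|S|)%N = p.
Proof.
split=> [h S b q0|h].
  have := eulerE Q S b; rewrite h ffunE mcoeffZ => /(mulIf q0)/eqP.
  by rewrite eqr_nat => /eqP.
apply/ffunP=> S; apply/mpolyP=> b; rewrite eulerE ffunE mcoeffZ.
by have [->|/h ->] := eqVneq (Q S)@_b 0; rewrite ?mulr0.
Qed.

(** [delta] trades one eps for a quadric in x, so the total degree rises by one. *)
Lemma euler_koszul_diff p Q : euler Q = p%:R *: Q -> euler (delta Q) = p.+1%:R *: delta Q.
Proof.
move=> /eulerP hQ; apply/eulerP => S b.
rewrite sum_ffunE raddf_sum => /sum_neq0[l _] /=.
rewrite !ffunE /= /xmul; case: ifPn => lS; first by rewrite mulr0 mcoeff0 eqxx.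
rewrite -scalerAr mcoeffZ mulf_eq0 negb_or => /andP[_].
rewrite -mcoeff_msupp => /msuppM_le /allpairsP[[b1 b2] /= [h1 h2 ->]].
have e1 := dhomogP _ _ _ (hr l) _ h1; move: h2; rewrite mcoeff_msupp => /hQ.
by rewrite cardsU1 lS mdegD /= in e1 *; rewrite e1 => <-; rewrite addnCA -addnA.
Qed.

Lemma euler_ext_poly p f : f \is p.-homog -> euler (embed f) = p%:R *: embed f.
Proof.
move=> hf; apply/eulerP => S b; rewrite ffunE; case: (eqVneq S set0) => [->|_];
  last by rewrite mcoeff0 eqxx.
by rewrite -mcoeff_msupp cards0 addn0 => /(dhomogP _ _ _ hf).
Qed.

(** [repr] picks an arbitrary polynomial of the class, possibly inhomogeneous. This is harmless:
    [Psi p] sees only the part of degree p, and elements of the ideal give coboundaries. *)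
Definition phi p (a : A) : cochain L p := Psi p (embed (generic_quotient.repr a)).
Arguments phi : clear implicits.

Lemma homog_basis_zero p Q : euler Q = p%:R *: Q ->
  (forall (k : 'I_p -> nat) (x : {ffun 'I_p -> L}), homogeneous k x -> Psi p Q x = 0) -> Q = 0.
Proof.
move=> hQ h; apply: Psi_inj hQ => t.
by apply: (h (fun i => bdeg (t i))) => i; rewrite ffunE; exact: bas_gr.
Qed.

Lemma phi_rep p (a : A) : poly_quot_gr p a ->
  exists f, [/\ f \is p.-homog, a = pi f & phi p a = Psi p (embed f)].
Proof.
move=> [f hf ->]; pose g := pihomog mdeg p (generic_quotient.repr (pi f)).
exists g; split; first exact: pihomogP.
  apply/quotP; have := ideal_pihomog hr hI p (quot_repr I f).
  by rewrite linearB /= (pihomog_dE hf) -opprB rpredN.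
by apply/funext => x; exact: Psi_homog_part.
Qed.

Lemma phi_cohomology : cohomology_iso (@poly_quot_gr K m I) (@qvar K m I) (fun i => bas r (inl i)) phi.
Proof.
split.
- move=> p a _; split; first exact: Psi_cochain.
  move=> k x hx; have := Psi_differential hr p (embed (generic_quotient.repr a)) k x hx.
  rewrite koszul_diff_set0 ?scaler0 ?Psi0 // => S S0; rewrite ffunE (negPf S0) //.
- move=> p c a b _ _; rewrite /cohomologous /phi.
  have [[f ->] [g ->]] := (quot_surj a, quot_surj b).
  set u := generic_quotient.repr (pi f); set v := generic_quotient.repr (pi g).
  set w := generic_quotient.repr _.
  rewrite (_ : (fun x => _) = Psi p (embed (w - (c *: u + v)))).
    apply: coboundary_ideal; apply/quotP; rewrite /w reprK quotD quotZ.
    by rewrite !reprK.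
  by apply/funext => x; rewrite linearB linearP /= PsiB Psi_linear.
- move=> x /=; rewrite /phi PsiE /= (size0nil (size_enum_ord 0)) /=.
  have /(ideal_low hr hI (b := 0%MM)) := quot_repr I 1.
  by rewrite mdeg0 rmorph1 mcoeffB mcoeff1 eqxx => /(_ isT).
- move=> p q a b /phi_rep[f [hf -> ->]] /phi_rep[g [hg -> ->]].
  exists (Psi (p + q) (embed (f * g))); first exact: Psi_mul.
  rewrite /cohomologous -rmorphM.
  rewrite (_ : (fun x => _) = Psi (p + q) (embed (f * g - generic_quotient.repr (pi (f * g))))).
    by apply: coboundary_ideal; rewrite -opprB rpredN quot_repr.
  by apply/funext => x; rewrite linearB PsiB.
- move=> p a /phi_rep[f [hf -> ->]]; case: p hf => [|p] hf.
    move=> /(_ [ffun=> 0]); rewrite PsiE (size0nil (size_enum_ord 0)) /= => f0.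
    by rewrite (homog0_const hf) f0 mpolyC0 raddf0.
  move=> [_ [h [hc hd]]]; have [Q eQ hQ] := Psi_surj hc.
  (* Injectivity of [Psi] lifts the equality of cochains to the Koszul complex, where the component
     at [set0] puts f in the ideal. *)
  have X0 : embed f - (-1) ^+ p *: delta Q = 0.
    apply: (homog_basis_zero (p := p.+1)).
      by rewrite linearB linearZ /= (euler_koszul_diff eQ) (euler_ext_poly hf) scalerBr !scalerA mulrC.
    move=> k x hx; rewrite PsiB (hd k x hx) (Psi_differential hr p Q k x hx).
    rewrite -sumrB big1 // => j _; rewrite -sumrB big1 // => i _.
    by rewrite hQ subrr.
  have fE : f = (-1) ^+ p *: delta Q set0.
    move/ffunP/(_ set0): X0; rewrite !ffunE eqxx => /eqP.
    by rewrite subr_eq0 => /eqP.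
  apply/quot0P; rewrite fE -mul_mpolyC idealMr // sum_ffunE rpred_sum // => l _.
  by rewrite !ffunE /= /xmul mulrC idealMr // (ideal_gen hI).
- move=> p h [hc hd]; have [Q eQ hQ] := Psi_surj hc.
  have dQ : delta Q = 0.
    apply: (homog_basis_zero (p := p.+1)); first exact: euler_koszul_diff.
    move=> k x hx; apply: (mulfI (_ : (-1) ^+ p != 0)); first by rewrite signr_eq0.
    rewrite mulr0 -PsiZ (Psi_differential hr p Q k x hx); apply: etrans (esym (hd k x hx)).
    by apply: eq_bigr => j _; apply: eq_bigr => i _; rewrite hQ.
  (* Modulo delta y, exactness leaves only the component c in exterior degree 0; its part of degree
     p gives the class sought. *)
  have [y hy] := hex dQ; pose c := (Q - delta y) set0.
  have QE : Q = delta y + embed c.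
    apply/ffunP=> S; have [->|S0] := eqVneq S set0.
      by rewrite /c !ffunE eqxx addrC subrK.
    have := hy S S0; rewrite !ffunE (negPf S0) addr0 => /eqP.
    by rewrite subr_eq0 => /eqP.
  exists (pi (pihomog mdeg p c)); first by exists (pihomog mdeg p c) => //; exact: pihomogP.
  rewrite /cohomologous /phi; set w := generic_quotient.repr _.
  have [Z hZ] := ext_poly_ideal (quot_repr I (pihomog mdeg p c)).
  rewrite (_ : (fun x => _) = Psi p (delta (y - Z))); first exact: coboundary_koszul_diff.
  apply/funext => x; rewrite hQ QE linearB /= -hZ PsiB PsiD (Psi_homog_part c).
  by rewrite linearB PsiB opprB addrA.
- move=> i j; rewrite /phi PsiE enum_ordSl /= (size0nil (size_enum_ord 0)) /= ffunE /dirder.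
  rewrite raddf_sum (bigD1 j) //= mxE !eqxx scale1r big1 ?addr0 => [|k /negPf kj]; last first.
    by rewrite mxE kj andbF scale0r mcoeff0.
  rewrite mcoeff_deriv add0m mnm0E mulr1n.
  have /(ideal_low hr hI (b := U_(j)%MM)) := quot_repr I 'X_i.
  rewrite mdeg1 mcoeffB mcoeffX eq_mnm1 => /(_ isT) /eqP.
  by rewrite subr_eq0 => /eqP.
Qed.

End Cohomology.

(** * The algebras AQ *)

Section AQ.
Variables (K : numFieldType) (n N1 N2 : nat).
Local Notation M := (N1 + N2)%N.
Local Notation V := (AQ_var n N1 N2).
Local Notation m := #|V|.
Local Notation rank := (@enum_rank V).
Local Notation idx := (AQ_index N1 N2).

Definition AQ_quadric (l : 'I_(2 * M).+1) : {mpoly K[m]} :=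
  AQ_rel K n N1 N2 ((l : nat)%:Z - (2 * N1)%:Z).

(* The term of index (s, t, Some i) is f^i[s] g_i[t], that of index
   (s, t, None) is h[s] h[t]. *)
Definition AQ_term := (idx * idx * option 'I_n)%type.

Definition lvar (p : AQ_term) : V :=
  if p.2 is Some i then inl (inl (i, p.1.1)) else inr p.1.1.

Definition rvar (p : AQ_term) : V :=
  if p.2 is Some i then inl (inr (i, p.1.2)) else inr p.1.2.

Definition term_mode (p : AQ_term) : nat := (p.1.1 + p.1.2)%N.

Definition term_mnm (p : AQ_term) : 'X_{1..m} :=
  (U_(rank (lvar p)) + U_(rank (rvar p)))%MM.

(** Indices are modes shifted by N1, so the condition on modes becomes s + t = l. *)
Lemma AQ_quadricE l : AQ_quadric l = \sum_(p | term_mode p == l) 'X_[term_mnm p].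
Proof.
rewrite /AQ_quadric /AQ_rel pair_big_dep /=.
rewrite (eq_bigl (fun st : idx * idx => st.1 + st.2 == l)%N); last first.
  by move=> [s t]; rewrite /mode /=; apply/eqP/eqP; lia.
pose F (st : idx * idx) (o : option 'I_n) : {mpoly K[m]} := 'X_[term_mnm (st, o)].
rewrite (eq_bigr (fun st => \sum_o F st o)) => [|[s t] _ /=].
  rewrite (pair_big_dep _ (fun=> xpredT) F) /=.
  by apply: eq_big => [[[s t] o]|[[s t] o] _] /=; rewrite ?andbT.
rewrite (bigD1 (None : option 'I_n)) //= [RHS]addrC /F /term_mnm /= mpolyXD.
congr (_ + _).
rewrite (reindex_omap Some id) => [|[i|] //].
apply: eq_big => [i|i _]; first by rewrite eqxx.
by rewrite /term_mnm /= mpolyXD.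
Qed.

Lemma AQ_quadric_homog l : AQ_quadric l \is 2.-homog.
Proof.
rewrite AQ_quadricE rpred_sum // => p _; rewrite dhomogX /=.
by rewrite /term_mnm mdegD !mdeg1.
Qed.

Lemma AQ_idealP (p : {mpoly K[m]}) : p \in @AQ_ideal K n N1 N2 <->
  exists c : 'I_(2 * M).+1 -> {mpoly K[m]}, p = \sum_l c l * AQ_quadric l.
Proof. by rewrite unfold_in; split=> /asboolP. Qed.

Lemma lrvar_inj p q : lvar p = lvar q -> rvar p = rvar q -> p = q.
Proof. by case: p q => [[s t] [i|]] [[s' t'] [j|]] //= [] // => [-> -> [->]|-> [->]]. Qed.

Lemma hess_AQ l (x y : V) : hess AQ_quadric l (rank x) (rank y) =
  \sum_(p | term_mode p == l) (((lvar p == x) && (rvar p == y))%:R +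
                               ((lvar p == y) && (rvar p == x))%:R).
Proof.
rewrite /hess AQ_quadricE (raddf_sum (mderiv (rank y))) (raddf_sum (mderiv (rank x))) raddf_sum.
apply: eq_bigr => p _ /=; rewrite /term_mnm mpolyXD deriv2_varM.
by rewrite !(inj_eq enum_rank_inj).
Qed.

(** The indices are l/2 rounded down and up; for l <= 2 M both are in range, so [inord] keeps their
    values. *)
Definition balanced_term (o : option 'I_n) (l : nat) : AQ_term :=
  (inord l./2, inord (uphalf l), o).

Lemma inord_half (l : 'I_(2 * M).+1) :
  (inord l./2 : idx) = l./2 :> nat /\ (inord (uphalf l) : idx) = uphalf l :> nat.
Proof.
have := ltn_ord l; move: (l : nat) => k kM.
by split; rewrite inordK //; lia.
Qed.

Lemma term_modeE o (l : 'I_(2 * M).+1) : term_mode (balanced_term o l) = l.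
Proof.
have [e1 e2] := inord_half l; rewrite /term_mode /= e1 e2.
by move: (l : nat) => k; lia.
Qed.

Lemma sum_indicator (I : finType) (C : pred I) (q : I) :
  \sum_(p | C p) (p == q)%:R = (C q)%:R :> K.
Proof.
rewrite big_mkcond (bigD1 q) //= eqxx big1 ?addr0 => [|p /negPf ->]; last by case: ifP.
by case: (C q).
Qed.

(** The factor 2 is uniform: for distinct s and t the product h[s] h[t] occurs in both orders, and
    for s = t it is a square, whose second derivative is 2. *)
Lemma hess_term (k l : 'I_(2 * M).+1) o :
  hess AQ_quadric k (rank (lvar (balanced_term o l))) (rank (rvar (balanced_term o l))) =
  (if o is Some _ then 1 else 2) * (k == l)%:R.
Proof.
rewrite hess_AQ big_split /=.
under eq_bigr => p _.
  rewrite (_ : _ && _ = (p == balanced_term o l)); first over.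
  by apply/andP/eqP => [[/eqP h1 /eqP h2]|-> //]; exact: lrvar_inj.
rewrite sum_indicator term_modeE eq_sym val_eqE.
case: o => [i|].
  rewrite big1 ?addr0 ?mul1r // => p _; case: p => [[s t] [j|]] //=.
pose p' : AQ_term := (inord (uphalf l), inord l./2, None).
under [X in _ + X]eq_bigr => p _.
  rewrite (_ : _ && _ = (p == p')); first over.
  apply/andP/eqP => [[/eqP h1 /eqP h2]|-> //].
  by apply: lrvar_inj; [exact: h1|exact: h2].
rewrite sum_indicator (_ : term_mode p' = l) ?val_eqE ?[l == k]eq_sym -?mulr2n ?mulr_natl //.
by rewrite /term_mode addnC -[RHS](term_modeE None).
Qed.

Lemma hess_AQ0 l (x y : V) : (forall p, lvar p = x -> rvar p <> y) ->
  (forall p, lvar p = y -> rvar p <> x) -> hess AQ_quadric l (rank x) (rank y) = 0.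
Proof.
move=> xy yx; rewrite hess_AQ; apply: big1 => p _.
have -> : (lvar p == x) && (rvar p == y) = false by apply/negP => /andP[/eqP/xy h /eqP].
have -> : (lvar p == y) && (rvar p == x) = false by apply/negP => /andP[/eqP/yx h /eqP].
exact: addr0.
Qed.

Lemma hess_AQ_hvar0 k v (s : idx) :
  hess AQ_quadric k (rank (inl v)) (rank (inr s)) = 0.
Proof. by apply: hess_AQ0 => -[[s' t] [i|]]. Qed.

Variable i0 : 'I_n.

Definition lead (l : 'I_(2 * M).+1) : AQ_term :=
  balanced_term (if odd l then Some i0 else None) l.

(* The cost of h[s] is (2 s)^2, that of f^i[s] is (2 s + 1)^2 and that of g_i[t]
   is (2 t - 1)^2, with a penalty of 1 if i != i0; leading monomials have minimal
   cost. *)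
Definition cost (x : V) : nat :=
  match x with
  | inl (inl (i, s)) => (2 * s + 1) ^ 2 + (i != i0)
  | inl (inr (i, t)) => 4 * t ^ 2 + 1 - 4 * t + (i != i0)
  | inr s => (2 * s) ^ 2
  end%N.

(** Every monomial of r[l] has two factors, so subtracting costs from a constant turns least cost
    into greatest weight. The constant bounds [cost], which keeps the truncated subtraction
    exact. *)
Definition weight (i : 'I_m) : nat := ((2 * M + 1) ^ 2 + 1 - cost (enum_val i))%N.

Lemma cost_le x : (cost x <= (2 * M + 1) ^ 2 + 1)%N.
Proof.
have sq (k : idx) : (k * k <= M * M)%N /\ (k <= M)%N by rewrite leq_mul -ltnS.
case: x => [[[i s]|[i t]]|s] /=; rewrite -!mulnn.
- by have [] := sq s; move: (s : nat) => k; case: (i != i0); lia.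
- by have [] := sq t; move: (t : nat) => k; case: (i != i0); lia.
- by have [] := sq s; move: (s : nat) => k; lia.
Qed.

Lemma cost_lead l : (cost (lvar (lead l)) + cost (rvar (lead l)) = 2 * l ^ 2)%N.
Proof.
have [e1 e2] := inord_half l; rewrite /lead /balanced_term /cost /lvar /rvar /=.
rewrite -[in RHS](odd_double_half l) -muln2.
case: ifP => lo /=; rewrite ?eqxx /= e1 e2 uphalf_half lo; move: (l./2) => k.
  by rewrite -!mulnn; lia.
by rewrite -!mulnn; lia.
Qed.

Lemma sq_le x y : (2 * (x ^ 2 + y ^ 2) <= (x + y) ^ 2)%N -> x = y.
Proof.
move=> h; apply/eqP; rewrite -(nat_Cauchy x y).2.
by have := (nat_Cauchy x y).1; move: h; rewrite -!mulnn; lia.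
Qed.

(* Completing squares: the cost of a term exceeds 2 l^2 by 2 (s - t)^2 for
   h[s] h[t] and by 2 (s + 1 - t)^2 or more for f^i[s] g_i[t]. *)
Lemma cost_gt (l : 'I_(2 * M).+1) p : term_mode p = l -> p != lead l ->
  (2 * l ^ 2 < cost (lvar p) + cost (rvar p))%N.
Proof.
case: p => [[s t] o]; rewrite /term_mode /= => e; rewrite ltnNge; apply: contra => h.
have [e1 e2] := inord_half l; apply/eqP; rewrite /lead /balanced_term.
suff [st tl oE] : [/\ s = l./2 :> nat, t = uphalf l :> nat & o = if odd l then Some i0 else None].
  by rewrite -oE; congr (_, _, _); apply/val_inj; rewrite /= ?e1 ?e2.
move: h; rewrite -e /lvar /rvar /cost; case: o => [i|] /= h.
  have [ii0 ts] : (i == i0) /\ (t = s.+1 :> nat).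
    (* f^i[s] sits at 2 s + 1 and g_i[t] at 2 t - 1, so balance means t = s + 1; any penalty for i
       exceeds the available slack. *)
    have := (nat_Cauchy s.+1 t).1; move: h; rewrite -!mulnn.
    move: (s : nat) (t : nat) => x y h1 h2; split.
      by apply: contraLR h1; move=> -> /=; lia.
    apply/esym/sq_le; rewrite -!mulnn; lia.
  by rewrite ts (eqP ii0) addnS /= oddD addbb addnn doubleK uphalf_double.
have -> : t = s :> nat.
  by apply/esym/sq_le; move: h; rewrite -!mulnn; move: (s : nat) (t : nat) => x y; lia.
by rewrite addnn odd_double uphalf_half odd_double doubleK.
Qed.

Definition lead_mnm (l : 'I_(2 * M).+1) : 'X_{1..m} := term_mnm (lead l).

(** For a product of two distinct variables this is the smaller exponent; for h[s]^2 it is half the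
    exponent, rounded down. *)
Definition lead_val (l : 'I_(2 * M).+1) (b : 'X_{1..m}) : nat :=
  if odd l then minn (b (rank (lvar (lead l)))) (b (rank (rvar (lead l))))
  else (b (rank (lvar (lead l))))./2.

Lemma lead_var (l : 'I_(2 * M).+1) :
  if odd l then exists v w, lvar (lead l) = inl (inl v) /\ rvar (lead l) = inl (inr w)
  else exists s, lvar (lead l) = inr s /\ rvar (lead l) = inr s.
Proof.
rewrite /lead /balanced_term /lvar /rvar; case: ifP => lo /=.
  by rewrite lo; exists (i0, inord l./2), (i0, inord (uphalf l)).
by rewrite lo; exists (inord l./2); rewrite uphalf_half lo add0n.
Qed.

Lemma lvar_lead_inj : injective (fun l => lvar (lead l)).
Proof.
move=> k l; have [ek _] := inord_half k; have [el _] := inord_half l.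
rewrite /lead /balanced_term /lvar; case: ifP => ko; case: ifP => lo //= [e]; apply/val_inj => /=;
  move: ek ko lo; rewrite e el; move: (k : nat) (l : nat) => x y; lia.
Qed.

Lemma rvar_lead_inj : injective (fun l => rvar (lead l)).
Proof.
move=> k l; have [_ ek] := inord_half k; have [_ el] := inord_half l.
rewrite /lead /balanced_term /rvar; case: ifP => ko; case: ifP => lo //= [e]; apply/val_inj => /=;
  move: ek ko lo; rewrite e el; move: (k : nat) (l : nat) => x y; lia.
Qed.

(** By injectivity of [lvar] and [rvar] on leading terms, leading monomials of different l share no
    variable; for l = k the minimum or the half grows by exactly one. *)
Lemma lead_valD l k b : lead_val l (b + lead_mnm k)%MM = (lead_val l b + (l == k))%N.
Proof.
rewrite /lead_val /lead_mnm /term_mnm !mnmDE !mnm1E !(inj_eq enum_rank_inj).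
rewrite (inj_eq lvar_lead_inj) (inj_eq rvar_lead_inj) [k == l]eq_sym.
have := lead_var l; have := lead_var k; have [->|lk] := eqVneq l k.
  case: (odd k) => -[s].
    by move=> [t [-> ->]] _ /=; lia.
  by move=> [-> ->] _; rewrite eqxx; lia.
case: (odd l); case: (odd k) => -[s].
- by move=> [t [-> ->]] [u [w [-> ->]]] /=; lia.
- by move=> [-> ->] [u [w [-> ->]]] /=; lia.
- by move=> [t [_ ->]] [u [-> _]] /=; lia.
- move=> [e1 e2] _; rewrite e2 -e1 (inj_eq lvar_lead_inj) eq_sym (negPf lk); lia.
Qed.

Lemma lead_val_le l b : lead_val l b != 0%N -> (lead_mnm l <= b)%MM.
Proof.
rewrite /lead_val /lead_mnm /term_mnm => h; apply/mnm_lepP => x; rewrite mnmDE !mnm1E.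
have := lead_var l; move: h; case: (odd l) => h [].
  move=> v [w [e1 e2]]; move: h; rewrite e1 e2.
  have [<-|_] := eqVneq (rank (inl (inl v))) x.
    by rewrite (inj_eq enum_rank_inj) /=; lia.
  by have [<-|_] := eqVneq (rank (inl (inr w))) x => //; lia.
move=> s [e1 e2]; move: h; rewrite e1 e2.
by have [<-|_] := eqVneq (rank (inr s)) x => //; lia.
Qed.

Lemma mweight_term p :
  mweight weight (term_mnm p) = (weight (rank (lvar p)) + weight (rank (rvar p)))%N.
Proof.
have h (i : 'I_m) : mweight weight U_(i) = weight i.
  rewrite /mweight (bigD1 i) //= mnm1E eqxx mul1n big1 ?addn0 // => j ji.
  by rewrite mnm1E eq_sym (negPf ji).
by rewrite /term_mnm mweightD !h.
Qed.

Lemma lead_low l b : b \in msupp (AQ_quadric l - 'X_[lead_mnm l]) ->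
  (mweight weight b < mweight weight (lead_mnm l))%N.
Proof.
rewrite mcoeff_msupp AQ_quadricE (bigD1 (lead l)) /= ?term_modeE //.
rewrite addrAC subrr add0r raddf_sum => /sum_neq0[p /andP[/eqP pl pn]] /=.
rewrite mcoeffX; have [<- _|_] := eqVneq (term_mnm p) b; last by rewrite eqxx.
rewrite /lead_mnm !mweight_term /weight !enum_rankK.
have := cost_gt pl pn; rewrite -cost_lead.
have := (cost_le (lvar p), cost_le (rvar p));
  have := (cost_le (lvar (lead l)), cost_le (rvar (lead l))).
move=> [h1 h2] [h3 h4]; lia.
Qed.

Lemma AQ_hess_gen (l k : 'I_(2 * M).+1) :
  hess AQ_quadric k (rank (lvar (balanced_term (Some i0) l))) (rank (rvar (balanced_term (Some i0) l))) =
  (k == l)%:R.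
Proof. by rewrite hess_term mul1r. Qed.

(** No term mixes h with f or g. If u is an f or a g, the pair (i, j) consists of h's and c = 2; if
    u is an h, it consists of an f and a g and c = 1. *)
Lemma AQ_hess_central (l : 'I_(2 * M).+1) (u : 'I_m) : exists i j (c : K),
  [/\ c != 0, forall k, hess AQ_quadric k i j = c * (k == l)%:R,
      forall k, hess AQ_quadric k u i = 0 & forall k, hess AQ_quadric k u j = 0].
Proof.
rewrite -(enum_valK u); case: (enum_val u) => [v|s].
  exists (rank (lvar (balanced_term None l))), (rank (rvar (balanced_term None l))), 2.
  split=> [|k|k|k]; [by rewrite pnatr_eq0|exact: hess_term| |].
    exact: hess_AQ_hvar0.
  exact: hess_AQ_hvar0.
exists (rank (lvar (balanced_term (Some i0) l))), (rank (rvar (balanced_term (Some i0) l))), 1.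
split=> [|k|k|k]; [exact: oner_neq0|exact: hess_term| |].
  by rewrite hessC; exact: hess_AQ_hvar0.
by rewrite hessC; exact: hess_AQ_hvar0.
Qed.

Lemma AQ_koszul : koszul (@AQ_gr K n N1 N2).
Proof.
pose I : idealr {mpoly K[m]} := @AQ_ideal K n N1 N2.
exists m, (@qvar K m I); split.
  exact: quot_quadratic AQ_quadric_homog AQ_idealP.
exists (qlie AQ_quadric), (fun i => bas AQ_quadric (inl i)); split.
  exact: (quot_koszul_dual AQ_quadric_homog AQ_idealP AQ_hess_gen AQ_hess_central).
eexists; apply: (phi_cohomology AQ_quadric_homog AQ_idealP).
move=> z; exact: (koszul_exact lead_valD lead_val_le lead_low).
Qed.

End AQ.

Theorem theorem14 (R : realType) (n N1 N2 : nat) (hn : (1 <= n)%N) :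
  koszul (@AQ_gr R[i] n N1 N2).
Proof. exact: AQ_koszul (Ordinal hn). Qed.
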